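(* Let $\boldsymbol{f}\in\boldsymbol{V}_h^*$. There exists at least one $(\boldsymbol{u}_h,\boldsymbol{B}_h,p_h,r_h)\in\tilde{\boldsymbol{X}}_h\times\boldsymbol{Y}_h$ such that, with $\tilde{\boldsymbol{\xi}}_h=(\boldsymbol{u}_h,\boldsymbol{B}_h)$ and $\boldsymbol{x}_h=(p_h,r_h)$, $$\tilde{\boldsymbol{a}}(\tilde{\boldsymbol{\xi}}_h;\tilde{\boldsymbol{\xi}}_h,\tilde{\boldsymbol{\eta}}_h)+\boldsymbol{b}(\tilde{\boldsymbol{\eta}}_h,\boldsymbol{x}_h)=\langle\boldsymbol{f},\boldsymbol{v}_h\rangle\quad\forall\,\tilde{\boldsymbol{\eta}}_h=(\boldsymbol{v}_h,\boldsymbol{C}_h)\in\tilde{\boldsymbol{X}}_h,\qquad \boldsymbol{b}(\tilde{\boldsymbol{\xi}}_h,\boldsymbol{y}_h)=0\quad\forall\,\boldsymbol{y}_h\in\boldsymbol{Y}_h.$$ Therefore there exists at least one $(\boldsymbol{u}_h,\boldsymbol{j}_h,\boldsymbol{\sigma}_h,\boldsymbol{B}_h,p_h,r_h)\in\boldsymbol{X}_h\times\boldsymbol{Y}_h$ such that, for all $(\boldsymbol{v}_h,\boldsymbol{k}_h,\boldsymbol{\tau}_h,\boldsymbol{C}_h,q_h,s_h)\in\boldsymbol{X}_h\times\boldsymbol{Y}_h$, $$\begin{aligned} &R_e^{-1}(\nabla\boldsymbol{u}_h,\nabla\boldsymbol{v}_h)+L(\boldsymbol{u}_h;\boldsymbol{u}_h,\boldsymbol{v}_h)+S(\boldsymbol{j}_h,\boldsymbol{v}_h\times\boldsymbol{B}_h)-(p_h,\nabla\cdot\boldsymbol{v}_h)=\langle\boldsymbol{f},\boldsymbol{v}_h\rangle,\\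 &SR_m^{-1}(\nabla\times\boldsymbol{j}_h,\boldsymbol{C}_h)-SR_m^{-1}(\nabla\times\boldsymbol{\sigma}_h,\boldsymbol{C}_h)+(r_h,\nabla\cdot\boldsymbol{C}_h)=0,\\ &SR_m^{-1}(\boldsymbol{\sigma}_h,\boldsymbol{\tau}_h)-SR_m^{-1}(\boldsymbol{u}_h\times\boldsymbol{B}_h,\boldsymbol{\tau}_h)=0,\\ &S(\boldsymbol{j}_h,\boldsymbol{k}_h)-SR_m^{-1}(\boldsymbol{B}_h,\nabla\times\boldsymbol{k}_h)=0,\\ &-(\nabla\cdot\boldsymbol{u}_h,q_h)=0,\qquad(\nabla\cdot\boldsymbol{B}_h,s_h)=0. \end{aligned}$$
   Context: $\Omega\subset\mathbb{R}^3$ is a bounded contractible Lipschitz polyhedron; $R_e,R_m,S>0$ are constants. $(\cdot,\cdot)$ and $\|\cdot\|$ are the $L^2(\Omega)$ inner product and norm. $H_0(\mathrm{curl},\Omega)$ and $H_0(\mathrm{div},\Omega)$ are the usual spaces with vanishing tangential, respectively normal, trace; $L^2_0(\Omega)$ is the space of mean-zero $L^2$ functions. On a regular quasi-uniform (tetrahedral) triangulation of $\Omega$ with mesh size $h$, the finite element spaces $H_0^h(\mathrm{grad},\Omega)\subset H^1_0(\Omega)$, $H_0^h(\mathrm{curl},\Omega)\subset H_0(\mathrm{curl},\Omega)$, $H_0^h(\mathrm{div},\Omega)\subset H_0(\mathrm{div},\Omega)$, $L^2_{0,h}(\Omega)\subset L^2_0(\Omega)$ belong to one finite element de Rham sequence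 (Lagrange, Nédélec edge elements of first or second kind, Raviart–Thomas or BDM face elements, discontinuous piecewise polynomials); grad, curl, div map each space into the next, the sequence is exact, and $\nabla\cdot H_0^h(\mathrm{div},\Omega)=L^2_{0,h}(\Omega)$. $\boldsymbol{V}_h\subset H_0^1(\Omega)^3$ and $Q_h\subset L^2_0(\Omega)$ are a stable (inf-sup) finite element pair for the Stokes problem. $\boldsymbol{X}_h:=\boldsymbol{V}_h\times H_0^h(\mathrm{curl},\Omega)\times H_0^h(\mathrm{curl},\Omega)\times H_0^h(\mathrm{div},\Omega)$, $\tilde{\boldsymbol{X}}_h:=\boldsymbol{V}_h\times H_0^h(\mathrm{div},\Omega)$, $\boldsymbol{Y}_h:=Q_h\times L^2_{0,h}(\Omega)$. The discrete curl $\nabla_h\times\boldsymbol{C}_h\in H_0^h(\mathrm{curl},\Omega)$ of $\boldsymbol{C}_h\in H_0^h(\mathrm{div},\Omega)$ is defined by $(\nabla_h\times\boldsymbol{C}_h,\boldsymbol{F}_h)=(\boldsymbol{C}_h,\nabla\times\boldsymbol{F}_h)$ for all $\boldsymbol{F}_h\in H_0^h(\mathrm{curl},\Omega)$. $L(\boldsymbol{w};\boldsymbol{u},\boldsymbol{v}):=\frac12[((\boldsymbol{w}\cdot\nabla)\boldsymbol{u},\boldsymbol{v})-((\boldsymbol{w}\cdot\nabla)\boldsymbol{v},\boldsymbol{u})]$. For $\tilde{\boldsymbol{\psi}}_h=(\boldsymbol{w}_h,\boldsymbol{G}_h)$, $\tilde{\boldsymbol{\xi}}_h=(\boldsymbol{u}_h,\boldsymbol{B}_h)$,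 $\tilde{\boldsymbol{\eta}}_h=(\boldsymbol{v}_h,\boldsymbol{C}_h)$ in $\tilde{\boldsymbol{X}}_h$ and $\boldsymbol{y}_h=(q_h,s_h)\in\boldsymbol{Y}_h$, $$\begin{aligned}\tilde{\boldsymbol{a}}(\tilde{\boldsymbol{\psi}}_h;\tilde{\boldsymbol{\xi}}_h,\tilde{\boldsymbol{\eta}}_h):=\;&R_e^{-1}(\nabla\boldsymbol{u}_h,\nabla\boldsymbol{v}_h)+L(\boldsymbol{w}_h;\boldsymbol{u}_h,\boldsymbol{v}_h)+SR_m^{-1}(\nabla_h\times\boldsymbol{B}_h,\boldsymbol{v}_h\times\boldsymbol{G}_h)\\&-SR_m^{-1}(\boldsymbol{u}_h\times\boldsymbol{G}_h,\nabla_h\times\boldsymbol{C}_h)+SR_m^{-2}(\nabla_h\times\boldsymbol{B}_h,\nabla_h\times\boldsymbol{C}_h),\end{aligned}$$ $$\boldsymbol{b}(\tilde{\boldsymbol{\xi}}_h,\boldsymbol{y}_h):=-(\nabla\cdot\boldsymbol{u}_h,q_h)+(\nabla\cdot\boldsymbol{B}_h,s_h).$$ *)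

(* Defs.v *)
(* Points of R^3 are triples (so that Lebesgue measure is
   an iterated product measure); vector values are row vectors.  Elements of
   L^2(Omega) and of its subspaces are represented by functions; only their
   restriction to Omega, up to null sets, matters. *)
From HB Require Import structures.
From mathcomp Require Import all_boot all_order all_algebra.
From mathcomp Require Import all_classical all_reals all_analysis.

Set Implicit Arguments.
Unset Strict Implicit.
Unset Printing Implicit Defensive.

Import Order.TTheory GRing.Theory Num.Theory numFieldNormedType.Exports.

Local Open Scope classical_set_scope.
Local Open Scope ring_scope.

Definition pt (R : realType) := (R * R * R)%type.
Definition sfield (R : realType) := pt R -> R.
Definition vfield (R : realType) := pt R -> 'rV[R]_3.

(* The same type as pt R, with the Borel sigma-algebra for which
   lebesgue_measure is declared. *)
Definition mpt (R : realType) :=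
  (measurableTypeR R * measurableTypeR R * measurableTypeR R)%type.

Definition leb3 (R : realType) : {measure set (mpt R) -> \bar R} :=
  ((@lebesgue_measure R \x @lebesgue_measure R) \x @lebesgue_measure R)%E.

Definition vec (R : realType) (x : pt R) : 'rV[R]_3 :=
  \row_i [:: x.1.1; x.1.2; x.2]`_i.

Definition basis3 (R : realType) (i : 'I_3) : pt R :=
  ((i == 0)%:R, (i == 1)%:R, (i == 2%:R)%:R).

(* Indices in 'I_3 are added modulo 3, so the k-th component is
   u_(k+1) v_(k+2) - u_(k+2) v_(k+1). *)
Definition cross (R : realType) (u v : 'rV[R]_3) : 'rV[R]_3 :=
  \row_k (u 0 (k + 1) * v 0 (k + 2%:R) - u 0 (k + 2%:R) * v 0 (k + 1)).

Definition enorm (R : realType) (v : 'rV[R]_3) : R :=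
  Num.sqrt (\sum_i v 0 i ^+ 2).

Definition edist (R : realType) (x y : pt R) : R := enorm (vec x - vec y).

Definition L2 (R : realType) (Omega : set (pt R)) (f : sfield R) : Prop :=
  @measurable_fun _ _ (mpt R) R Omega f /\
  (leb3 R).-integrable Omega (fun x => (f x ^+ 2)%:E).

Definition L2v (R : realType) (Omega : set (pt R)) (F : vfield R) : Prop :=
  forall i, L2 Omega (fun x => F x 0 i).

Definition sip (R : realType) (Omega : set (pt R)) (f g : sfield R) : R :=
  \int[leb3 R]_(x in Omega) (f x * g x).

(* \tr (A *m B^T) is the entrywise product: the dot product of row vectors,
   the Frobenius product of square matrices. *)
Definition mip (R : realType) (m n : nat) (Omega : set (pt R))
    (F G : pt R -> 'M[R]_(m, n)) : R :=
  \int[leb3 R]_(x in Omega) \tr (F x *m (G x)^T).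

Definition L20 (R : realType) (Omega : set (pt R)) : set (sfield R) :=
  [set f | L2 Omega f /\ \int[leb3 R]_(x in Omega) f x = 0].

Definition pd (R : realType) (i : 'I_3) (f : sfield R) : sfield R :=
  fun x => 'D_(basis3 R i) f x.

Definition smooth (R : realType) (f : sfield R) : Prop :=
  forall s : seq 'I_3, let g := foldr (@pd R) f s in
    continuous g /\ forall x i, derivable g x (basis3 R i).

Definition test_fun (R : realType) (Omega : set (pt R)) (f : sfield R) : Prop :=
  let supp := closure [set x | f x != 0] in
  [/\ smooth f, compact supp & supp `<=` Omega].

Definition smoothv (R : realType) (F : vfield R) : Prop :=
  forall i, smooth (fun x => F x 0 i).

Definition test_field (R : realType) (Omega : set (pt R)) (F : vfield R) : Prop :=
  forall i, test_fun Omega (fun x => F x 0 i).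

Definition grad (R : realType) (f : sfield R) : vfield R :=
  fun x => \row_i pd i f x.

(* Cyclic indices, as in cross. *)
Definition curl (R : realType) (F : vfield R) : vfield R := fun x =>
  \row_k (pd (k + 1) (fun y => F y 0 (k + 2%:R)) x
        - pd (k + 2%:R) (fun y => F y 0 (k + 1)) x).

(* Weak derivatives are taken in L^2(Omega).  They are unique up to null
    sets; the operators below pick a representative when one exists. *)

Definition is_wpd (R : realType) (Omega : set (pt R)) (i : 'I_3)
    (u g : sfield R) : Prop :=
  L2 Omega g /\
  forall phi, test_fun Omega phi -> sip Omega u (pd i phi) = - sip Omega g phi.

Definition is_wcurl (R : realType) (Omega : set (pt R)) (F G : vfield R) : Prop :=
  L2v Omega G /\
  forall Phi, test_field Omega Phi -> mip Omega F (curl Phi) = mip Omega G Phi.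

Definition is_wdiv (R : realType) (Omega : set (pt R)) (F : vfield R)
    (g : sfield R) : Prop :=
  L2 Omega g /\
  forall phi, test_fun Omega phi -> mip Omega F (grad phi) = - sip Omega g phi.

Definition wpd (R : realType) (Omega : set (pt R)) (i : 'I_3) (u : sfield R)
    : sfield R := get [set g : sfield R | is_wpd Omega i u g].

Definition wgrad (R : realType) (Omega : set (pt R)) (u : sfield R) : vfield R :=
  fun x => \row_i wpd Omega i u x.

Definition wcurl (R : realType) (Omega : set (pt R)) (F : vfield R) : vfield R :=
  get [set G : vfield R | is_wcurl Omega F G].

Definition wdiv (R : realType) (Omega : set (pt R)) (F : vfield R) : sfield R :=
  get [set g : sfield R | is_wdiv Omega F g].

(* Entry (i, j) is d_i u_j, so that (w . nabla) u is w *m wgradv u. *)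
Definition wgradv (R : realType) (Omega : set (pt R)) (u : vfield R)
    : pt R -> 'M[R]_3 :=
  fun x => \matrix_(i, j) wpd Omega i (fun y => u y 0 j) x.

Definition H1 (R : realType) (Omega : set (pt R)) : set (sfield R) :=
  [set u | L2 Omega u /\ forall i, exists g, is_wpd Omega i u g].

(* Closure of the test functions in the H^1 norm. *)
Definition H10 (R : realType) (Omega : set (pt R)) : set (sfield R) :=
  [set u | H1 Omega u /\ forall e : R, 0 < e -> exists2 phi,
    test_fun Omega phi &
    let d x := u x - phi x in
    let D x := wgrad Omega u x - grad phi x in
    sip Omega d d + mip Omega D D < e].

Definition H10v (R : realType) (Omega : set (pt R)) : set (vfield R) :=
  [set u | forall j, H10 Omega (fun x => u x 0 j)].

(* The tangential (resp. normal) trace is the functional of the fields (resp.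
   functions) smooth up to the boundary given by Green's formula. *)
Definition H0curl (R : realType) (Omega : set (pt R)) : set (vfield R) :=
  [set F | [/\ L2v Omega F, (exists G, is_wcurl Omega F G) &
    forall Phi, smoothv Phi ->
      mip Omega (wcurl Omega F) Phi - mip Omega F (curl Phi) = 0]].

Definition H0div (R : realType) (Omega : set (pt R)) : set (vfield R) :=
  [set F | [/\ L2v Omega F, (exists g, is_wdiv Omega F g) &
    forall phi, smooth phi ->
      sip Omega (wdiv Omega F) phi + mip Omega F (grad phi) = 0]].

Definition h1norm (R : realType) (Omega : set (pt R)) (u : vfield R) : R :=
  Num.sqrt (mip Omega u u + mip Omega (wgradv Omega u) (wgradv Omega u)).

Definition simplex (R : realType) : Type := 4.-tuple (pt R).

(* The face spanned by the vertices in S; empty if S is. *)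
Definition face (R : realType) (K : simplex R) (S : {set 'I_4}) : set (pt R) :=
  [set x | exists l : 'I_4 -> R,
    [/\ forall i, 0 <= l i, forall i, i \notin S -> l i = 0,
        \sum_i l i = 1 & x = \sum_i l i *: tnth K i]].

Definition tetra (R : realType) (K : simplex R) : set (pt R) :=
  face K [set: 'I_4]%SET.

Definition nondegenerate (R : realType) (K : simplex R) : Prop :=
  forall l : 'I_4 -> R,
    \sum_i l i = 0 -> \sum_i l i *: tnth K i = 0 -> forall i, l i = 0.

Definition mesh (R : realType) : Type := seq (simplex R).

Definition mesh_cover (R : realType) (Th : mesh R) : set (pt R) :=
  [set x | exists2 K, K \in Th & tetra K x].

Definition lipschitz_boundary (R : realType) (Omega : set (pt R)) : Prop :=
  forall x0, (closure Omega `\` Omega) x0 ->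
  exists (Q : 'M[R]_3) (e L : R) (g : R * R -> R),
  [/\ Q *m Q^T = 1%:M, 0 < e, L.-lipschitz (g : R * R -> R^o) &
      forall x, edist x x0 < e -> let y := vec x *m Q in
        (Omega x <-> g (y 0 0, y 0 1) < y 0 2%:R)].

Definition bounded_lipschitz_polyhedron (R : realType) (Omega : set (pt R)) : Prop :=
  [/\ open Omega, bounded_set Omega, lipschitz_boundary Omega &
      exists Th : mesh R, (forall K, K \in Th -> nondegenerate K) /\
        closure Omega = mesh_cover Th].

Definition contractible (R : realType) (Omega : set (pt R)) : Prop :=
  exists (x0 : pt R) (H : R * pt R -> pt R),
  [/\ Omega x0,
      {within `[0, 1]%classic `*` Omega, continuous H},
      forall t x, 0 <= t <= 1 -> Omega x -> Omega (H (t, x)),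
      forall x, Omega x -> H (0, x) = x &
      forall x, Omega x -> H (1, x) = x0].

Definition triangulation (R : realType) (Omega : set (pt R)) (Th : mesh R) : Prop :=
  [/\ forall K, K \in Th -> nondegenerate K,
      closure Omega = mesh_cover Th &
      forall K K', K \in Th -> K' \in Th -> exists S S' : {set 'I_4},
        tetra K `&` tetra K' = face K S /\ tetra K `&` tetra K' = face K' S'].

(* h is the largest diameter; every tetrahedron contains a ball of radius
   c h, which expresses both shape regularity and quasi-uniformity. *)
Definition regular_quasi_uniform (R : realType) (c h : R) (Th : mesh R) : Prop :=
  [/\ forall K i j, K \in Th -> edist (tnth K i) (tnth K j) <= h,
      exists K i j, K \in Th /\ edist (tnth K i) (tnth K j) = h &
      forall K, K \in Th -> exists x0, forall x, edist x x0 <= c * h -> tetra K x].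

Definition refines (R : realType) (Th' Th : mesh R) : Prop :=
  forall K', K' \in Th' -> exists2 K, K \in Th & tetra K' `<=` tetra K.

Definition poly_fun (R : realType) (k : nat) : set (sfield R) :=
  [set f | exists c : nat -> nat -> nat -> R, forall x,
    f x = \sum_(i < k.+1) \sum_(j < k.+1) \sum_(l < k.+1 | (i + j + l <= k)%N)
            c i j l * x.1.1 ^+ i * x.1.2 ^+ j * x.2 ^+ l].

Definition poly_field (R : realType) (k : nat) : set (vfield R) :=
  [set F | forall i, poly_fun k (fun x => F x 0 i)].

Definition piecewise (R : realType) (T : Type) (Th : mesh R)
    (P : set (pt R -> T)) : set (pt R -> T) :=
  [set F | forall K, K \in Th -> exists2 p, P p & ae_eq (leb3 R) (tetra K) F p].

Variant edge_kind := Nedelec1 | Nedelec2.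
Variant face_kind := RaviartThomas | BDM.

(* First kind, order k > 0: P_(k-1)^3 + x * P_(k-1)^3 (cross product). *)
Definition edge_local (R : realType) (e : edge_kind) (k : nat) : set (vfield R) :=
  match e with
  | Nedelec1 => [set F | exists p q, [/\ poly_field k.-1 p, poly_field k.-1 q &
                   forall x, F x = p x + cross (vec x) (q x)]]
  | Nedelec2 => poly_field k
  end.

(* Raviart-Thomas, order k > 0: P_(k-1)^3 + x P_(k-1). *)
Definition face_local (R : realType) (d : face_kind) (k : nat) : set (vfield R) :=
  match d with
  | RaviartThomas => [set F | exists p q, [/\ poly_field k.-1 p, poly_fun k.-1 q &
                        forall x, F x = p x + q x *: vec x]]
  | BDM => poly_field k
  end.

(* A finite element de Rham sequence is determined by the degree of the
   discontinuous polynomials and the kinds of face and edge elements.  The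
   derivative lowers the polynomial degree by one into or from a full
   polynomial space of forms (BDM, second kind), while the order is preserved
   out of a Raviart-Thomas or first kind space counted with order k > 0. *)
Record deRham_kind := DeRhamKind {
  dg_degree : nat; face_elt : face_kind; edge_elt : edge_kind }.

Definition face_order (D : deRham_kind) : nat := (dg_degree D).+1.

Definition edge_order (D : deRham_kind) : nat :=
  if face_elt D is RaviartThomas then face_order D else (face_order D).+1.

Definition lagrange_degree (D : deRham_kind) : nat :=
  if edge_elt D is Nedelec1 then edge_order D else (edge_order D).+1.

Definition H0hgrad (R : realType) (Omega : set (pt R)) (Th : mesh R)
    (D : deRham_kind) : set (sfield R) :=
  H10 Omega `&` piecewise Th (poly_fun (lagrange_degree D)).

Definition H0hcurl (R : realType) (Omega : set (pt R)) (Th : mesh R)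
    (D : deRham_kind) : set (vfield R) :=
  H0curl Omega `&` piecewise Th (edge_local (edge_elt D) (edge_order D)).

Definition H0hdiv (R : realType) (Omega : set (pt R)) (Th : mesh R)
    (D : deRham_kind) : set (vfield R) :=
  H0div Omega `&` piecewise Th (face_local (face_elt D) (face_order D)).

Definition L20h (R : realType) (Omega : set (pt R)) (Th : mesh R)
    (D : deRham_kind) : set (sfield R) :=
  L20 Omega `&` piecewise Th (poly_fun (dg_degree D)).

Definition exact_sequence (R : realType) (Omega : set (pt R))
    (Vg : set (sfield R)) (Vc Vd : set (vfield R)) (Vl : set (sfield R)) : Prop :=
  let ae T (f g : pt R -> T) := ae_eq (leb3 R) Omega f g in
  [/\ [/\ forall phi, Vg phi -> Vc (wgrad Omega phi),
          forall F, Vc F -> Vd (wcurl Omega F) &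
          forall B, Vd B -> Vl (wdiv Omega B)],
      forall phi, Vg phi -> ae _ (wgrad Omega phi) (fun=> 0) -> ae _ phi (fun=> 0),
      forall F, Vc F -> (ae _ (wcurl Omega F) (fun=> 0) <->
        exists2 phi, Vg phi & ae _ F (wgrad Omega phi)),
      forall B, Vd B -> (ae _ (wdiv Omega B) (fun=> 0) <->
        exists2 F, Vc F & ae _ B (wcurl Omega F)) &
      forall s, Vl s -> exists2 B, Vd B & ae _ s (wdiv Omega B)].

Definition linear_subspace (R : realType) (W : lmodType R) (A : set (pt R -> W)) : Prop :=
  A (fun=> 0) /\
  forall (a : R) u v, A u -> A v -> A (fun x => a *: u x + v x).

Definition inf_sup (R : realType) (Omega : set (pt R))
    (V : set (vfield R)) (Q : set (sfield R)) : \bar R :=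
  ereal_inf [set ereal_sup
     [set (sip Omega (wdiv Omega v) q /
           (h1norm Omega v * Num.sqrt (sip Omega q q)))%:E
       | v in [set v | V v /\ 0 < h1norm Omega v]]
     | q in [set q | Q q /\ 0 < sip Omega q q]].

(* V and Q consist of piecewise polynomials on a refinement of the mesh, so
   that bubble functions and macro-elements are allowed. *)
Definition stokes_pair (R : realType) (Omega : set (pt R)) (Th : mesh R)
    (V : set (vfield R)) (Q : set (sfield R)) : Prop :=
  [/\ linear_subspace V /\ linear_subspace (Q : set (pt R -> R^o)),
      V `<=` H10v Omega, Q `<=` L20 Omega,
      (exists (Th' : mesh R) (k : nat),
        [/\ triangulation Omega Th', refines Th' Th,
            V `<=` piecewise Th' (poly_field k) &
            Q `<=` piecewise Th' (poly_fun k)]) &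
      exists2 beta : R, 0 < beta & (beta%:E <= inf_sup Omega V Q)%E].

Definition dual_functional (R : realType) (Omega : set (pt R)) (V : set (vfield R))
    (f : vfield R -> R) : Prop :=
  (forall (a : R) u v, V u -> V v ->
     f (fun x => a *: u x + v x) = a * f u + f v) /\
  exists C : R, forall v, V v -> `|f v| <= C * h1norm Omega v.

Definition dcurl (R : realType) (Omega : set (pt R)) (Vc : set (vfield R))
    (C : vfield R) : vfield R :=
  get [set G : vfield R | Vc G /\
    forall F, Vc F -> mip Omega G F = mip Omega C (wcurl Omega F)].

Definition crossf (R : realType) (u v : vfield R) : vfield R :=
  fun x => cross (u x) (v x).

Definition convect (R : realType) (Omega : set (pt R)) (w u : vfield R) : vfield R :=
  fun x => w x *m wgradv Omega u x.

Definition Lform (R : realType) (Omega : set (pt R)) (w u v : vfield R) : R :=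
  2^-1 * (mip Omega (convect Omega w u) v - mip Omega (convect Omega w v) u).

Definition aform (R : realType) (Omega : set (pt R)) (Vc : set (vfield R))
    (Re Rm S : R) (psi xi eta : vfield R * vfield R) : R :=
  let: (w, G) := psi in let: (u, B) := xi in let: (v, C) := eta in
  let rot := dcurl Omega Vc in
  Re^-1 * mip Omega (wgradv Omega u) (wgradv Omega v)
  + Lform Omega w u v
  + S * Rm^-1 * mip Omega (rot B) (crossf v G)
  - S * Rm^-1 * mip Omega (crossf u G) (rot C)
  + S * Rm ^- 2 * mip Omega (rot B) (rot C).

Definition bform (R : realType) (Omega : set (pt R))
    (xi : vfield R * vfield R) (y : sfield R * sfield R) : R :=
  - sip Omega (wdiv Omega xi.1) y.1 + sip Omega (wdiv Omega xi.2) y.2.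

(* Main.v *)
Require Import Defs.
From HB Require Import structures.
From mathcomp Require Import all_boot all_order all_algebra ring lra.
From mathcomp Require complex ssrcomplements mpoly.

(** The discrete system asks for a zero of a polynomial map on a finite
    dimensional space.  On pairs (u, B) the form a splits into the energy
    Re^-1 (grad u, grad v) + S Rm^-2 (rot B, rot C), where rot is the discrete
    curl, and a trilinear coupling which vanishes when its last two arguments
    agree.  On the pairs constrained by b the energy is definite: if it
    vanishes, then grad u = 0, whence u = 0 in H^1_0 ([H10_null]), while B is
    divergence free, hence by exactness the curl of some F in the edge space,
    and (B, B) = (B, curl F) = (rot B, F) = 0 ([energy_definite]).

    In coordinates that are orthonormal for the energy the problem reads
    x_k + N_k(x, x) = f_k with sum_k N_k(x, x) x_k = 0.  It is solved without
    degree theory ([skew_quadratic_zero]): the perturbed system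
    x_k + N_k(x, x) + e x_k^3 = f_k satisfies |x| <= |f| whenever it is
    solvable, and it is solvable because every polynomial system
    x_k^d + q_k(x) = 0 with d odd and deg q_k < d has a real zero
    ([OddSystem.odd_system_zero]).  Indeed the quotient of the polynomial ring
    by these equations has the odd dimension d^n, so that the commuting
    multiplications by the variables have a common real eigenvector, whose
    eigenvalues form a zero.  Compactness lets e tend to 0.

    The residual of the momentum and induction equations then vanishes where
    all the functionals b(., y) do, so it is one of them
    ([functional_in_span]), which gives p and r.  For the mixed system, j is
    Rm^-1 rot B and sigma is the L^2 projection of u x B on the edge space.

    Making this precise requires the weak operators to be linear up to null
    sets, that is, weak derivatives to be unique.  This is the fundamental
    lemma of the calculus of variations ([null_of_orthogonal_test]), proved
    with products of the functions exp(- 1 / t).  Finite dimension is used in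
    the form [finite_mod]: piecewise polynomials are spanned, up to null sets,
    by finitely many functions; maximal orthonormal families then play the
    role of bases. *)

Set Implicit Arguments.
Unset Strict Implicit.
Unset Printing Implicit Defensive.

(** * Real zeros of polynomial systems with odd leading powers *)

Module OddSystem.
Import ssrcomplements mpoly GRing.Theory.
Local Open Scope ring_scope.

Lemma msize_le (K : nzRingType) (n : nat) (p : {mpoly K[n]}) (k : nat) :
  (forall m, m \in msupp p -> mdeg m < k)%N -> (msize p <= k)%N.
Proof. by move=> pk; rewrite msizeE; apply/bigmax_leqP_seq => m /pk. Qed.

Lemma msizeM_leS (K : nzRingType) (n : nat) (p q : {mpoly K[n]}) (k l : nat) :
  (msize p <= k -> msize q <= l.+1 -> msize (p * q) <= k + l)%N.
Proof.
move=> pk ql; apply: msize_le => m /msuppM_le /allpairsP[[m1 m2] /= [m1p m2q ->]].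
rewrite mdegD -addSn leq_add //.
  exact: leq_trans (msize_mdeg_lt m1p) pk.
by rewrite -ltnS; apply: leq_trans (msize_mdeg_lt m2q) ql.
Qed.

Section LeadingMonomial.
Variables (K : nzRingType) (n : nat).
Implicit Types (p q : {mpoly K[n]}) (m : 'X_{1..n}).

(** The polynomial is the monomial up to terms of smaller total degree; other
    terms of the same degree are excluded. *)
Definition leads p m := (msize (p - 'X_[m]) <= mdeg m)%N.

Lemma leads_msize p m : leads p m -> (msize p <= (mdeg m).+1)%N.
Proof.
move=> pm; rewrite -[p](subrK 'X_[m]).
apply: leq_trans (msizeD_le _ _) _.
by rewrite geq_max msizeX leqnn andbT (leq_trans pm).
Qed.

Lemma leadsX m : leads 'X_[m] m.
Proof. by rewrite /leads subrr msize0. Qed.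

Lemma leadsM p q m m' : leads p m -> leads q m' -> leads (p * q) (m + m')%MM.
Proof.
move=> pm qm'; rewrite /leads mpolyXD.
have -> : p * q - 'X_[m] * 'X_[m'] = (p - 'X_[m]) * q + 'X_[m] * (q - 'X_[m']).
  by rewrite mulrBl mulrBr addrA subrK.
apply: leq_trans (msizeD_le _ _) _; rewrite geq_max mdegD; apply/andP; split.
  exact: msizeM_leS pm (leads_msize qm').
rewrite -commr_mpolyX addnC; apply: msizeM_leS qm' _.
by rewrite msizeX.
Qed.

Lemma leadsXn p m k : leads p m -> leads (p ^+ k) (m *+ k)%MM.
Proof.
move=> pm; elim: k => [|k IHk]; first by rewrite expr0 mulm0n -mpolyX0 leadsX.
by rewrite exprS mulmS leadsM.
Qed.

Lemma leads_prod (I : Type) (r : seq I) (E : I -> {mpoly K[n]}) (e : I -> 'X_{1..n}) :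
  (forall i, leads (E i) (e i)) ->
  leads (\prod_(i <- r) E i) (\sum_(i <- r) e i)%MM.
Proof.
move=> Ee; elim/big_ind2: _ => [|p m q m'|i _]; last exact: Ee.
  by rewrite -mpolyX0 leadsX.
exact: leadsM.
Qed.

End LeadingMonomial.

Section Reduction.
Variables (K : comNzRingType) (n d : nat) (q : 'I_n -> {mpoly K[n]}).
Hypotheses (d_gt0 : (0 < d)%N) (q_size : forall i, (msize (q i) <= d)%N).

Let F i := 'X_i ^+ d + q i.

Definition mquo (m : 'X_{1..n}) : 'X_{1..n} := [multinom (m i %/ d)%N | i < n].
Definition mrem (m : 'X_{1..n}) : 'X_{1..n} := [multinom (m i %% d)%N | i < n].

(** The analogue of a base-d expansion: the exponents are divided by d, and
    each d-th power of a variable is replaced by the equation [F i] that it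
    leads.  Since [F i] differs from it by lower degree terms, the linear
    extension [adic] is unitriangular for the degree, hence bijective. *)
Definition adicX (m : 'X_{1..n}) : {mpoly K[n]} :=
  (\prod_i F i ^+ mquo m i) * 'X_[mrem m].

Definition adic (p : {mpoly K[n]}) : {mpoly K[n]} :=
  \sum_(m <- msupp p) p@_m *: adicX m.

Lemma adicwE k p : (msize p <= k)%N ->
  adic p = \sum_(m : 'X_{1..n < k}) p@_m *: adicX m.
Proof.
move=> lt_pk; pose I : subFinType _ := 'X_{1..n < k}.
rewrite /adic (big_mksub I) //=; first last.
- by move=> x /msize_mdeg_lt /leq_trans; apply.
- by rewrite msupp_uniq.
by rewrite big_rmcond //= => i; move/memN_msupp_eq0 ->; rewrite scale0r.
Qed.

Lemma adic_is_linear : linear adic.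
Proof.
move=> a p p'; set k := maxn (msize p) (msize p').
have pk : (msize p <= k)%N by rewrite leq_maxl.
have pk' : (msize p' <= k)%N by rewrite leq_maxr.
rewrite (adicwE pk) (adicwE pk') (@adicwE k); last first.
  apply: leq_trans (msizeD_le _ _) _; rewrite geq_max pk' andbT.
  exact: leq_trans (msizeZ_le _ _) pk.
rewrite scaler_sumr -big_split; apply: eq_bigr => m _ /=.
by rewrite mcoeffD mcoeffZ scalerDl scalerA.
Qed.

HB.instance Definition _ :=
  GRing.isLinear.Build K {mpoly K[n]} {mpoly K[n]} _ adic adic_is_linear.

Lemma adic_mon m : adic 'X_[m] = adicX m.
Proof. by rewrite /adic msuppX big_seq1 mcoeffX eqxx scale1r. Qed.

Lemma leads_adicX m : leads (adicX m) m.
Proof.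
have Fi i : leads (F i) (U_(i) *+ d)%MM.
  by rewrite /leads -mpolyXn /F addrAC subrr add0r mdegMn mdeg1 mul1n q_size.
have {2}-> : m = (\sum_i U_(i) *+ d *+ mquo m i + mrem m)%MM.
  apply/mnmP => i; rewrite mnmDE mnm_sumE (bigD1 i) //= big1 ?addn0 => [|j ji].
    by rewrite !mulmnE mnm1E eqxx mul1n !mnmE {1}(divn_eq (m i) d) mulnC.
  by rewrite !mulmnE mnm1E (negPf ji) !mul0n.
apply: leadsM (leadsX _ _); apply: leads_prod => i; exact/leadsXn/Fi.
Qed.

(** Unitriangularity, from which injectivity and surjectivity follow by
    induction on the degree. *)
Lemma adicB_msize p k : (msize p <= k.+1)%N -> (msize (adic p - p) <= k)%N.
Proof.
move=> pk; rewrite {2}[p]mpolyE /adic -sumrB big_seq.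
elim/big_rec: _ => [|m r mp rk]; first by rewrite msize0.
apply: leq_trans (msizeD_le _ _) _; rewrite geq_max rk andbT.
rewrite -scalerBr; apply: leq_trans (msizeZ_le _ _) _.
apply: leq_trans (leads_adicX m) _.
by have := leq_trans (msize_mdeg_lt mp) pk; rewrite ltnS.
Qed.

Lemma adic_inj p : adic p = 0 -> p = 0.
Proof.
move=> p0; apply/eqP; rewrite -msize_poly_eq0 -leqn0.
have [k] := ubnP (msize p); elim: k => [|[|k] IHk] //; rewrite ltnS => pk.
by apply: IHk; have := adicB_msize pk; rewrite p0 sub0r msizeN ltnS.
Qed.

Lemma adic_surj p : exists h, adic h = p.
Proof.
have [k] := ubnP (msize p); elim: k p => [|[|k] IHk] p //; rewrite ltnS => pk.
  exists 0; rewrite linear0; apply/esym/eqP.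
  by rewrite -msize_poly_eq0 -leqn0.
have [|h hE] := IHk (p - adic p).
  by rewrite ltnS -msizeN opprB adicB_msize.
by exists (p + h); rewrite raddfD /= hE addrC subrK.
Qed.

Lemma adicXM i m : adicX (m + U_(i) *+ d)%MM = adicX m * F i.
Proof.
have mE j : (m + U_(i) *+ d)%MM j = ((i == j) * d + m j)%N.
  by rewrite mnmDE mulmnE mnm1E addnC.
rewrite /adicX mulrAC; congr (_ * 'X_[_]); last first.
  by apply/mnmP => j; rewrite [LHS]mnmE [RHS]mnmE mE modnMDl.
have -> : F i = \prod_j F j ^+ (i == j).
  rewrite (bigD1 i) //= eqxx expr1 big1 ?mulr1 // => j ji.
  by rewrite eq_sym (negPf ji) expr0.
rewrite -big_split; apply: eq_bigr => j _ /=.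
by rewrite -exprD [X in _ ^+ X]mnmE mE divnMDl // [mquo m j]mnmE addnC.
Qed.

(** [adic] turns multiplication by the d-th power of a variable into
    multiplication by the corresponding equation; this identifies the ideal of
    the equations with the image of the monomials outside the box. *)
Lemma adicM i p : adic (p * 'X_[U_(i) *+ d]) = adic p * F i.
Proof.
rewrite {1}[p]mpolyE mulr_suml raddf_sum mulr_suml; apply: eq_bigr => m _ /=.
by rewrite -!scalerAl linearZ /= -mpolyXD adic_mon adicXM.
Qed.

Definition ideal (p : {mpoly K[n]}) := exists g : 'I_n -> {mpoly K[n]}, p = \sum_i g i * F i.

Lemma ideal0 : ideal 0.
Proof. by exists (fun=> 0); rewrite big1 // => i _; rewrite mul0r. Qed.

Lemma idealD p p' : ideal p -> ideal p' -> ideal (p + p').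
Proof.
move=> [g ->] [g' ->]; exists (fun i => g i + g' i).
by rewrite -big_split; apply: eq_bigr => i _ /=; rewrite mulrDl.
Qed.

Lemma idealM p p' : ideal p' -> ideal (p * p').
Proof.
move=> [g ->]; exists (fun i => p * g i).
by rewrite mulr_sumr; apply: eq_bigr => i _; rewrite mulrA.
Qed.

Lemma idealZ a p : ideal p -> ideal (a *: p).
Proof. by move=> Ip; rewrite -mul_mpolyC; exact: idealM. Qed.

Lemma idealF i : ideal (F i).
Proof.
exists (fun j => (j == i)%:R).
by rewrite (bigD1 i) //= eqxx mul1r big1 ?addr0 // => j /negPf->; rewrite mul0r.
Qed.

Local Notation box := {ffun 'I_n -> 'I_d}.

Definition boxmon (a : box) : 'X_{1..n} := [multinom (a i : nat) | i < n].

Lemma boxmon_inj : injective boxmon.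
Proof.
move=> a b /mnmP ab; apply/ffunP => i; apply/val_inj.
by have := ab i; rewrite !mnmE.
Qed.

Definition boxpoly (v : 'rV[K]_#|{: box}|) : {mpoly K[n]} :=
  \sum_k v 0 k *: 'X_[boxmon (enum_val k)].

Lemma boxpoly_is_linear : linear boxpoly.
Proof.
move=> a u v; rewrite /boxpoly scaler_sumr -big_split; apply: eq_bigr => k _ /=.
by rewrite !mxE scalerDl scalerA.
Qed.

HB.instance Definition _ :=
  GRing.isLinear.Build K 'rV[K]_#|{: box}| {mpoly K[n]} _ boxpoly boxpoly_is_linear.

Lemma boxpoly_coef v k : (boxpoly v)@_(boxmon (enum_val k)) = v 0 k.
Proof.
rewrite /boxpoly raddf_sum (bigD1 k) //= mcoeffZ mcoeffX eqxx mulr1 big1 ?addr0 //.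
move=> l lk; rewrite mcoeffZ mcoeffX; case: eqP => [/boxmon_inj/enum_val_inj lE|_].
  by rewrite lE eqxx in lk.
by rewrite mulr0.
Qed.

Lemma adic_boxpoly v : adic (boxpoly v) = boxpoly v.
Proof.
rewrite {1}/boxpoly raddf_sum; apply: eq_bigr => k _ /=.
rewrite linearZ /= adic_mon /adicX big1 ?mul1r => [|i _].
  congr (_ *: 'X_[_]); apply/mnmP => i; rewrite !mnmE modn_small //.
by rewrite !mnmE divn_small.
Qed.

(** The reduced monomials are independent modulo the equations: pulled back
    along [adic], a relation would express a reduced polynomial by monomials
    divisible by some d-th power. *)
Lemma ideal_boxpoly v : ideal (boxpoly v) -> v = 0.
Proof.
move=> [g vE].
have /fin_all_exists[h hE] : forall i, exists h, adic h = g i.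
  by move=> i; exact: adic_surj.
have : adic (boxpoly v - \sum_i h i * 'X_[U_(i) *+ d]) = 0.
  rewrite raddfB /= adic_boxpoly vE [adic _]linear_sum -sumrB big1 // => i _ /=.
  by rewrite adicM hE subrr.
move=> /adic_inj /eqP; rewrite subr_eq0 => /eqP {}vE.
apply/rowP => k; rewrite mxE -boxpoly_coef vE raddf_sum big1 // => i _ /=.
apply/memN_msupp_eq0; rewrite (perm_mem (msuppMX _ _)).
apply/mapP => -[m _ /mnmP /(_ i)].
rewrite mnmDE mulmnE mnm1E eqxx mul1n mnmE => kE.
by have := ltn_ord (enum_val k i); rewrite kE ltnNge leq_addr.
Qed.

Lemma boxpoly_delta (a : box) : boxpoly (delta_mx 0 (enum_rank a)) = 'X_[boxmon a].
Proof.
rewrite /boxpoly (bigD1 (enum_rank a)) //= mxE !eqxx scale1r enum_rankK.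
by rewrite big1 ?addr0 // => k ka; rewrite mxE (negPf ka) andbF scale0r.
Qed.

(** The reduced monomials span the quotient, by surjectivity of [adic]. *)
Lemma boxpoly_full p : exists v, ideal (p - boxpoly v).
Proof.
have [h <-] := adic_surj p; rewrite /adic.
elim: (msupp h) => [|m s [v sv]]; first by exists 0; rewrite big_nil linear0 subr0; exact: ideal0.
suff [u mu] : exists u, ideal (adicX m - boxpoly u).
  exists (h@_m *: u + v); rewrite big_cons linearP /= opprD addrACA -scalerBr.
  by apply: idealD => //; exact: idealZ.
have [lt_m|] := boolP [forall i, (m i < d)%N].
  pose a : box := [ffun i => Ordinal (forallP lt_m i)].
  exists (delta_mx 0 (enum_rank a)); rewrite boxpoly_delta.
  rewrite /adicX big1 ?mul1r => [|i _]; last first.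
    by rewrite mnmE divn_small ?expr0 // (forallP lt_m).
  rewrite (_ : mrem m = boxmon a) ?subrr; first exact: ideal0.
  by apply/mnmP => i; rewrite !mnmE ffunE modn_small // (forallP lt_m).
rewrite negb_forall => /existsP [i]; rewrite -leqNgt => dm.
exists 0; rewrite linear0 subr0.
have <- : (m - U_(i) *+ d + U_(i) *+ d)%MM = m.
  apply/submK/mnm_lepP => j; rewrite mulmnE mnm1E.
  by case: eqP => [<-|_]; rewrite ?mul1n.
by rewrite adicXM; apply/idealM/idealF.
Qed.

Lemma boxpoly_mulX : exists M : 'I_n -> 'M[K]_#|{: box}|,
  forall i v, ideal ('X_i * boxpoly v - boxpoly (v *m M i)).
Proof.
have /fin_all_exists[M ME] : forall i, exists r : 'M[K]_#|{: box}|,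
    forall k, ideal ('X_i * 'X_[boxmon (enum_val k)] - boxpoly (row k r)).
  move=> i; have /fin_all_exists[r rE] : forall k : 'I_#|{: box}|, exists v,
      ideal ('X_i * 'X_[boxmon (enum_val k)] - boxpoly v).
    by move=> k; exact: boxpoly_full.
  by exists (\matrix_k r k) => k; rewrite rowK.
exists M => i v.
rewrite mulmx_sum_row [boxpoly (\sum_k _)]linear_sum {1}/boxpoly mulr_sumr -sumrB.
apply: big_ind => [||k _]; [exact: ideal0|exact: idealD|].
by rewrite linearZ /= -scalerAr -scalerBr; apply/idealZ/ME.
Qed.

(** The matrices commute because multiplication of polynomials does and the
    coordinates modulo the ideal are unique. *)
Lemma boxpoly_mulX_comm (M : 'I_n -> 'M[K]_#|{: box}|) :
  (forall i v, ideal ('X_i * boxpoly v - boxpoly (v *m M i))) ->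
  forall i j, M i *m M j = M j *m M i.
Proof.
move=> ME i j; apply/row_matrixP => k; rewrite 2!rowE.
set v := delta_mx _ _; apply/eqP; rewrite -subr_eq0; apply/eqP/ideal_boxpoly.
have ij i' j' : ideal ('X_j' * ('X_i' * boxpoly v) - boxpoly (v *m (M i' *m M j'))).
  rewrite mulmxA -[_ * (_ * _)](subrK ('X_j' * boxpoly (v *m M i'))) -addrA.
  by apply: idealD (ME _ _); rewrite -mulrBr; exact: idealM.
rewrite linearB /=; have := idealD (ij j i) (idealZ (-1) (ij i j)).
by rewrite scaleN1r opprB mulrCA addrC addrA subrK.
Qed.

(** On a common eigenvector every polynomial acts, modulo the ideal, as its
    value at the eigenvalues. *)
Lemma boxpoly_horner (M : 'I_n -> 'M[K]_#|{: box}|) v (x : 'I_n -> K) :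
  (forall i v, ideal ('X_i * boxpoly v - boxpoly (v *m M i))) ->
  (forall i, v *m M i = x i *: v) ->
  forall p, ideal (p * boxpoly v - p.@[x] *: boxpoly v).
Proof.
move=> ME vx p; elim/mpolyind: p => [|c m p _ _ IHp].
  by rewrite mul0r meval0 scale0r subrr; exact: ideal0.
rewrite mevalD mevalZ mulrDl scalerDl opprD addrACA; apply: idealD (IHp).
rewrite -scalerAl -scalerA -scalerBr; apply: idealZ.
rewrite mpolyXE_id rmorph_prod; elim/big_rec2: _ => [|i y p' _ IHy].
  by rewrite mul1r scale1r subrr; exact: ideal0.
rewrite rmorphXn /= mevalXU.
elim: (m i) => [|k IHk]; first by rewrite !expr0 !mul1r.
move: IHk; rewrite !exprS -(mulrA _ _ y) -(mulrA _ _ p').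
set r := _ ^+ k * y; set s := _ ^+ k * p' => IHk.
rewrite (_ : _ - _ = 'X_i * (r * boxpoly v - s *: boxpoly v)
    + s *: ('X_i * boxpoly v - boxpoly (v *m M i))); last first.
  rewrite vx [boxpoly (_ *: _)]linearZ /= mulrBr scalerBr addrA -scalerAr subrK scalerA.
  by rewrite (mulrC s) (mulrA 'X_i r).
by apply: idealD; [exact: idealM|exact/idealZ/ME].
Qed.

End Reduction.

(** The quotient algebra has dimension d^n, which is odd, so that commuting
    endomorphisms have a common real eigenvector; as [F i] acts as 0 on the
    quotient, its value at the eigenvalues vanishes. *)
Theorem odd_system_zero (K : rcfType) (n d : nat) (q : 'I_n -> {mpoly K[n]}) :
  odd d -> (forall i, (msize (q i) <= d)%N) ->
  exists x : 'I_n -> K, forall i, x i ^+ d + (q i).@[x] = 0.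
Proof.
case: n q => [|n] q d_odd q_size; first by exists (fun=> 0) => -[].
have d_gt0 : (0 < d)%N by rewrite odd_gt0.
have [M ME] := boxpoly_mulX d_gt0 q_size.
have Mcomm := boxpoly_mulX_comm d_gt0 q_size ME.
have [] := @complex.Lemma4 K n _ 1%:M _ [seq M i | i <- enum 'I_n.+1].
- by rewrite mxrank1 card_ffun !card_ord dvdn2 oddX d_odd orbT.
- by rewrite size_map size_enum_ord.
- by move=> f _; rewrite mul1mx submx1.
- by move=> _ _ /mapP [i _ ->] /mapP[j _ ->].
move=> v v_neq0 vM.
have /fin_all_exists[x vx] : forall i, exists a, v *m M i = a *: v.
  move=> i; have [|a /eigenspaceP va] := vM (M i); last by exists a.
  by rewrite map_f // mem_enum.
exists x => i; apply/eqP; apply: contraNT v_neq0 => Fx_neq0; apply/eqP.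
have := boxpoly_horner ME vx ('X_i ^+ d + q i).
have := idealM (boxpoly v) (@idealF _ _ d q i); rewrite mulrC.
move=> I1 /(idealZ (-1)) /(idealD I1).
rewrite scaleN1r opprB addrC subrK mevalD rmorphXn /= mevalXU => I2.
have := idealZ (x i ^+ d + (q i).@[x])^-1 I2.
rewrite scalerA mulVf // scale1r.
exact: ideal_boxpoly.
Qed.

Corollary cubic_system_zero (K : rcfType) (n : nat)
    (a : 'I_n -> 'I_n -> 'I_n -> K) (b : 'I_n -> K) (c : 'I_n -> K) :
  exists x : 'I_n -> K, forall k,
    x k ^+ 3 + ((\sum_i \sum_j a i j k * x i * x j) + b k * x k + c k) = 0.
Proof.
pose q k : {mpoly K[n]} :=
  \sum_i \sum_j a i j k *: ('X_i * 'X_j) + b k *: 'X_k + (c k)%:MP.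
have [//|k|x xP] := @odd_system_zero K n 3 q.
  apply: leq_trans (msizeD_le _ _) _; rewrite geq_max msizeC (leq_trans (leq_b1 _)) // andbT.
  apply: leq_trans (msizeD_le _ _) _; rewrite geq_max; apply/andP; split.
    apply: leq_trans (msize_sum _ _ _) _; apply/bigmax_leqP => i _.
    apply: leq_trans (msize_sum _ _ _) _; apply/bigmax_leqP => j _.
    apply: leq_trans (msizeZ_le _ _) _.
    by rewrite -mpolyXD msizeX mdegD !mdeg1.
  by apply: leq_trans (msizeZ_le _ _) _; rewrite msizeX mdeg1.
exists x => k; rewrite -[RHS](xP k) !mevalD mevalC mevalZ mevalXU raddf_sum /=.
congr (_ + (_ + _ + _)); apply: eq_bigr => i _; rewrite raddf_sum /=.
by apply: eq_bigr => j _; rewrite mevalZ mevalM !mevalXU mulrA.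
Qed.

End OddSystem.

From mathcomp Require Import all_classical all_reals all_analysis measurable_realfun.
Import Order.TTheory GRing.Theory Num.Theory numFieldNormedType.Exports.
Local Open Scope classical_set_scope.
Local Open Scope ring_scope.

(** * Zeros of quadratic maps with a skew quadratic part *)

Section SkewQuadraticZero.
Variables (R : realType) (n : nat) (N : 'I_n -> 'I_n -> 'I_n -> R) (f : 'I_n -> R).
Hypothesis N_skew : forall x : 'I_n -> R,
  \sum_k \sum_i \sum_j N i j k * x i * x j * x k = 0.

Let residual (x : 'I_n -> R) k := x k + \sum_i \sum_j N i j k * x i * x j - f k.

(** Multiplying by x and summing, the quadratic part disappears and the cubic
    perturbation has a favourable sign, so the bound does not depend on e. *)
Lemma perturbed_zero_bound (e : R) (x : 'I_n -> R) : 0 <= e ->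
  (forall k, residual x k = - (e * x k ^+ 3)) ->
  \sum_k x k ^+ 2 <= \sum_k f k ^+ 2.
Proof.
move=> e_ge0 xP.
have sumE : \sum_k x k * residual x k = \sum_k x k ^+ 2 - \sum_k f k * x k.
  under eq_bigr do rewrite /residual mulrBr mulrDr -expr2.
  rewrite sumrB big_split /= (_ : \sum_k x k * (\sum_i _) = 0) ?addr0; last first.
    rewrite -[RHS](N_skew x); apply: eq_bigr => k _; rewrite mulr_sumr.
    apply: eq_bigr => i _; rewrite mulr_sumr; apply: eq_bigr => j _.
    by rewrite mulrC.
  by congr (_ - _); apply: eq_bigr => k _; rewrite mulrC.
have sum_le0 : \sum_k x k * residual x k <= 0.
  apply: sumr_le0 => k _; rewrite xP mulrN oppr_le0 mulrCA -exprS.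
  by rewrite mulr_ge0 // exprn_even_ge0.
have : 2 * \sum_k f k * x k <= \sum_k f k ^+ 2 + \sum_k x k ^+ 2.
  rewrite mulr_sumr -big_split; apply: ler_sum => k _ /=.
  by have := sqr_ge0 (f k - x k); nra.
by move: sum_le0; rewrite sumE; lra.
Qed.

Lemma perturbed_zero (e : R) : 0 < e ->
  exists x : 'I_n -> R, forall k, residual x k = - (e * x k ^+ 3).
Proof.
move=> e_gt0.
have [x xP] := OddSystem.cubic_system_zero
  (fun i j k => e^-1 * N i j k) (fun=> e^-1) (fun k => - (e^-1 * f k)).
exists x => k; apply/eqP; rewrite -addr_eq0; apply/eqP.
have := congr1 ( *%R e) (xP k); rewrite mulr0 => <-.
rewrite addrC mulrDr; congr (_ + _).
rewrite /residual (addrC (x k)) !mulrDr !mulrA mulrN mulfV ?gt_eqF // !mul1r.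
rewrite mulrA mulfV ?gt_eqF // mul1r; congr (_ + _ - _).
rewrite mulr_sumr; apply: eq_bigr => i _; rewrite mulr_sumr; apply: eq_bigr => j _.
by rewrite !mulrA mulfV ?gt_eqF // mul1r.
Qed.

(** The squared norm of the residual attains its minimum on a box containing
    the zeros of all perturbed systems, where it is as small as e^2. *)
Theorem skew_quadratic_zero : exists x : 'I_n -> R, forall k,
  x k + \sum_i \sum_j N i j k * x i * x j = f k.
Proof.
pose M := \sum_k f k ^+ 2 + 1.
have M_ge1 : 1 <= M by rewrite lerDr sumr_ge0 // => k _; exact: sqr_ge0.
pose Phi (x : 'rV[R]_n) := \sum_k residual (x 0) k ^+ 2.
have Phi_cont : continuous Phi.
  have coord k : continuous (fun x : 'rV[R]_n => x 0 k) by exact: coord_continuous.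
  have sum_cont (h : 'I_n -> 'rV[R]_n -> R) :
      (forall k, continuous (h k)) -> continuous (fun x => \sum_k h k x).
    by move=> hc; apply: continuous_big => //; exact: add_continuous.
  have mul_cont (g h : 'rV[R]_n -> R) :
      continuous g -> continuous h -> continuous (fun x => g x * h x).
    by move=> gc hc x; exact: (cvgM (gc x) (hc x)).
  have res_cont k : continuous (fun x : 'rV[R]_n => residual (x 0) k).
    have quad_cont : continuous (fun x : 'rV[R]_n =>
        \sum_i \sum_j N i j k * x 0 i * x 0 j).
      apply: (sum_cont) => i; apply: (sum_cont) => j.
      by do !apply: (mul_cont) => //; exact: cst_continuous.
    by move=> x; exact: (cvgB (cvgD (coord k x) (quad_cont x)) (cvg_cst _)).
  by apply: (sum_cont) => k; apply: (mul_cont).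
pose A := [set x : 'rV[R]_n | forall k, x 0 k \in `[- M, M]].
have cA : compact A.
  exact: (rV_compact (fun=> @segment_compact _ (- M) M)).
have [|x xA x_min] := EVT_min_rV _ cA (continuous_subspaceT Phi_cont).
  exists 0 => k; rewrite mxE in_itv /= oppr_le0 andbb.
  by apply: le_trans M_ge1.
have Phi_small e : 0 < e -> Phi x <= e ^+ 2 * (n%:R * M ^+ 6).
  move=> e_gt0; have [y yP] := perturbed_zero e_gt0.
  have yM k : `|y k| <= M.
    rewrite -ler_sqr ?nnegrE // ?(le_trans _ M_ge1) // real_normK ?num_real //.
    have := perturbed_zero_bound (ltW e_gt0) yP.
    rewrite (bigD1 k) //= => yk.
    have : 0 <= \sum_(i < n | i != k) y i ^+ 2.
      by apply: sumr_ge0 => i _; exact: sqr_ge0.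
    rewrite -/M in M_ge1 *; have : \sum_k f k ^+ 2 <= M by rewrite /M lerDl.
    by move: yk; nra.
  have yA : (\row_k y k : 'rV[R]_n) \in A.
    rewrite inE => k; rewrite mxE in_itv /= -ler_norml; exact: yM.
  apply: le_trans (x_min _ yA) _; rewrite (_ : n%:R * _ = \sum_(k < n) M ^+ 6); last first.
    by rewrite sumr_const card_ord mulr_natl.
  rewrite mulr_sumr.
  apply: ler_sum => k _.
  have -> : residual ((\row_k y k : 'rV[R]_n) 0) k = residual y k.
    rewrite /residual mxE; congr (_ + _ - _).
    by apply: eq_bigr => i _; apply: eq_bigr => j _; rewrite !mxE.
  rewrite yP sqrrN exprMn -exprM ler_wpM2l ?sqr_ge0 //.
  by rewrite -[y k ^+ _]ger0_norm ?exprn_even_ge0 // normrX lerXn2r ?nnegrE // (le_trans _ M_ge1).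
have Phi0 : Phi x = 0.
  apply/eqP; rewrite eq_le sumr_ge0 ?andbT => [|k _]; last exact: sqr_ge0.
  apply/ler_addgt0Pr => e e_gt0; rewrite add0r.
  set B := n%:R * M ^+ 6 in Phi_small.
  have B_ge0 : 0 <= B by rewrite mulr_ge0 // exprn_ge0 // (le_trans _ M_ge1).
  (* t <= 1 gives t^2 B <= t B, and the second bound makes t B <= e *)
  pose t := Num.min 1 (e / (B + 1)).
  have t_gt0 : 0 < t by rewrite lt_min ltr01 divr_gt0 // ltr_wpDl.
  apply: le_trans (Phi_small t t_gt0) _.
  have t_le1 : t <= 1 by rewrite ge_min lexx.
  have : t <= e / (B + 1) by rewrite ge_min lexx orbT.
  rewrite ler_pdivlMr ?ltr_wpDl // => tB.
  by nra.
exists (x 0) => k; apply/eqP; rewrite -subr_eq0 -/(residual (x 0) k) -sqrf_eq0.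
move: Phi0 => /eqP; rewrite psumr_eq0 => [/allP/(_ k)|i _]; last exact: sqr_ge0.
by rewrite mem_index_enum => /(_ isT).
Qed.

End SkewQuadraticZero.

(** * Semi-inner products on finite dimensional subspaces *)

Section SemiInnerProduct.
Variables (R : realType) (E : lmodType R).
Implicit Types (A N : set E) (ip : E -> E -> R) (g : E -> R).

Definition subspace A := A 0 /\ forall a u v, A u -> A v -> A (a *: u + v).

Definition linear_on A g :=
  forall a u v, A u -> A v -> g (a *: u + v) = a * g u + g v.

Definition semi_inner A ip :=
  [/\ forall w, A w -> linear_on A (ip^~ w),
      forall u v, A u -> A v -> ip u v = ip v u
    & forall u, A u -> 0 <= ip u u].

(** The spanning family need not lie in A, so that the property passes to
    subsets at once. *)
Definition finite_mod N A := exists (m : nat) (s : 'I_m -> E),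
  forall x, A x -> exists c : 'I_m -> R, N (x - \sum_i c i *: s i).

Lemma subspace_sum A (I : Type) (r : seq I) (c : I -> R) (e : I -> E) :
  subspace A -> (forall i, A (e i)) -> A (\sum_(i <- r) c i *: e i).
Proof.
move=> [A0 Al] Ae; elim: r => [|i r IHr]; first by rewrite big_nil.
by rewrite big_cons; exact: Al.
Qed.

Lemma subspaceZ A a u : subspace A -> A u -> A (a *: u).
Proof. by move=> [A0 Al] Au; rewrite -[_ *: _]addr0; exact: Al. Qed.

Lemma subspaceB A u v : subspace A -> A u -> A v -> A (u - v).
Proof. by move=> [A0 Al] Au Av; rewrite addrC -scaleN1r; exact: Al. Qed.

Lemma linear_on0 A g : subspace A -> linear_on A g -> g 0 = 0.
Proof.
move=> [A0 _] gl; have := gl 1 0 0 A0 A0; rewrite scaler0 addr0 mul1r.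
by move/eqP; rewrite -{1}[g 0]add0r (inj_eq (addIr _)) eq_sym => /eqP.
Qed.

Lemma linear_onZ A g a u : subspace A -> linear_on A g -> A u -> g (a *: u) = a * g u.
Proof.
move=> As gl Au; rewrite -[a *: u]addr0 gl ?(linear_on0 As gl) ?addr0 //.
exact: As.1.
Qed.

Lemma linear_onB A g u v : subspace A -> linear_on A g -> A u -> A v ->
  g (u - v) = g u - g v.
Proof. by move=> As gl Au Av; rewrite addrC -scaleN1r gl // mulN1r addrC. Qed.

Lemma linear_on_sum A g (I : Type) (r : seq I) (c : I -> R) (e : I -> E) :
  subspace A -> linear_on A g -> (forall i, A (e i)) ->
  g (\sum_(i <- r) c i *: e i) = \sum_(i <- r) c i * g (e i).
Proof.
move=> As gl Ae; elim: r => [|i r IHr]; first by rewrite !big_nil (linear_on0 As).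
by rewrite !big_cons gl ?IHr //; exact: subspace_sum.
Qed.

Lemma finite_mod_finType N A (I : finType) (s : I -> E) :
  (forall x, A x -> exists c : I -> R, N (x - \sum_i c i *: s i)) -> finite_mod N A.
Proof.
move=> sP; exists #|I|, (fun k => s (enum_val k)) => x /sP[c cP].
exists (fun k => c (enum_val k)).
by rewrite -(big_enum_val (fun i => c i *: s i)) /= in cP *.
Qed.

Section FixedSubspace.
Variables (A : set E) (ip : E -> E -> R).
Hypotheses (As : subspace A) (ipP : semi_inner A ip).

Lemma semi_inner_linr u : A u -> linear_on A (ip u).
Proof.
case: ipP => ipl ipC _ Au a v w Av Aw.
have Avw : A (a *: v + w) by case: As => _; exact.
by rewrite ipC // (ipl u) // (ipC v) // (ipC w).
Qed.

(** If ip v v = 0 the optimal multiple of v does not exist; subtracting a large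
    one shows that ip u v = 0. *)
Lemma cauchy_schwarz u v : A u -> A v -> ip u v ^+ 2 <= ip u u * ip v v.
Proof.
case: ipP => ipl ipC ip0 Au Av.
have sq a b : 0 <= a ^+ 2 * ip u u + 2 * a * b * ip u v + b ^+ 2 * ip v v.
  have Aw : A (a *: u + b *: v) by case: (As) => _; apply => //; exact: subspaceZ.
  have := ip0 _ Aw; rewrite (ipl _ Aw a u) ?(linear_onZ b As (ipl _ Aw)) //; last first.
    exact: subspaceZ.
  rewrite (ipC u) // (ipC v) // !(ipl _ _ a u) ?(linear_onZ b As (ipl _ _)) //;
    try exact: subspaceZ.
  rewrite (ipC v u) //; congr (_ <= _); ring.
have [v0|v_neq0] := eqVneq (ip v v) 0.
  rewrite v0 mulr0; have [->|uv] := eqVneq (ip u v) 0; first by rewrite expr0n.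
  have := sq 1 (- ((ip u u + 1) / (2 * ip u v))).
  rewrite v0 mulr0 addr0 expr1n mul1r.
  have -> : 2 * 1 * - ((ip u u + 1) / (2 * ip u v)) * ip u v = - (ip u u + 1).
    by field.
  lra.
have v_gt0 : 0 < ip v v by rewrite lt_def v_neq0 ip0.
have := sq (ip v v) (- ip u v).
rewrite -(pmulr_rge0 _ v_gt0) => h.
rewrite -subr_ge0 -(pmulr_rge0 _ v_gt0) -(pmulr_rge0 _ v_gt0).
by apply: le_trans h _; rewrite le_eqVlt; apply/orP; left; apply/eqP; ring.
Qed.

Lemma semi_inner_null u v : A u -> A v -> ip v v = 0 -> ip u v = 0.
Proof.
move=> Au Av v0; apply/eqP; rewrite -sqrf_eq0 eq_le sqr_ge0 andbT.
by have := cauchy_schwarz Au Av; rewrite v0 mulr0.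
Qed.

Definition orthonormal_family n (e : 'I_n -> E) :=
  (forall i, A (e i)) /\ forall i j, ip (e i) (e j) = (i == j)%:R.

Definition residual_of n (e : 'I_n -> E) x := x - \sum_i ip x (e i) *: e i.

Lemma residual_in n (e : 'I_n -> E) x :
  orthonormal_family e -> A x -> A (residual_of e x).
Proof. by move=> [Ae _] Ax; apply: subspaceB => //; exact: subspace_sum. Qed.

Lemma residual_orthogonal n (e : 'I_n -> E) x i :
  orthonormal_family e -> A x -> ip (residual_of e x) (e i) = 0.
Proof.
case: ipP => ipl _ _ [Ae ee] Ax.
have Asum : A (\sum_j ip x (e j) *: e j) by exact: subspace_sum.
rewrite (linear_onB As (ipl _ (Ae i))) // (linear_on_sum _ _ As (ipl _ (Ae i))) //.
rewrite (bigD1 i) //= ee eqxx mulr1 big1 ?addr0 ?subrr // => j ji.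
by rewrite ee (negPf ji) mulr0.
Qed.

(** A combination of the family with coefficients in the kernel of the matrix
    expressing it by s lies in N, hence is orthogonal to the family. *)
Lemma orthonormal_size N m (s : 'I_m -> E) n (e : 'I_n -> E) :
  subspace N -> (forall x, A x -> N x -> ip x x = 0) ->
  (forall x, A x -> exists c : 'I_m -> R, N (x - \sum_i c i *: s i)) ->
  orthonormal_family e -> (n <= m)%N.
Proof.
case: ipP => ipl ipC ip0 Ns N0 sP [Ae ee]; rewrite leqNgt; apply/negP => mn.
have /fin_all_exists[C CP] : forall i, exists c : 'I_m -> R,
    N (e i - \sum_j c j *: s j) by move=> i; exact: sP.
pose M := \matrix_(i < n, j < m) C i j.
have : kermx M != 0.
  by rewrite kermx_eq0 /row_free neq_ltn (leq_ltn_trans (rank_leq_col _) mn).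
move=> /rowV0Pn[v /sub_kermxP vM v_neq0].
pose y := \sum_i v 0 i *: e i.
have Ay : A y by exact: subspace_sum.
have Ny : N y.
  have -> : y = \sum_i v 0 i *: (e i - \sum_j C i j *: s j).
    under [RHS]eq_bigr do rewrite scalerBr.
    rewrite sumrB -[LHS]subr0; congr (_ - _).
    under eq_bigr do rewrite scaler_sumr.
    rewrite exchange_big /= big1 // => j _.
    under eq_bigr do rewrite scalerA.
    rewrite -scaler_suml.
    have -> : \sum_i v 0 i * C i j = (v *m M) 0 j.
      by rewrite mxE; apply: eq_bigr => i _; rewrite mxE.
    by rewrite vM mxE scale0r.
  exact: subspace_sum.
case/eqP: v_neq0; apply/rowP => k; rewrite mxE.
have : ip y (e k) = 0 by rewrite ipC //; exact: semi_inner_null (N0 _ Ay Ny).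
rewrite (linear_on_sum _ _ As (ipl _ (Ae k))) // (bigD1 k) //= ee eqxx mulr1.
by rewrite big1 ?addr0 // => i ik; rewrite ee (negPf ik) mulr0.
Qed.

(** By maximality: normalizing a residual of positive norm would extend the
    family. *)
Theorem orthonormal_basis N :
  subspace N -> (forall x, A x -> N x -> ip x x = 0) -> finite_mod N A ->
  exists n (e : 'I_n -> E), orthonormal_family e /\
    forall x, A x -> ip (residual_of e x) (residual_of e x) = 0.
Proof.
case: (ipP) => ipl ipC ip0 Ns N0 [m [s sP]].
pose P n := `[< exists e : 'I_n -> E, orthonormal_family e >].
have exP : exists n, P n.
  by exists 0; apply/asboolP; exists (fun=> 0); split=> -[].
have Pm n : P n -> (n <= m)%N by move=> /asboolP[e]; exact: orthonormal_size sP.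
have [n /asboolP[e eo] nmax] := ex_maxnP exP Pm.
exists n, e; split => // x Ax; apply: contrapT => /eqP r_neq0.
set r := residual_of e x in r_neq0.
have Ar : A r by exact: residual_in.
have r_gt0 : 0 < ip r r by rewrite lt_def r_neq0 ip0.
pose u := (Num.sqrt (ip r r))^-1 *: r.
have Au : A u by exact: subspaceZ.
have ure i : ip u (e i) = 0.
  rewrite (linear_onZ _ As (ipl _ (eo.1 i))) //.
  by rewrite residual_orthogonal ?mulr0.
suff /nmax : P n.+1 by rewrite ltnn.
apply/asboolP; exists (fun i => if unlift ord0 i is Some j then e j else u).
split=> [i|i j]; first by case: unliftP => [j _|_] //; exact: eo.1.
case: unliftP => [i' ->|->]; case: unliftP => [j' ->|->].
- by rewrite eo.2 (inj_eq lift_inj).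
- by rewrite ipC ?ure //; exact: eo.1.
- by rewrite ure.
rewrite eqxx (linear_onZ _ As (ipl _ Au)) // (linear_onZ _ As (semi_inner_linr Ar)) //.
by rewrite mulrA -expr2 exprVn sqr_sqrtr ?ip0 // mulVf.
Qed.

Section Basis.
Variables (n : nat) (e : 'I_n -> E).
Hypotheses (eo : orthonormal_family e)
  (e_full : forall x, A x -> ip (residual_of e x) (residual_of e x) = 0).

(** Only functionals that vanish on vectors of norm 0 see the family as a
    basis. *)
Lemma linear_on_basis g : linear_on A g ->
  (forall r, A r -> ip r r = 0 -> g r = 0) ->
  forall x, A x -> g x = \sum_i ip x (e i) * g (e i).
Proof.
move=> gl g0 x Ax; have Ar := residual_in eo Ax.
rewrite -(linear_on_sum _ _ As gl); last exact: eo.1.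
apply/eqP; rewrite -subr_eq0 -(linear_onB As gl) //.
  by rewrite g0 //; exact: e_full.
by apply: subspace_sum => //; exact: eo.1.
Qed.

Lemma riesz g : linear_on A g -> (forall r, A r -> ip r r = 0 -> g r = 0) ->
  exists2 u, A u & forall x, A x -> ip u x = g x.
Proof.
case: (ipP) => ipl ipC _ gl g0; exists (\sum_i g (e i) *: e i).
  by apply: subspace_sum => //; exact: eo.1.
move=> x Ax; rewrite (linear_on_sum _ _ As (ipl _ Ax)); last exact: eo.1.
rewrite (linear_on_basis gl g0) //; apply: eq_bigr => i _.
by rewrite mulrC ipC //; exact: eo.1.
Qed.

(** In orthonormal coordinates the quadratic form of the inner product becomes
    the identity, as [skew_quadratic_zero] requires. *)
Theorem skew_variational (t : E -> E -> E -> R) (g : E -> R) :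
  (forall u v, A u -> A v -> linear_on A (t u v)) ->
  (forall u v, A u -> A v -> linear_on A (fun w => t u w v)) ->
  (forall u v, A u -> A v -> linear_on A (fun w => t w u v)) ->
  (forall u v, A u -> A v -> t u v v = 0) ->
  linear_on A g ->
  (forall r, A r -> ip r r = 0 -> g r = 0 /\ forall u v, A u -> A v -> t u v r = 0) ->
  exists2 u, A u & forall x, A x -> ip u x + t u u x = g x.
Proof.
case: (ipP) => ipl ipC _ t3 t2 t1 t_skew gl null0.
have Ae := eo.1.
have tE c c' c'' : t (\sum_i c i *: e i) (\sum_j c' j *: e j) (\sum_k c'' k *: e k) =
    \sum_k \sum_i \sum_j c'' k * (c i * (c' j * t (e i) (e j) (e k))).
  have Asum d : A (\sum_i d i *: e i) by exact: subspace_sum.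
  rewrite (linear_on_sum _ _ As (t3 _ _ (Asum _) (Asum _))) //.
  apply: eq_bigr => k _.
  rewrite (linear_on_sum _ _ As (t1 _ _ (Asum _) (Ae k))) // mulr_sumr.
  apply: eq_bigr => i _.
  rewrite (linear_on_sum _ _ As (t2 _ _ (Ae i) (Ae k))) // !mulr_sumr.
  by apply: eq_bigr.
have [|c cP] := @skew_quadratic_zero R n (fun i j k => t (e i) (e j) (e k)) (fun k => g (e k)).
  move=> c; have Ax : A (\sum_i c i *: e i) by exact: subspace_sum.
  rewrite -[RHS](t_skew _ _ Ax Ax) tE; apply: eq_bigr => k _.
  by apply: eq_bigr => i _; apply: eq_bigr => j _; ring.
set u := \sum_i c i *: e i.
have Au : A u by exact: subspace_sum.
exists u => // x Ax.
have lin : linear_on A (fun y => ip u y + t u u y).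
  move=> a y z Ay Az; rewrite (semi_inner_linr Au) // (t3 _ _ Au Au) //.
  by rewrite mulrDr addrACA.
rewrite (linear_on_basis lin) //; last first.
  move=> r Ar r0; rewrite (semi_inner_null Au Ar r0) add0r.
  by have [_] := null0 r Ar r0; exact.
rewrite (linear_on_basis gl) => [|r Ar r0|//]; last by have [] := null0 r Ar r0.
apply: eq_bigr => k _; congr (_ * _); rewrite -cP; congr (_ + _).
  rewrite (linear_on_sum _ _ As (ipl _ (Ae k))) // (bigD1 k) //= eo.2 eqxx mulr1.
  by rewrite big1 ?addr0 // => i ik; rewrite eo.2 (negPf ik) mulr0.
rewrite (linear_on_sum _ _ As (t1 _ _ Au (Ae k))) //; apply: eq_bigr => i _.
rewrite (linear_on_sum _ _ As (t2 _ _ (Ae i) (Ae k))) // mulr_sumr.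
by apply: eq_bigr => j _; ring.
Qed.

End Basis.
End FixedSubspace.

(** Induction on the number of functionals, restricting to the kernel of the
    first one.  This provides the Lagrange multipliers. *)
Lemma functional_in_span m (b : 'I_m -> E -> R) A g :
  subspace A -> (forall i, linear_on A (b i)) -> linear_on A g ->
  (forall x, A x -> (forall i, b i x = 0) -> g x = 0) ->
  exists c : 'I_m -> R, forall x, A x -> g x = \sum_i c i * b i x.
Proof.
elim: m b A g => [|m IHm] b A g As bl gl g0.
  by exists (fun=> 0) => x Ax; rewrite big_ord0 g0 // => -[].
pose A' := [set x | A x /\ b ord0 x = 0].
have As' : subspace A'.
  split; first by split; [exact: As.1|exact: linear_on0 (bl _)].
  move=> a u v [Au u0] [Av v0]; split; first exact: As.2.
  by rewrite bl // u0 v0 mulr0 addr0.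
have sub (h : E -> R) : linear_on A h -> linear_on A' h.
  by move=> hl a u v [Au _] [Av _]; exact: hl.
have [||x [Ax x0] xi|c cP] := IHm (fun i => b (lift ord0 i)) A' g As'.
- by move=> i; exact/sub/bl.
- exact: sub.
- by apply: g0 => // i; case: (unliftP ord0 i) => [j ->|->].
pose g' x := g x - \sum_i c i * b (lift ord0 i) x.
have g'l : linear_on A g'.
  move=> a u v Au Av; rewrite /g' gl //.
  under eq_bigr do rewrite bl // mulrDr mulrCA.
  by rewrite big_split /= -mulr_sumr; ring.
have [b0|] := pselect (forall x, A x -> b ord0 x = 0).
  exists (fun i => if unlift ord0 i is Some j then c j else 0) => x Ax.
  rewrite big_ord_recl unlift_none mul0r add0r cP; last by split=> //; exact: b0.
  by apply: eq_bigr => i _; rewrite liftK.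
move=> /existsNP[z /not_implyP[Az /eqP bz]].
pose a := g' z / b ord0 z.
have g'E x : A x -> g' x = a * b ord0 x.
  move=> Ax; pose y := - (b ord0 x / b ord0 z) *: z + x.
  have Ay : A y by exact: As.2.
  have y0 : b ord0 y = 0 by rewrite bl // mulNr divfK // addrC subrr.
  have : g' y = 0 by rewrite /g' (cP y) ?subrr.
  rewrite g'l // => /eqP; rewrite addrC mulNr subr_eq0 => /eqP ->.
  by rewrite /a; ring.
exists (fun i => if unlift ord0 i is Some j then c j else a) => x Ax.
rewrite big_ord_recl unlift_none -g'E //.
under eq_bigr do rewrite liftK.
by rewrite subrK.
Qed.

End SemiInnerProduct.

(** * Boxes and Borel sets in three dimensions *)

Section Boxes.
Variable R : realType.

Definition obox (l u : pt R) : set (mpt R) :=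
  (`]l.1.1, u.1.1[ `*` `]l.1.2, u.1.2[) `*` `]l.2, u.2[.

Definition cbox (l u : pt R) : set (pt R) :=
  (`[l.1.1, u.1.1] `*` `[l.1.2, u.1.2]) `*` `[l.2, u.2].

Definition rat_pt (q : rat * rat * rat) : pt R :=
  (ratr q.1.1, ratr q.1.2, ratr q.2).

Lemma obox_measurable l u : measurable (obox l u).
Proof. by apply: measurableX; [apply: measurableX|]; exact: measurable_itv. Qed.

Lemma cbox_compact l u : compact (cbox l u).
Proof. by do !apply: compact_setX; exact: segment_compact. Qed.

Lemma obox_sub_cbox l u : obox l u `<=` cbox l u.
Proof.
by move=> x [[/= ? ?] ?]; split; [split|] => /=; exact: subset_itv_oo_cc.
Qed.

Definition ptmax (l l' : pt R) : pt R :=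
  (Num.max l.1.1 l'.1.1, Num.max l.1.2 l'.1.2, Num.max l.2 l'.2).

Definition ptmin (u u' : pt R) : pt R :=
  (Num.min u.1.1 u'.1.1, Num.min u.1.2 u'.1.2, Num.min u.2 u'.2).

Lemma obox_setI l u l' u' :
  obox l u `&` obox l' u' = obox (ptmax l l') (ptmin u u').
Proof.
rewrite /obox -!setXI /=.
have itvI (a b a' b' : R) : `]Num.max a a', Num.min b b'[%classic =
    `]a, b[%classic `&` `]a', b'[%classic.
  apply/seteqP; split => x /=; rewrite !in_itv /= gt_max lt_min.
    by move=> /andP[/andP[-> ->] /andP[-> ->]].
  by move=> [/andP[-> ->] /andP[-> ->]].
by rewrite !itvI.
Qed.

Lemma cbox_ptmax_ptmin l u l' u' : cbox (ptmax l l') (ptmin u u') `<=` cbox l u.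
Proof.
move=> x [[/=]]; rewrite !in_itv /= !ge_max !le_min.
move=> /andP[/andP[l1 _] /andP[u1 _]] /andP[/andP[l2 _] /andP[u2 _]].
move=> /andP[/andP[l3 _] /andP[u3 _]].
by split; [split|]; rewrite /= in_itv /=; apply/andP.
Qed.

Lemma obox_setI_closed : setI_closed [set obox l u | l in setT & u in setT].
Proof.
move=> _ _ [l _ [u _ <-]] [l' _ [u' _ <-]]; rewrite obox_setI.
by exists (ptmax l l') => //; exists (ptmin u u').
Qed.

Lemma rat_around (x e : R) : 0 < e ->
  exists a b : rat, x - e < ratr a < x /\ x < ratr b < x + e.
Proof.
move=> e_gt0.
have [|a /[!in_itv]/= aP] := @rat_in_itvoo R (x - e) x; first by lra.
have [|b /[!in_itv]/= bP] := @rat_in_itvoo R x (x + e); first by lra.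
by exists a, b.
Qed.

(** The closed boxes also lie in U, which is what compactly supported bump
    functions need. *)
Lemma open_bigcup_obox (U : set (pt R)) : open U ->
  U = \bigcup_(q in [set q : (rat * rat * rat) * (rat * rat * rat) |
        cbox (rat_pt q.1) (rat_pt q.2) `<=` U]) obox (rat_pt q.1) (rat_pt q.2).
Proof.
move=> oU; apply/seteqP; split => [x Ux|x [q qU /obox_sub_cbox]]; last exact: qU.
have /nbhs_ballP[e /= e_gt0 eU] : nbhs x U by exact: open_nbhs_nbhs.
have [a1 [b1 [/andP[? ?] /andP[? ?]]]] := rat_around x.1.1 e_gt0.
have [a2 [b2 [/andP[? ?] /andP[? ?]]]] := rat_around x.1.2 e_gt0.
have [a3 [b3 [/andP[? ?] /andP[? ?]]]] := rat_around x.2 e_gt0.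
exists ((a1, a2, a3), (b1, b2, b3)) => /=.
  move=> y [[/=]]; rewrite !in_itv /= => /andP[? ?] /andP[? ?] /andP[? ?].
  apply: eU; split; [split|]; rewrite /ball /= ltr_norml; apply/andP; split; lra.
by split; [split|]; rewrite /= in_itv /=; apply/andP; split.
Qed.

Lemma open_measurable_mpt (U : set (pt R)) : open U -> measurable (U : set (mpt R)).
Proof.
move=> /open_bigcup_obox ->; rewrite bigcup_mkcond.
apply: countable_bigcupT_measurable => [|q]; first exact: countableP.
by case: ifP => _ //; exact: obox_measurable.
Qed.

Lemma continuous_measurable_mpt (D : set (mpt R)) (f : sfield R) :
  measurable D -> continuous f -> @measurable_fun _ _ (mpt R) R D f.
Proof.
move=> mD fc; apply: measurable_funS (measurableT) (subsetT _) _.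
apply: (measurability _ (measurable_realfun.RGenOpens.measurableE R)) => _ [_ [a [b ->] <-]].
rewrite setTI; apply: open_measurable_mpt.
by move/continuousP: fc; apply; exact: interval_open.
Qed.

(** The coordinates are measurable for the sigma-algebra generated by the
    boxes, since a slab is a countable union of boxes; hence so is the
    identity. *)
Lemma measurable_obox : @measurable _ (mpt R) = <<s [set obox l u | l in setT & u in setT] >>.
Proof.
set G := [set _ | _ in _ & _ in _].
apply/seteqP; split; last first.
  apply: smallest_sub => [|_ [l _ [u _ <-]]]; last exact: obox_measurable.
  exact: sigma_algebra_measurable.
pose T := g_sigma_algebraType (G : set (set (mpt R))).
have natP (y : R) : exists2 n : nat, True & forall m, (n <= m)%N -> - m%:R < y < m%:R.
  exists (Num.truncn `|y|).+1 => // m nm; rewrite -ltr_norml.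
  by apply: lt_le_trans (truncnS_gt _) _; rewrite ler_nat.
pose N n : R := n%:R.
have mc (c : T -> R) (l u : nat -> R -> R -> pt R) :
    (forall a b, c @^-1` `]a, b[ = \bigcup_n obox (l n a b) (u n a b)) ->
    measurable_fun setT c.
  move=> cE; apply: (measurability _ (measurable_realfun.RGenOpens.measurableE R)) => _ [_ [a [b ->] <-]].
  rewrite setTI cE; apply: bigcupT_measurable => n; apply: sub_sigma_algebra.
  by exists (l n a b) => //; exists (u n a b).
have mc0 : measurable_fun setT (fun x : T => x.1.1).
  apply: (mc _ (fun n a b => (a, - N n, - N n)) (fun n a b => (b, N n, N n))) => a b.
  apply/seteqP; split => x; last by move=> [n _ [[]]].
  have [n _ nP] := natP x.1.2; have [m _ mP] := natP x.2.
  move=> xab; exists (maxn n m) => //; split; [split => //|]; rewrite /= in_itv /=.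
    by apply: nP; rewrite leq_maxl.
  by apply: mP; rewrite leq_maxr.
have mc1 : measurable_fun setT (fun x : T => x.1.2).
  apply: (mc _ (fun n a b => (- N n, a, - N n)) (fun n a b => (N n, b, N n))) => a b.
  apply/seteqP; split => x; last by move=> [n _ [[]]].
  have [n _ nP] := natP x.1.1; have [m _ mP] := natP x.2.
  move=> xab; exists (maxn n m) => //; split; [split => //|]; rewrite /= in_itv /=.
    by apply: nP; rewrite leq_maxl.
  by apply: mP; rewrite leq_maxr.
have mc2 : measurable_fun setT (fun x : T => x.2).
  apply: (mc _ (fun n a b => (- N n, - N n, a)) (fun n a b => (N n, N n, b))) => a b.
  apply/seteqP; split => x; last by move=> [n _ []].
  have [n _ nP] := natP x.1.1; have [m _ mP] := natP x.1.2.
  move=> xab; exists (maxn n m) => //; split; [split => //|] => //; rewrite /= in_itv /=.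
    by apply: nP; rewrite leq_maxl.
  by apply: mP; rewrite leq_maxr.
have mid : measurable_fun setT (fun x : T => (x.1.1, x.1.2, x.2) : mpt R).
  by apply: measurable_fun_pair => //; exact: measurable_fun_pair.
move=> S mS; have := mid measurableT S mS; rewrite setTI.
by rewrite (_ : _ @^-1` S = S) //; apply/seteqP; split => -[[]].
Qed.
End Boxes.

(** * Square integrable functions on a bounded open set *)

Lemma ae_imply (R : realType) (P Q : pt R -> Prop) :
  (forall x, P x -> Q x) -> {ae leb3 R, forall x, P x} -> {ae leb3 R, forall x, Q x}.
Proof.
by move=> PQ; apply: (@filterS _ (almost_everywhere (leb3 R)) (ae_filter_ringOfSetsType _)).
Qed.

Lemma ae_imply2 (R : realType) (P Q S : pt R -> Prop) :
  (forall x, P x -> Q x -> S x) ->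
  {ae leb3 R, forall x, P x} -> {ae leb3 R, forall x, Q x} -> {ae leb3 R, forall x, S x}.
Proof.
by move=> PQ; apply: (@filterS2 _ (almost_everywhere (leb3 R)) (ae_filter_ringOfSetsType _)).
Qed.

Lemma ae_forall (R : realType) (I : finType) (P : I -> pt R -> Prop) :
  (forall i, {ae leb3 R, forall x, P i x}) -> {ae leb3 R, forall x, forall i, P i x}.
Proof.
by move=> aeP; apply: (@filter_forall (mpt R) I P (almost_everywhere (leb3 R)) (ae_filter_ringOfSetsType _) aeP).
Qed.

Section L2Theory.
Variables (R : realType) (Omega : set (pt R)).
Hypotheses (oOmega : open Omega) (bOmega : bounded_set Omega).
Implicit Types (f g : sfield R).

Local Notation mu := (leb3 R).
Local Notation mfun f := (@measurable_fun _ _ (mpt R) R Omega f).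

Lemma measurable_Omega : @measurable _ (mpt R) Omega.
Proof. exact: open_measurable_mpt. Qed.
Local Hint Resolve measurable_Omega : core.

Lemma Omega_sub_cbox : exists M : R, Omega `<=` cbox (- M, - M, - M) (M, M, M).
Proof.
have [M [_ MO]] := bOmega; exists (M + 1) => x Ox.
have := MO (M + 1); rewrite ltrDl ltr01 => /(_ isT x Ox).
rewrite /= /Num.norm /= !ge_max -!andbA => /and3P[x0 x1 x2].
by rewrite /cbox; do !split; rewrite /= in_itv /= -ler_norml.
Qed.

Lemma measure_Omega_lty : (mu Omega < +oo)%E.
Proof.
have [M OM] := Omega_sub_cbox.
have mI : measurable (`[- M, M]%classic : set (measurableTypeR R)) by exact: measurable_itv.
apply: (@le_lt_trans _ _ (mu (cbox (- M, - M, - M) (M, M, M)))).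
  apply: le_measure => //; rewrite inE //.
  by apply: measurableX => //; exact: measurableX.
pose I : set (measurableTypeR R) := `[- M, M]%classic.
pose leb := @lebesgue_measure R.
have Ifin : (leb I < +oo)%E.
  rewrite /leb /I lebesgue_measure_itv /=.
  by case: ifP => _; rewrite -?EFinB ltry.
have -> : mu (cbox (- M, - M, - M) (M, M, M)) = ((leb \x leb) (I `*` I) * leb I)%E.
  by apply: product_measure1E => //; exact: measurableX.
rewrite product_measure1E //.
have fI : leb I \is a fin_num by rewrite ge0_fin_numE.
by rewrite ltey_eq !fin_numM.
Qed.

Lemma continuous_bounded f : continuous f -> exists M : R, forall x, Omega x -> `|f x| <= M.
Proof.
move=> fc; have [M OM] := Omega_sub_cbox.
have [B [_ BP]] : bounded_set (f @` cbox (- M, - M, - M) (M, M, M)).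
  apply: compact_bounded; apply: continuous_compact; last exact: cbox_compact.
  exact: continuous_subspaceT.
exists (B + 1) => x Ox; apply: (BP (B + 1)); first by rewrite ltrDl.
by exists x => //; exact: OM.
Qed.

(** Boundedness outside a null set only: piecewise polynomials are prescribed
    up to null sets. *)
Definition Linf f := mfun f /\ exists M : R, {ae mu, forall x, Omega x -> `|f x| <= M}.

Lemma integrable_mulL2 f g : L2 Omega f -> L2 Omega g ->
  mu.-integrable Omega (EFin \o (fun x => f x * g x)).
Proof.
move=> [mf f2] [mg g2]; apply: le_integrable (integrableD _ f2 g2) => //.
- by apply/measurable_EFinP; exact: measurable_funM.
- move=> x _; rewrite /= lee_fin [leRHS]ger0_norm ?addr_ge0 ?sqr_ge0 //.
  have := sqr_ge0 (f x - g x); have := sqr_ge0 (f x + g x).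
  by rewrite ler_norml => ? ?; apply/andP; split; nra.
Qed.

Lemma L2Dl (a : R) f g : L2 Omega f -> L2 Omega g -> L2 Omega (fun x => a * f x + g x).
Proof.
move=> f2 g2; split.
  apply: measurable_funD; last exact: g2.1.
  by apply: measurable_funM => //; exact: f2.1.
have -> : (fun x => ((a * f x + g x) ^+ 2)%:E) =
    (fun x => (a ^+ 2)%:E * (f x ^+ 2)%:E + (2 * a)%:E * (f x * g x)%:E + (g x ^+ 2)%:E)%E.
  by apply/funext => x; rewrite -!EFinM -!EFinD; congr EFin; ring.
apply: (integrableD _ _ g2.2) => //.
apply: integrableD => //.
  by apply: integrableZl => //; exact: f2.2.
by apply: integrableZl => //; exact: integrable_mulL2.
Qed.

Lemma L2_Linf f g : Linf f -> L2 Omega g -> L2 Omega (fun x => f x * g x).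
Proof.
move=> [mf [M [N [mN N0 NM]]]] [mg g2]; split; first exact: measurable_funM.
have mh : measurable_fun Omega (fun x : mpt R => ((f x * g x) ^+ 2)%:E).
  by apply/measurable_EFinP; apply: measurable_funX; exact: measurable_funM.
apply/(negligible_integrable mN) => //.
have mD : @measurable _ (mpt R) (Omega `\` N) by exact: measurableD.
apply: (@le_integrable _ _ _ mu _ mD _ (fun x => (M ^+ 2)%:E * (g x ^+ 2)%:E)%E).
- exact: measurable_funS mh.
- move=> x [Ox Nx]; rewrite -EFinM /= lee_fin ger0_norm ?sqr_ge0 //.
  rewrite [leRHS]ger0_norm; last by rewrite mulr_ge0 ?sqr_ge0.
  rewrite exprMn ler_wpM2r ?sqr_ge0 // -[f x ^+ 2]real_normK ?num_real //.
  have fM : `|f x| <= M by apply: contrapT => fM; apply: Nx; apply: NM => /= /(_ Ox).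
  by apply: lerXn2r => //; rewrite nnegrE (le_trans _ fM).
apply: (@integrableZl _ _ _ mu _ mD (M ^+ 2) (fun x => (g x ^+ 2)%:E)).
by apply: integrableS g2.
Qed.

Lemma Linf_bounded f : mfun f -> (exists M : R, forall x, Omega x -> `|f x| <= M) -> Linf f.
Proof. by move=> mf [M fM]; split=> //; exists M; apply: aeW. Qed.

Lemma L2_cst (a : R) : L2 Omega (fun=> a).
Proof.
split; first exact: measurable_cst.
apply: (@measurable_bounded_integrable _ _ _ mu (fun=> a ^+ 2) _ measurable_Omega measure_Omega_lty).
  exact: measurable_cst.
by exists `|a ^+ 2|; split=> [|M Ma x _]; [exact: num_real|exact: ltW].
Qed.

Lemma Linf_L2 f : Linf f -> L2 Omega f.
Proof.
move=> fb; have := L2_Linf fb (L2_cst 1).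
by under eq_fun do rewrite mulr1.
Qed.

Lemma continuous_Linf f : continuous f -> Linf f.
Proof.
move=> fc; apply: Linf_bounded; last exact: continuous_bounded.
exact: continuous_measurable_mpt.
Qed.

Definition null (T : nmodType) (F : pt R -> T) := ae_eq mu Omega F (fun=> 0).

Lemma sip_semi_inner : @semi_inner R (pt R -> R^o) (L2 Omega) (sip Omega).
Proof.
split=> [h h2 a f g f2 g2|f g f2 g2|f f2].
- rewrite /sip -RintegralZl //; last exact: integrable_mulL2.
  rewrite -RintegralD //; last exact: integrable_mulL2.
    by apply: eq_Rintegral => x _; rewrite /= mulrDl mulrA.
  apply: (@integrableZl _ _ _ mu Omega measurable_Omega a (EFin \o (fun x => f x * h x))).
  exact: integrable_mulL2.
- by apply: eq_Rintegral => x _; rewrite mulrC.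
- by apply: Rintegral_ge0 => x _; rewrite -expr2 sqr_ge0.
Qed.

Lemma sip_null f : L2 Omega f -> sip Omega f f = 0 <-> null f.
Proof.
move=> [mf f2].
have -> : sip Omega f f = 0 <-> (\int[mu]_(x in Omega) `|(f x ^+ 2)%:E| = 0)%E.
  have -> : (\int[mu]_(x in Omega) `|(f x ^+ 2)%:E|)%E = (sip Omega f f)%:E.
    rewrite /sip /Rintegral fineK.
      by apply: eq_integral => x _; rewrite /= ger0_norm ?sqr_ge0 // expr2.
    by apply: integrable_fin_num => //; exact: (@integrable_mulL2 f f).
  by split=> [->//|[]].
rewrite (ae_eq_integral_abs mu measurable_Omega); last first.
  by apply/measurable_EFinP; exact: measurable_funX.
split; apply: ae_imply => x h Ox.
  by have [/eqP] := h Ox; rewrite sqrf_eq0 => /eqP.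
by rewrite (h Ox) expr0n.
Qed.

Lemma sip_null0 f g : L2 Omega f -> L2 Omega g -> null g -> sip Omega f g = 0.
Proof.
move=> f2 g2 /(sip_null g2); apply: (semi_inner_null _ sip_semi_inner) => //.
split=> [|a u v]; [exact: (L2_cst 0)|exact: L2Dl].
Qed.

End L2Theory.

(** * Smooth functions with compact support *)

Section Flat.
Variable R : realType.
Implicit Types (P : {poly R}) (s : R).

(** A family containing t |-> exp (- 1 / t) and closed under differentiation,
    so that smoothness of its members needs no induction on the order. *)
Definition flat P s : R := if 0 < s then P.[s^-1] * expR (- s^-1) else 0.

Lemma expn_le_expR n (y : R) : 0 <= y -> y ^+ n <= n`!%:R * expR y.
Proof.
case: n => [|n] y_ge0; first by rewrite expr0 mul1r -[leLHS]expR0 ler_expR.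
have f_gt0 : 0 < n.+1`!%:R :> R by rewrite ltr0n fact_gt0.
rewrite mulrC -ler_pdivrMr //.
by have := expR_ge1Dxn n y_ge0; apply: le_trans; rewrite lerDr.
Qed.

Lemma horner_le_expR P : exists C : R, forall y, 0 <= y -> `|P.[y]| <= C * expR y.
Proof.
exists (\sum_(i < size P) `|P`_i| * i`!%:R) => y y_ge0.
rewrite horner_coef mulr_suml; apply: le_trans (ler_norm_sum _ _ _) _.
apply: ler_sum => i _; rewrite normrM -mulrA ler_wpM2l //.
by rewrite ger0_norm ?exprn_ge0 //; exact: expn_le_expR.
Qed.

Lemma flat_le0 P s : s <= 0 -> flat P s = 0.
Proof. by rewrite /flat ltNge => ->. Qed.

Lemma flat_gt0 P s : 0 < s -> flat P s = P.[s^-1] * expR (- s^-1).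
Proof. by rewrite /flat => ->. Qed.

(** The linear bound makes the function differentiable at 0; the factor 1 / t of
    the difference quotient is absorbed in the polynomial. *)
Lemma flat_bound P : exists C : R, forall s, `|flat P s| <= C * `|s|.
Proof.
have [C CP] := horner_le_expR (P * 'X); exists C => s.
have C_ge0 : 0 <= C.
  by have := CP 0 (lexx _); rewrite expR0 mulr1; apply: le_trans.
have [s_le0|s_gt0] := leP s 0; first by rewrite flat_le0 // normr0 mulr_ge0.
have sV_gt0 : 0 < s^-1 by rewrite invr_gt0.
rewrite flat_gt0 // (gtr0_norm s_gt0) normrM (ger0_norm (expR_ge0 _)) expRN.
rewrite ler_pdivrMr ?expR_gt0 // -(ler_pM2r sV_gt0) [leRHS]mulrAC mulfK ?gt_eqF //.
by have := CP _ (ltW sV_gt0); rewrite hornerM hornerX normrM (gtr0_norm sV_gt0).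
Qed.

Lemma is_derive_flat P s :
  is_derive s 1 (flat P) (flat ((P - P^`()) * 'X^2) s).
Proof.
(* At 0 the difference quotient of flat P is flat (P * 'X). *)
have [s_lt0|s_gt0|->] := ltgtP s 0.
- rewrite flat_le0 ?ltW //.
  apply: (@near_eq_is_derive _ _ _ (cst 0)).
  by near=> t; rewrite flat_le0 // ltW //; near: t; exact: lt_nbhsl.
- have s_neq0 : s != 0 by rewrite gt_eqF.
  have dV : is_derive s 1 (fun t : R => t^-1) (- s ^- 2).
    have := @is_deriveV R id s 1 1 s_neq0 (is_derive_id _ _).
    by move/is_derive_eq; apply; rewrite scaler1.
  have dP := is_derive1_comp (is_derive_poly P s^-1) dV.
  have dN := is_deriveN dV.
  have dE := @is_derive1_comp R (@expR R) (- (fun t => t^-1)) s _ _ (is_derive_expR _) dN.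
  have dPE := is_deriveM dP dE.
  apply: near_eq_is_derive (is_derive_eq dPE _).
    by near=> t; rewrite flat_gt0 //; near: t; exact: lt_nbhsr.
  rewrite flat_gt0 // hornerM hornerXn hornerD hornerN /GRing.scale /= exprVn.
  ring.
- have lim0 : (fun h : R => h^-1 *: ((flat P \o shift 0) (h *: 1) - flat P 0)) @ 0^' --> (0 : R).
    have [C CP] := flat_bound (P * 'X).
    have -> : (fun h : R => h^-1 *: ((flat P \o shift 0) (h *: 1) - flat P 0)) = flat (P * 'X).
      apply/funext => h; rewrite /= addr0 (flat_le0 P (lexx 0)) subr0 /GRing.scale /= mulr1.
      by rewrite /flat; case: ifP => _; rewrite ?mulr0 // hornerM hornerX; ring.
    apply/cvgr0Pnorm_le => e e_gt0.
    have C_ge0 : 0 <= C.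
      by apply: le_trans (normr_ge0 (flat (P * 'X) 1)) _; have := CP 1; rewrite normr1 mulr1.
    have d_gt0 : 0 < e / (C + 1) by rewrite divr_gt0 // ltr_wpDl.
    near=> h; apply: le_trans (CP h) _.
    have hd : `|h| <= e / (C + 1) by near: h; exact: dnbhs0_le.
    have : C * `|h| <= C * (e / (C + 1)) by rewrite ler_wpM2l.
    move/le_trans; apply; rewrite mulrCA ger_pMr // ler_pdivrMr ?ltr_wpDl //; lra.
  apply: DeriveDef; first by apply/cvg_ex; exists 0.
  by rewrite (flat_le0 _ (lexx 0)); exact: cvg_lim lim0.
Unshelve. all: by end_near.
Qed.

Lemma flat_continuous P : continuous (flat P).
Proof.
move=> s; apply: differentiable_continuous; apply/derivable1_diffP.
by case: (is_derive_flat P s).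
Qed.

End Flat.

Section SmoothAlgebra.
Variable R : realType.
Implicit Types (f g : sfield R) (S : set (sfield R)).

(** Functions obtained from S by ring operations.  If the partial derivatives
    of the members of S are again generated by S, all generated functions are
    smooth. *)
Inductive generated S : sfield R -> Prop :=
| gen_base f of S f : generated S f
| gen_cst (c : R) : generated S (fun=> c)
| gen_add f g of generated S f & generated S g : generated S (fun x => f x + g x)
| gen_mul f g of generated S f & generated S g : generated S (fun x => f x * g x).

Lemma pdD i f g : (forall x, derivable f x (basis3 R i)) ->
  (forall x, derivable g x (basis3 R i)) ->
  pd i (fun x => f x + g x) = fun x => pd i f x + pd i g x.
Proof. by move=> df dg; apply/funext => x; exact: (deriveD (df x) (dg x)). Qed.

Lemma pdM i f g : (forall x, derivable f x (basis3 R i)) ->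
  (forall x, derivable g x (basis3 R i)) ->
  pd i (fun x => f x * g x) = fun x => f x * pd i g x + g x * pd i f x.
Proof. by move=> df dg; apply/funext => x; exact: (deriveM (df x) (dg x)). Qed.

Lemma generated_smooth S :
  (forall f, S f -> continuous f /\
    forall i, (forall x, derivable f x (basis3 R i)) /\ generated S (pd i f)) ->
  forall f, generated S f -> smooth f.
Proof.
move=> SP.
have step f : generated S f -> continuous f /\
    forall i, (forall x, derivable f x (basis3 R i)) /\ generated S (pd i f).
  elim=> {f} [f /SP//|c|f g _ [fc fP] _ [gc gP]|f g af [fc fP] ag [gc gP]].
  - split=> [x|i]; first exact: cvg_cst.
    have -> : pd i (fun=> c) = fun=> (0 : R).
      by apply/funext => x; exact: derive_cst.
    by split=> [x|]; [exact: derivable_cst|exact: gen_cst].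
  - split=> [x|i]; first exact: (cvgD (fc x) (gc x)).
    have [[df af] [dg ag]] := (fP i, gP i); rewrite pdD //.
    by split=> [x|]; [exact: (derivableD (df x) (dg x))|exact: gen_add].
  - split=> [x|i]; first exact: (cvgM (fc x) (gc x)).
    have [[df af'] [dg ag']] := (fP i, gP i); rewrite pdM //.
    split=> [x|]; first exact: (derivableM (df x) (dg x)).
    by apply: gen_add; exact: gen_mul.
move=> f af s.
have : generated S (foldr (@pd R) f s).
  by elim: s => //= i s IHs; have [_ /(_ i)[]] := step _ IHs.
by move=> /step[gc gP]; split=> // x i; have [] := gP i.
Qed.

Lemma vecE (x : pt R) : (vec x 0 0 = x.1.1) * (vec x 0 1 = x.1.2) * (vec x 0 2%:R = x.2).
Proof. by rewrite /vec !mxE. Qed.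

Lemma ord3_ind (P : 'I_3 -> Prop) : P 0 -> P 1 -> P 2%:R -> forall i, P i.
Proof.
move=> P0 P1 P2 [[|[|[|//]]] lti].
- by rewrite (_ : Ordinal _ = 0) //; apply: val_inj.
- by rewrite (_ : Ordinal _ = 1) //; apply: val_inj.
- by rewrite (_ : Ordinal _ = 2%:R) //; apply: val_inj.
Qed.

Lemma vec_basis3 (h : R) i (x : pt R) j :
  vec (h *: basis3 R i + x) 0 j = h * (i == j)%:R + vec x 0 j.
Proof. by elim/ord3_ind: j; rewrite !vecE. Qed.

Lemma vec_continuous j : continuous (fun x : pt R => vec x 0 j).
Proof.
elim/ord3_ind: j => x; under eq_fun do rewrite vecE.
- by apply: cvg_comp; exact: cvg_fst.
- by apply: cvg_comp; [exact: cvg_fst|exact: cvg_snd].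
- exact: cvg_snd.
Qed.

Lemma is_derive_vec (g : R -> R) (d : R) i j (x : pt R) :
  is_derive (vec x 0 j) 1 g d ->
  is_derive x (basis3 R i) (fun y => g (vec y 0 j)) ((i == j)%:R * d).
Proof.
move=> [dg gd].
have E : (fun h : R => h^-1 *: (((fun y : pt R => g (vec y 0 j)) \o shift x) (h *: basis3 R i)
      - g (vec x 0 j))) =
   fun h => h^-1 * (g (h * (i == j)%:R + vec x 0 j) - g (vec x 0 j)).
  by apply/funext => h; rewrite /= vec_basis3.
have [ij|ij] := eqVneq i j; last first.
  have E0 : (fun h : R => h^-1 * (g (h * (i == j)%:R + vec x 0 j) - g (vec x 0 j))) = cst 0.
    by apply/funext => h; rewrite (negPf ij) mulr0 add0r subrr mulr0.
  rewrite mul0r; apply: DeriveDef; rewrite /derivable /derive E E0.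
    exact: is_cvg_cst.
  exact: lim_cst.
rewrite mul1r; apply: DeriveDef; rewrite /derivable /derive E ij eqxx.
  exact: dg.
exact: gd.
Qed.

Definition slab (j : 'I_3) (P : {poly R}) (a b : R) : sfield R :=
  fun x => flat P (a * vec x 0 j + b).

Definition slabs : set (sfield R) := [set f | exists j P a b, f = slab j P a b].

Lemma slabs_smooth f : generated slabs f -> smooth f.
Proof.
apply: generated_smooth => {}f [j [P [a [b ->]]]]; split=> [x|i].
  apply: (cvg_comp (fun x : pt R => a * vec x 0 j + b) (flat P)); last exact: flat_continuous.
  apply: cvgD; last exact: cvg_cst.
  by apply: cvgM; [exact: cvg_cst|exact: vec_continuous].
have der x : is_derive x (basis3 R i) (slab j P a b)
    ((i == j)%:R * (flat ((P - P^`()) * 'X^2) (a * vec x 0 j + b) * a)).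
  apply: (@is_derive_vec (flat P \o (fun t => a * t + b))).
  apply: is_derive1_comp.
    exact: is_derive_flat.
  have := is_deriveD (is_deriveZ a (is_derive_id (vec x 0 j) 1)) (is_derive_cst b (vec x 0 j) 1).
  by move/is_derive_eq; apply; rewrite addr0 [LHS]mulr1.
split=> [x|].
  by case: (der x).
have -> : pd i (slab j P a b) =
    fun x => (i == j)%:R * (flat ((P - P^`()) * 'X^2) (a * vec x 0 j + b) * a).
  by apply/funext => x; case: (der x).
apply: gen_mul; first exact: gen_cst.
apply: gen_mul; last exact: gen_cst.
by apply: gen_base; exists j, ((P - P^`()) * 'X^2), a, b.
Qed.

Lemma smooth_pd i f : smooth f -> smooth (pd i f).
Proof. by move=> fs s; have := fs (rcons s i); rewrite foldr_rcons. Qed.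

Lemma smooth_continuous f : smooth f -> continuous f.
Proof. by move=> /(_ [::])[]. Qed.

Lemma smooth_derivable f i x : smooth f -> derivable f x (basis3 R i).
Proof. by move=> /(_ [::])[_]. Qed.

Lemma smooth_cst (c : R) : smooth (fun=> c).
Proof. by apply: (@slabs_smooth (fun=> c)); exact: gen_cst. Qed.

Lemma pd_vec i j : pd i (fun x : pt R => vec x 0 j) = fun=> (i == j)%:R.
Proof.
apply/funext => x.
by have [_ pdE] := @is_derive_vec id 1 i j x (is_derive_id _ _); rewrite [LHS]pdE mulr1.
Qed.

Lemma derivable_vec i j x : derivable (fun x : pt R => vec x 0 j) x (basis3 R i).
Proof. by have [] := @is_derive_vec id 1 i j x (is_derive_id _ _). Qed.

(** Applied to the coordinate function and all iterated derivatives of f. *)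
Lemma smooth_vecM j f : smooth f -> smooth (fun x => vec x 0 j * f x).
Proof.
move=> fs; pose S := [set g | g = (fun x : pt R => vec x 0 j) \/ smooth g].
apply: (@generated_smooth S); last first.
  by apply: gen_mul; apply: gen_base; [left|right].
move=> g [->|gs].
  split=> [|i]; first exact: vec_continuous.
  split=> [x|]; first exact: derivable_vec.
  by rewrite pd_vec; exact: gen_cst.
split=> [|i]; first exact: smooth_continuous.
split=> [x|]; first exact: smooth_derivable.
by apply: gen_base; right; exact: smooth_pd.
Qed.

End SmoothAlgebra.

Section Bump.
Variable R : realType.
Implicit Types (l u : pt R) (n : nat).

(** Smooth, zero for t <= 0, and increasing to 1 with n for t > 0. *)
Definition step (n : nat) (t : R) : R := flat 1 (n.+1%:R * t).

Lemma step_le0 n t : t <= 0 -> step n t = 0.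
Proof. by move=> t_le0; rewrite /step flat_le0 // mulr_ge0_le0. Qed.

Lemma step_itv n t : 0 <= step n t <= 1.
Proof.
have [t_le0|t_gt0] := leP t 0; first by rewrite step_le0 // lexx ler01.
have nt_gt0 : 0 < n.+1%:R * t by rewrite mulr_gt0 // ltr0n.
by rewrite /step flat_gt0 // hornerC mul1r expR_ge0 expR_le1 oppr_le0 invr_ge0 ltW.
Qed.

Lemma step_cvg t : 0 < t -> step ^~ t @ \oo --> (1 : R).
Proof.
move=> t_gt0.
have -> : step ^~ t = fun n => expR (- (t^-1 * harmonic n)).
  apply/funext => n; rewrite /step flat_gt0 ?mulr_gt0 ?ltr0n // hornerC mul1r.
  by rewrite invfM mulrC.
rewrite -expR0 -oppr0 -(mulr0 t^-1).
apply: continuous_cvg; first exact: continuous_expR.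
by apply: cvgN; apply: cvgM; [exact: cvg_cst|exact: cvg_harmonic].
Qed.

Definition bump1 l u n (j : 'I_3) : sfield R := fun x =>
  step n (vec x 0 j - vec l 0 j) * step n (vec u 0 j - vec x 0 j).

Definition bump l u n : sfield R := fun x =>
  bump1 l u n 0 x * bump1 l u n 1 x * bump1 l u n 2%:R x.

Lemma bump_smooth l u n : smooth (bump l u n).
Proof.
apply: slabs_smooth.
have b1 j : generated (@slabs R) (bump1 l u n j).
  apply: gen_mul; apply: gen_base.
    exists j, 1, n.+1%:R, (- (n.+1%:R * vec l 0 j)).
    by apply/funext => x; rewrite /step /slab mulrBr.
  exists j, 1, (- n.+1%:R), (n.+1%:R * vec u 0 j).
  by apply/funext => x; rewrite /step /slab mulrBr addrC mulNr.
by apply: gen_mul; first exact: gen_mul.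
Qed.

Lemma oboxP l u x : obox l u x <-> forall j, vec l 0 j < vec x 0 j < vec u 0 j.
Proof.
split=> [[[/= + +] +]|xP].
  by rewrite !in_itv => ? ? ?; elim/ord3_ind => //; rewrite !vecE.
have := (xP 0, xP 1, xP 2%:R); rewrite !vecE => -[[x0 x1] x2].
by split; [split|] => /=; rewrite in_itv.
Qed.

Lemma bump_out l u n x : ~ obox l u x -> bump l u n x = 0.
Proof.
move=> /oboxP /existsNP[j xj].
have : bump1 l u n j x = 0.
  rewrite /bump1; move/negP: xj; rewrite negb_and -!leNgt => /orP[xj|xj].
    by rewrite (@step_le0 _ (vec x 0 j - _)) ?mul0r // subr_le0.
  by rewrite (@step_le0 _ (_ - vec x 0 j)) ?mulr0 // subr_le0.
rewrite /bump; move: j {xj}; elim/ord3_ind => ->; ring.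
Qed.

Lemma bump_norm l u n x : `|bump l u n x| <= 1.
Proof.
have b1 j : `|bump1 l u n j x| <= 1.
  have s t : `|step n t| <= 1 by have /andP[s0 s1] := step_itv n t; rewrite ger0_norm.
  by rewrite normrM mulr_ile1.
by rewrite /bump 2!normrM; apply: mulr_ile1; rewrite ?mulr_ge0 // mulr_ile1.
Qed.

Lemma bump_cvg l u x : (fun n => bump l u n x) @ \oo --> (\1_(obox l u) x : R).
Proof.
rewrite indicE; have [xO|xO] := boolP (x \in obox l u); last first.
  rewrite notin_setE in xO; under eq_fun do rewrite bump_out //.
  exact: cvg_cst.
rewrite inE in xO; move/oboxP: xO => xO.
have b1 j : (fun n => bump1 l u n j x) @ \oo --> (1 : R).
  have /andP[lx xu] := xO j; rewrite -[1]mulr1.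
  by apply: cvgM; apply: step_cvg; rewrite subr_gt0.
by rewrite -[X in _ --> X](mulr1 1) -{1}(mulr1 1); apply: cvgM => //; exact: cvgM.
Qed.

Lemma bump_test Omega l u n : cbox l u `<=` Omega -> test_fun Omega (bump l u n).
Proof.
move=> lO; have supp : closure [set x | bump l u n x != 0] `<=` cbox l u.
  rewrite [X in _ `<=` X](closure_id _).1; last first.
    by apply: compact_closed; [exact: norm_hausdorff|exact: cbox_compact].
  apply: closureS => x /= /eqP bx; apply: obox_sub_cbox.
  by apply: contrapT => /bump_out.
split; first exact: bump_smooth.
  by apply: subclosed_compact supp; [exact: closed_closure|exact: cbox_compact].
exact: subset_trans lO.
Qed.

End Bump.

Section FundamentalLemma.
Variables (R : realType) (Omega : set (pt R)).
Hypotheses (oOmega : open Omega) (bOmega : bounded_set Omega).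
Local Notation mu := (leb3 R).

(** Fundamental lemma of the calculus of variations.  Bump functions converge
    boundedly to the indicator of a box, so g has integral 0 over all boxes in
    Omega; these form a pi-system generating the Borel sets, so g vanishes
    almost everywhere on each box, and countably many boxes cover Omega. *)
Theorem null_of_orthogonal_test (g : sfield R) : L2 Omega g ->
  (forall phi, test_fun Omega phi -> sip Omega g phi = 0) -> null Omega g.
Proof.
move=> g2 g0.
have mO := measurable_Omega oOmega.
have gint : mu.-integrable Omega (EFin \o g).
  have := integrable_mulL2 oOmega g2 (L2_cst oOmega bOmega 1).
  by under eq_fun do rewrite mulr1.
have box0 l u : cbox l u `<=` Omega -> (\int[mu]_(x in obox l u) (g x)%:E = 0)%E.
  move=> lO; have OO : obox l u `<=` Omega by apply: subset_trans lO; exact: obox_sub_cbox.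
  have -> : (\int[mu]_(x in obox l u) (g x)%:E =
      \int[mu]_(x in Omega) (g x * \1_(obox l u) x)%:E)%E.
    rewrite -{1}(setIidr OO) integral_mkcondr; apply: eq_integral => x _.
    by rewrite patchE indicE; case: (x \in _) => /=; rewrite ?mulr1 ?mulr0.
  have mb n : @measurable_fun _ _ (mpt R) R Omega (bump l u n).
    apply: continuous_measurable_mpt => //.
    exact/smooth_continuous/bump_smooth.
  have [|||||_ _] := @dominated_convergence _ _ _ mu Omega mO
      (fun n x => (g x * bump l u n x)%:E) (fun x => (g x * \1_(obox l u) x)%:E)
      (EFin \o (Num.norm \o g)).
  - by move=> n; apply/measurable_EFinP; apply: measurable_funM; [exact: g2.1|exact: mb].
  - apply/measurable_EFinP; apply: measurable_funM; first exact: g2.1.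
    by apply: measurable_indic; exact: obox_measurable.
  - apply: aeW => x _; apply: cvg_EFin; first exact: nearW.
    by apply: cvgM; [exact: cvg_cst|exact: bump_cvg].
  - exact: integrable_norm.
  - apply: aeW => x n _; rewrite /= lee_fin normrM ler_piMr //.
    exact: bump_norm.
  move=> lim_int; apply/esym; apply: (cvg_unique _ _ lim_int) => //.
  rewrite (_ : [sequence _]_n = cst 0%E); first exact: cvg_cst.
  apply/funext => n /=.
  have := g0 _ (@bump_test _ _ l u n lO); rewrite /sip /Rintegral => sip0.
  rewrite -[LHS]fineK ?sip0 //; apply: integrable_fin_num => //.
  apply: (@integrable_mulL2 _ _ oOmega g (bump l u n)) => //; apply: Linf_L2 => //.
  apply: continuous_Linf => //.
  exact/smooth_continuous/bump_smooth.
have ae_box l u : cbox l u `<=` Omega -> ae_eq mu (obox l u) g (fun=> 0).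
  move=> lO; have mB := @obox_measurable R l u.
  have OO : obox l u `<=` Omega by apply: subset_trans lO; exact: obox_sub_cbox.
  have gB : mu.-integrable (obox l u) (EFin \o g) by exact: integrableS gint.
  (* Dynkin induction on the set of integration, inside a fixed box. *)
  suff : ae_eq mu (obox l u) (EFin \o g) (cst 0%E).
    by apply: ae_imply => x h Bx; have [] := h Bx.
  apply: integral_ae_eq => // S SB mS; rewrite integral_cst // mul0e.
  rewrite -(setIidr SB).
  pose P (S : set (mpt R)) := (\int[mu]_(x in obox l u `&` S) (g x)%:E = 0)%E.
  have intS (S' : set (mpt R)) : measurable S' ->
      mu.-integrable (obox l u `&` S') (EFin \o g).
    by move=> mS'; apply: integrableS gB => //; exact: measurableI.
  apply: (@dynkin_induction _ (mpt R) [set obox l u | l in setT & u in setT] P).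
  - exact: measurable_obox.
  - exact: obox_setI_closed.
  - by rewrite /P setIT; exact: box0.
  - move=> _ [l' _ [u' _ <-]]; rewrite /P.
    rewrite obox_setI; apply: box0.
    by apply: subset_trans lO; exact: cbox_ptmax_ptmin.
  - move=> S' mS' PS'.
    have UE : (obox l u `&` S') `|` (obox l u `&` ~` S') = obox l u.
      by rewrite -setIUr setUCr setIT.
    have := box0 _ _ lO; rewrite -{1}UE integral_setU.
    + by rewrite [X in (X + _)%E]PS' add0e.
    + exact: measurableI.
    + by apply: measurableI => //; exact: measurableC.
    + by rewrite UE; exact: measurable_int gB.
    + by rewrite disj_set2E; apply/eqP; rewrite setIACA setICr setI0.
  - move=> F mF tF PF; rewrite /P setI_bigcupr.
    rewrite integral_bigcup.
    + by apply: eseries0 => n _ _; exact: PF.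
    + exact: trivIset_setIl.
    + by move=> n; exact: measurableI.
    + rewrite -setI_bigcupr; apply: intS; exact: bigcupT_measurable.
  - by rewrite -measurable_obox.
rewrite /null (open_bigcup_obox oOmega).
have countU (I : countType) (C : set I) (A : I -> set (mpt R)) :
    (forall i, C i -> ae_eq mu (A i) g (fun=> 0)) ->
    ae_eq mu (\bigcup_(i in C) A i) g (fun=> 0).
  move=> AC.
  pose N (i : I) : set (mpt R) := [set x | C i /\ ~ (A i x -> g x = 0)].
  have negN i : mu.-negligible (N i).
    have [Ci|nCi] := pselect (C i); last first.
      by rewrite (_ : N i = set0); [exact: negligible_set0|apply/seteqP; split => x // []].
    by apply: negligibleS (AC i Ci) => x [].
  have : mu.-negligible (\bigcup_n (if unpickle n is Some i then N i else set0)).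
    apply: negligible_bigcup => n; case: (unpickle n) => [i|]; first exact: negN.
    exact: negligible_set0.
  apply: negligibleS => x /= /not_implyP[[i Ci Aix] gx].
  by exists (pickle i) => //; rewrite pickleK; split => // /(_ Aix).
by apply: countU => q; exact: ae_box.
Qed.
End FundamentalLemma.

(** * Square integrable fields *)

Section MatrixFields.
Variables (R : realType) (Omega : set (pt R)).
Hypotheses (oOmega : open Omega) (bOmega : bounded_set Omega).
Local Notation mu := (leb3 R).
Let mO := measurable_Omega oOmega.

Definition mL2 m n : set (pt R -> 'M[R]_(m, n)) :=
  [set F | forall i j, L2 Omega (fun x => F x i j)].

Lemma L2v_mL2 (F : vfield R) : L2v Omega F <-> mL2 F.
Proof. by split=> [F2 i j|F2 i]; [rewrite (ord1 i)|]; exact: F2. Qed.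

Lemma L2_subspace : @subspace R (pt R -> R^o) (L2 Omega).
Proof. by split=> [|a u v]; [exact: L2_cst|exact: L2Dl]. Qed.

Lemma L2B (f g : sfield R) : L2 Omega f -> L2 Omega g -> L2 Omega (fun x => f x - g x).
Proof. exact: (subspaceB L2_subspace). Qed.

Lemma mL2_subspace m n : subspace (@mL2 m n).
Proof.
split=> [i j|a F G F2 G2 i j].
  by under eq_fun do rewrite mxE; exact: L2_cst.
by under eq_fun do rewrite !mxE; apply: L2Dl.
Qed.

Lemma Rintegral_sum (I : Type) (r : seq I) (f : I -> sfield R) :
  (forall i, mu.-integrable Omega (EFin \o f i)) ->
  \int[mu]_(x in Omega) (\sum_(i <- r) f i x) =
  \sum_(i <- r) \int[mu]_(x in Omega) f i x.
Proof.
move=> fint; elim: r => [|i r IHr].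
  rewrite big_nil; under eq_Rintegral do rewrite big_nil.
  by rewrite Rintegral_cst // mul0r.
rewrite big_cons -IHr -RintegralD //.
  by apply: eq_Rintegral => x _; rewrite big_cons.
rewrite (_ : EFin \o _ = fun x => (\sum_(j <- r) (f j x)%:E)%E).
  by apply: integrable_sum => // j _; exact: fint.
by apply/funext => x; rewrite /= sumEFin.
Qed.

Lemma mipE m n (F G : pt R -> 'M[R]_(m, n)) : mL2 F -> mL2 G ->
  mip Omega F G = \sum_i \sum_j sip Omega (fun x => F x i j) (fun x => G x i j).
Proof.
move=> F2 G2.
have int1 i j : mu.-integrable Omega (EFin \o (fun x => F x i j * G x i j)).
  exact: integrable_mulL2.
rewrite /mip.
have -> : \int[mu]_(x in Omega) \tr (F x *m (G x)^T) =
    \int[mu]_(x in Omega) (\sum_i \sum_j F x i j * G x i j).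
  apply: eq_Rintegral => x _; apply: eq_bigr => i _; rewrite mxE.
  by apply: eq_bigr => j _; rewrite mxE.
rewrite Rintegral_sum => [|i].
  by apply: eq_bigr => i _; rewrite Rintegral_sum.
rewrite (_ : EFin \o _ = fun x => (\sum_j (F x i j * G x i j)%:E)%E).
  by apply: integrable_sum => // j _; exact: int1.
by apply/funext => x; rewrite /= sumEFin.
Qed.

Lemma mip_semi_inner m n : semi_inner (@mL2 m n) (mip Omega).
Proof.
have [sl sC s0] := sip_semi_inner oOmega.
split=> [H H2 a F G F2 G2|F G F2 G2|F F2].
- have FG2 : mL2 (a *: F + G) by case: (mL2_subspace m n) => _; exact.
  rewrite !mipE // mulr_sumr -big_split; apply: eq_bigr => i _ /=.
  rewrite mulr_sumr -big_split; apply: eq_bigr => j _ /=.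
  rewrite -(sl _ (H2 i j) a) //.
  by apply: eq_Rintegral => x _; rewrite !mxE.
- by rewrite !mipE //; apply: eq_bigr => i _; apply: eq_bigr => j _; rewrite sC.
- by rewrite mipE // sumr_ge0 // => i _; rewrite sumr_ge0 // => j _; exact: s0.
Qed.

Lemma null_entries m n (F : pt R -> 'M[R]_(m, n)) :
  null Omega F <-> forall i j, null Omega (fun x => F x i j).
Proof.
split=> [F0 i j|F0].
  by apply: ae_imply F0 => x F0 Ox; rewrite F0 ?mxE.
have F0' : forall i, {ae mu, forall x, forall j, Omega x -> F x i j = 0}.
  by move=> i; apply: ae_forall => j; exact: F0.
apply: ae_imply (ae_forall F0') => x {}F0 Ox.
by apply/matrixP => i j; rewrite mxE F0.
Qed.

Lemma mip_null m n (F : pt R -> 'M[R]_(m, n)) : mL2 F ->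
  mip Omega F F = 0 <-> null Omega F.
Proof.
have [_ _ s0] := sip_semi_inner oOmega.
move=> F2; rewrite mipE //; split=> [/eqP|/null_entries F0].
  rewrite psumr_eq0 => [/allP F0|i _]; last by rewrite sumr_ge0 // => j _; exact: s0.
  apply/null_entries => i j; apply/(sip_null oOmega) => //.
  have := F0 i (mem_index_enum i).
  rewrite /= psumr_eq0 => [/allP/(_ j (mem_index_enum j))/eqP//|k _].
  exact: s0.
by rewrite big1 // => i _; rewrite big1 // => j _; apply/(sip_null oOmega).
Qed.

Lemma mip_null0 m n (F G : pt R -> 'M[R]_(m, n)) : mL2 F -> mL2 G ->
  null Omega G -> mip Omega F G = 0.
Proof.
move=> F2 G2 /(mip_null G2).
exact: (semi_inner_null (mL2_subspace m n) (mip_semi_inner m n)).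
Qed.

Lemma mipC m n (F G : pt R -> 'M[R]_(m, n)) : mip Omega F G = mip Omega G F.
Proof.
apply: eq_Rintegral => x _; rewrite -[in LHS]mxtrace_tr trmx_mul trmxK.
by [].
Qed.

Lemma ae_eq_null m n (F G : pt R -> 'M[R]_(m, n)) :
  ae_eq mu Omega F G <-> null Omega (F - G).
Proof.
split; apply: ae_imply => x FG Ox.
  by apply/eqP; rewrite subr_eq0; apply/eqP; exact: FG.
by apply/eqP; rewrite -subr_eq0; apply/eqP; exact: FG.
Qed.

Lemma mip_ael m n (F G W : pt R -> 'M[R]_(m, n)) : mL2 F -> mL2 G -> mL2 W ->
  ae_eq mu Omega F G -> mip Omega F W = mip Omega G W.
Proof.
move=> F2 G2 W2 /ae_eq_null FG; apply/eqP; rewrite -subr_eq0.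
have [ml _ _] := mip_semi_inner m n.
rewrite -(linear_onB (mL2_subspace m n) (ml _ W2)) // mipC mip_null0 //.
exact: subspaceB (mL2_subspace m n) F2 G2.
Qed.

Lemma mipDl m n (a : R) (F G W : pt R -> 'M[R]_(m, n)) : mL2 F -> mL2 G -> mL2 W ->
  mip Omega (a *: F + G) W = a * mip Omega F W + mip Omega G W.
Proof. by move=> F2 G2 W2; have [ml _ _] := mip_semi_inner m n; rewrite ml. Qed.

Lemma sipDl (a : R) (f g w : sfield R) : L2 Omega f -> L2 Omega g -> L2 Omega w ->
  sip Omega (fun x => a * f x + g x) w = a * sip Omega f w + sip Omega g w.
Proof. by move=> f2 g2 w2; have [sl _ _] := sip_semi_inner oOmega; rewrite -sl. Qed.

Lemma sipD (f g w : sfield R) : L2 Omega f -> L2 Omega g -> L2 Omega w ->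
  sip Omega (fun x => f x + g x) w = sip Omega f w + sip Omega g w.
Proof.
move=> f2 g2 w2; rewrite -[X in X + _]mul1r -(sipDl 1 f2 g2 w2).
by apply: eq_Rintegral => x _; rewrite mul1r.
Qed.

Lemma L2D (f g : sfield R) : L2 Omega f -> L2 Omega g -> L2 Omega (fun x => f x + g x).
Proof.
move=> f2 g2; rewrite (_ : (fun x => _) = fun x => 1 * f x + g x); first exact: L2Dl.
by apply/funext => x; rewrite mul1r.
Qed.

Lemma sipC (f g : sfield R) : sip Omega f g = sip Omega g f.
Proof. by apply: eq_Rintegral => x _; rewrite mulrC. Qed.

Lemma sip_ael (f g w : sfield R) : L2 Omega f -> L2 Omega g -> L2 Omega w ->
  ae_eq mu Omega f g -> sip Omega f w = sip Omega g w.
Proof.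
move=> f2 g2 w2 fg; apply/eqP; rewrite -subr_eq0.
have [sl _ _] := sip_semi_inner oOmega.
rewrite -(linear_onB L2_subspace (sl _ w2)) // sipC sip_null0 //.
  exact: L2B.
by apply: ae_imply fg => x fg Ox; apply/eqP; rewrite subr_eq0; apply/eqP; exact: fg.
Qed.

Lemma L20_subspace : @subspace R (pt R -> R^o) (L20 Omega).
Proof.
have one2 := L2_cst oOmega bOmega 1.
have E (f : sfield R) : \int[mu]_(x in Omega) f x = sip Omega f (fun=> 1).
  by apply: eq_Rintegral => x _; rewrite mulr1.
have L2s := L2_subspace; have [sl _ _] := sip_semi_inner oOmega.
split=> [|a f g [f2 f0] [g2 g0]].
  split; first exact: L2s.1.
  by rewrite Rintegral_cst // mul0r.
split; first exact: L2s.2.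
by rewrite E sl // -!E f0 g0 mulr0 addr0.
Qed.

(** * Weak derivatives are unique and linear *)

Lemma test_cst0 : test_fun Omega (fun=> 0 : R).
Proof.
have E : [set x : pt R | (0 : R) != 0] = set0.
  by apply/seteqP; split => x //=; rewrite eqxx.
split; first exact: smooth_cst.
  by rewrite E closure0; exact: compact0.
by rewrite E closure0.
Qed.

Lemma test_smooth (phi : sfield R) : test_fun Omega phi -> smooth phi.
Proof. by case. Qed.

Lemma smooth_Linf (phi : sfield R) : smooth phi -> Linf Omega phi.
Proof. by move=> /smooth_continuous; exact: continuous_Linf. Qed.

Lemma smooth_L2 (phi : sfield R) : smooth phi -> L2 Omega phi.
Proof. by move=> /smooth_Linf; exact: Linf_L2. Qed.

Lemma pd_L2 i (phi : sfield R) : smooth phi -> L2 Omega (pd i phi).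
Proof. by move=> /(smooth_pd i)/smooth_L2. Qed.

Lemma grad_L2 (phi : sfield R) : smooth phi -> mL2 (grad phi).
Proof. by move=> ps; apply/L2v_mL2 => i; under eq_fun do rewrite mxE; exact: pd_L2. Qed.

Lemma smoothv_L2 (Phi : vfield R) : smoothv Phi -> mL2 Phi.
Proof. by move=> ps; apply/L2v_mL2 => i; apply/smooth_L2/ps. Qed.

Lemma curl_L2 (Phi : vfield R) : smoothv Phi -> mL2 (curl Phi).
Proof.
move=> ps; apply/L2v_mL2 => i; under eq_fun do rewrite mxE.
by apply: L2B; apply: pd_L2; exact: ps.
Qed.

Lemma ae_eq_sip_test (g h : sfield R) : L2 Omega g -> L2 Omega h ->
  (forall phi, test_fun Omega phi -> sip Omega g phi = sip Omega h phi) ->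
  ae_eq mu Omega g h.
Proof.
move=> g2 h2 gh.
have : null Omega (fun x => g x - h x).
  apply: null_of_orthogonal_test => // [|phi tphi]; first exact: L2B.
  have [sl _ _] := sip_semi_inner oOmega.
  have p2 : L2 Omega phi by exact/smooth_L2/test_smooth.
  rewrite [LHS](linear_onB L2_subspace (sl _ p2) g2 h2).
  by rewrite gh // subrr.
by apply: ae_imply => x E Ox; apply/eqP; rewrite -subr_eq0 E.
Qed.

Lemma is_wpd_unique i u g h : is_wpd Omega i u g -> is_wpd Omega i u h ->
  ae_eq mu Omega g h.
Proof.
move=> [g2 gP] [h2 hP]; apply: ae_eq_sip_test => // phi tphi.
by apply: oppr_inj; rewrite -gP // hP.
Qed.

Lemma is_wpdDl i (a : R) u v g h : L2 Omega u -> L2 Omega v ->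
  is_wpd Omega i u g -> is_wpd Omega i v h ->
  is_wpd Omega i (fun x => a * u x + v x) (fun x => a * g x + h x).
Proof.
move=> u2 v2 [g2 gP] [h2 hP]; split=> [|phi tphi]; first exact: L2Dl.
have ps := test_smooth tphi; have p2 := smooth_L2 ps; have dp2 := pd_L2 i ps.
by rewrite (sipDl a u2 v2 dp2) (sipDl a g2 h2 p2) gP // hP // mulrN opprD.
Qed.

Lemma wpdP i u : (exists g, is_wpd Omega i u g) -> is_wpd Omega i u (wpd Omega i u).
Proof. by move=> [g gP]; apply: getPex; exists g. Qed.

Lemma wpdDl i (a : R) u v : H1 Omega u -> H1 Omega v ->
  ae_eq mu Omega (wpd Omega i (fun x => a * u x + v x))
    (fun x => a * wpd Omega i u x + wpd Omega i v x).
Proof.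
move=> [u2 /(_ i)/wpdP uP] [v2 /(_ i)/wpdP vP].
have lP := is_wpdDl a u2 v2 uP vP.
by apply: is_wpd_unique (lP); apply: wpdP; eexists; exact: lP.
Qed.

Lemma wpd_null i u : L2 Omega u -> null Omega u -> null Omega (wpd Omega i u).
Proof.
move=> u2 u0; have P0 : is_wpd Omega i u (fun=> 0).
  split=> [|phi tphi]; first exact: L2_cst.
  have p2 := smooth_L2 (test_smooth tphi); have dp2 := pd_L2 i (test_smooth tphi).
  rewrite sipC sip_null0 // sipC sip_null0 ?oppr0 //; first exact: L2_cst.
  exact: aeW.
by apply: is_wpd_unique (P0); apply: wpdP; eexists; exact: P0.
Qed.

Lemma wpd_L2 i u : H1 Omega u -> L2 Omega (wpd Omega i u).
Proof. by move=> [_ /(_ i)/wpdP[]]. Qed.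

Definition H1v : set (vfield R) := [set u | forall j, H1 Omega (fun x => u x 0 j)].

Lemma H1v_L2 u : H1v u -> mL2 u.
Proof. by move=> u1; apply/L2v_mL2 => j; case: (u1 j). Qed.

Lemma wgradv_L2 u : H1v u -> mL2 (wgradv Omega u).
Proof. by move=> u1 i j; under eq_fun do rewrite mxE; exact: wpd_L2. Qed.

Lemma wgradvDl (a : R) u v : H1v u -> H1v v ->
  ae_eq mu Omega (wgradv Omega (a *: u + v)) (a *: wgradv Omega u + wgradv Omega v).
Proof.
move=> u1 v1; apply/ae_eq_null/null_entries => i j.
have E : (fun y => (a *: u + v) y 0 j) = fun y => a * u y 0 j + v y 0 j.
  by apply/funext => y; rewrite !mxE.
by apply: ae_imply (wpdDl i a (u1 j) (v1 j)) => x h Ox; rewrite !mxE E h // subrr.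
Qed.

Lemma wgradv_null u : H1v u -> null Omega u -> null Omega (wgradv Omega u).
Proof.
move=> u1 /null_entries u0; apply/null_entries => i j.
have := wpd_null i (u1 j).1 (u0 0 j).
by apply: ae_imply => x h Ox; rewrite mxE h.
Qed.

Let single (k : 'I_3) (phi : sfield R) : vfield R := fun x => phi x *: delta_mx 0 k.

Lemma single_test k phi : test_fun Omega phi -> test_field Omega (single k phi).
Proof.
move=> tphi i; have -> : (fun x => single k phi x 0 i) = fun x => phi x * (i == k)%:R.
  by apply/funext => x; rewrite !mxE.
case: eqP => _.
  by rewrite (_ : (fun x => _) = phi) //; apply/funext => x; rewrite [LHS]mulr1.
by rewrite (_ : (fun x => _) = fun=> 0); [exact: test_cst0|apply/funext => x; rewrite [LHS]mulr0].
Qed.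

(** Test fields with a single nonzero component reduce statements on fields to
    statements on their components. *)
Lemma mip_single (F : vfield R) k phi : mL2 F -> test_fun Omega phi ->
  mip Omega F (single k phi) = sip Omega (fun x => F x 0 k) phi.
Proof.
move=> F2 tphi; have s2 : mL2 (single k phi).
  by apply: smoothv_L2 => i; apply: test_smooth; exact: single_test.
rewrite mipE // big_ord1 (bigD1 k) //= big1 ?addr0 => [|j jk].
  by apply: eq_Rintegral => x _; rewrite !mxE !eqxx mulr1.
rewrite -[RHS](mul0r (fine (mu Omega))) -Rintegral_cst //.
by apply: eq_Rintegral => x _; rewrite !mxE (negPf jk) !mulr0.
Qed.

Lemma is_wcurl_unique F G H : is_wcurl Omega F G -> is_wcurl Omega F H ->
  ae_eq mu Omega G H.
Proof.
move=> [/L2v_mL2 G2 GP] [/L2v_mL2 H2 HP]; apply/ae_eq_null/null_entries => i k.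
have := ae_eq_sip_test (G2 0 k) (H2 0 k).
have GH : forall phi, test_fun Omega phi ->
    sip Omega (fun x => G x 0 k) phi = sip Omega (fun x => H x 0 k) phi.
  move=> phi tphi; rewrite -!mip_single // -GP; last exact: single_test.
  by rewrite HP //; exact: single_test.
by move=> /(_ GH); apply: ae_imply => x h Ox; rewrite (ord1 i) !mxE h // subrr.
Qed.

Definition Hcurl : set (vfield R) :=
  [set F | L2v Omega F /\ exists G, is_wcurl Omega F G].

Definition Hdiv : set (vfield R) :=
  [set F | L2v Omega F /\ exists g, is_wdiv Omega F g].

Lemma wcurlP F : Hcurl F -> is_wcurl Omega F (wcurl Omega F).
Proof. by move=> [_ [G GP]]; apply: getPex; exists G. Qed.

Lemma wdivP F : Hdiv F -> is_wdiv Omega F (wdiv Omega F).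
Proof. by move=> [_ [g gP]]; apply: getPex; exists g. Qed.

Lemma wcurl_L2 F : Hcurl F -> mL2 (wcurl Omega F).
Proof. by move=> /wcurlP[/L2v_mL2]. Qed.

Lemma wdiv_L2 F : Hdiv F -> L2 Omega (wdiv Omega F).
Proof. by move=> /wdivP[]. Qed.

Lemma is_wcurlDl (a : R) F F' : Hcurl F -> Hcurl F' ->
  is_wcurl Omega (a *: F + F') (a *: wcurl Omega F + wcurl Omega F').
Proof.
move=> HF HF'; have [/L2v_mL2 G2 GP] := wcurlP HF; have [/L2v_mL2 G2' GP'] := wcurlP HF'.
split=> [|Phi tPhi]; first by apply/L2v_mL2; case: (mL2_subspace 1 3) => _; exact.
have Ps : smoothv Phi by move=> i; exact: test_smooth.
have [[/L2v_mL2 F2 _] [/L2v_mL2 F2' _]] := (HF, HF').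
rewrite !mipDl //; [|exact: smoothv_L2|exact: curl_L2].
by rewrite GP // GP'.
Qed.

Lemma wcurlDl (a : R) F F' : Hcurl F -> Hcurl F' ->
  ae_eq mu Omega (wcurl Omega (a *: F + F')) (a *: wcurl Omega F + wcurl Omega F').
Proof.
move=> HF HF'; have lP := is_wcurlDl a HF HF'.
by apply: is_wcurl_unique (lP); apply: getPex; eexists; exact: lP.
Qed.

Lemma is_wdiv_unique F g h : is_wdiv Omega F g -> is_wdiv Omega F h ->
  ae_eq mu Omega g h.
Proof.
move=> [g2 gP] [h2 hP]; apply: ae_eq_sip_test => // phi tphi.
by apply: oppr_inj; rewrite -gP // hP.
Qed.

Lemma is_wdivDl (a : R) F F' : Hdiv F -> Hdiv F' ->
  is_wdiv Omega (a *: F + F') (fun x => a * wdiv Omega F x + wdiv Omega F' x).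
Proof.
move=> HF HF'; have [g2 gP] := wdivP HF; have [g2' gP'] := wdivP HF'.
have [[/L2v_mL2 F2 _] [/L2v_mL2 F2' _]] := (HF, HF').
split=> [|phi tphi]; first exact: L2Dl.
have ps := test_smooth tphi.
rewrite mipDl //; last exact: grad_L2.
rewrite (gP _ tphi).
rewrite (gP' _ tphi).
rewrite (sipDl a g2 g2' (smooth_L2 ps)).
by rewrite mulrN [RHS]opprD.
Qed.

Lemma wdivDl (a : R) F F' : Hdiv F -> Hdiv F' ->
  ae_eq mu Omega (wdiv Omega (a *: F + F')) (fun x => a * wdiv Omega F x + wdiv Omega F' x).
Proof.
move=> HF HF'; have lP := is_wdivDl a HF HF'.
by apply: is_wdiv_unique (lP); apply: getPex; eexists; exact: lP.
Qed.

Lemma wdiv_null F : mL2 F -> null Omega F -> null Omega (wdiv Omega F).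
Proof.
move=> F2 F0; have P0 : is_wdiv Omega F (fun=> 0).
  split=> [|phi tphi]; first exact: L2_cst.
  have ps := test_smooth tphi.
  rewrite mipC mip_null0 //; last exact: grad_L2.
  rewrite sipC sip_null0 ?oppr0 //; [exact: smooth_L2|exact: L2_cst|exact: aeW].
by apply: is_wdiv_unique (P0); apply: getPex; eexists; exact: P0.
Qed.

Lemma wcurl_null F : mL2 F -> null Omega F -> null Omega (wcurl Omega F).
Proof.
move=> F2 F0; have P0 : is_wcurl Omega F (fun=> 0).
  split=> [|Phi tPhi]; first by apply/L2v_mL2; case: (mL2_subspace 1 3).
  have Ps : smoothv Phi by move=> i; exact: test_smooth.
  rewrite mipC mip_null0 //; last exact: curl_L2.
  rewrite mipC mip_null0 //; [exact: smoothv_L2|by case: (mL2_subspace 1 3)|exact: aeW].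
by apply: is_wcurl_unique (P0); apply: getPex; eexists; exact: P0.
Qed.

Lemma H0curl_Hcurl F : H0curl Omega F -> Hcurl F.
Proof. by case. Qed.

Lemma H0div_Hdiv F : H0div Omega F -> Hdiv F.
Proof. by case. Qed.

(** The trace condition involves the representative chosen by [wcurl], so
    closure under sums already requires uniqueness of the weak curl. *)
Lemma H0curl_subspace : subspace (H0curl Omega).
Proof.
split.
  have F0 : L2v Omega (0 : vfield R) by apply/L2v_mL2; case: (mL2_subspace 1 3).
  have P0 : is_wcurl Omega (0 : vfield R) 0.
    by split=> // Phi tPhi; apply: eq_Rintegral => x _; rewrite !mul0mx.
  split => //; first by exists 0.
  move=> Phi Ps.
  have w0 : null Omega (wcurl Omega (0 : vfield R)).
    by apply: wcurl_null; [exact/L2v_mL2|exact: aeW].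
  rewrite mipC mip_null0 //; last by apply: wcurl_L2; split=> //; exists 0.
    rewrite mipC mip_null0 ?subr0 //; [exact: curl_L2|exact/L2v_mL2|exact: aeW].
  exact: smoothv_L2.
move=> a F F' HF HF'; have [F2 _ FP] := HF; have [F2' _ FP'] := HF'.
move/L2v_mL2 in F2; move/L2v_mL2 in F2'.
have [hF hF'] := (H0curl_Hcurl HF, H0curl_Hcurl HF').
have lP := is_wcurlDl a hF hF'.
have L2l : mL2 (a *: F + F') by case: (mL2_subspace 1 3) => _; exact.
have hl : Hcurl (a *: F + F') by split; [exact/L2v_mL2|eexists; exact: lP].
split; [exact/L2v_mL2|by case: hl|move=> Phi Ps].
have [P2 C2] := (smoothv_L2 Ps, curl_L2 Ps).
have [W2 W2'] := (wcurl_L2 hF, wcurl_L2 hF').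
have l2 : mL2 (a *: wcurl Omega F + wcurl Omega F').
  by case: (mL2_subspace 1 3) => _; exact.
rewrite (mip_ael (wcurl_L2 hl) l2 P2 (wcurlDl a hF hF')).
rewrite !mipDl //; have := (FP _ Ps, FP' _ Ps) => -[/eqP + /eqP].
by rewrite !subr_eq0 => /eqP-> /eqP->; rewrite subrr.
Qed.

Lemma H0div_subspace : subspace (H0div Omega).
Proof.
split.
  have F0 : L2v Omega (0 : vfield R) by apply/L2v_mL2; case: (mL2_subspace 1 3).
  have P0 : is_wdiv Omega (0 : vfield R) (fun=> 0).
    split=> [|phi tphi]; first exact: L2_cst.
    rewrite sipC sip_null0 // ?oppr0; [|exact/smooth_L2/test_smooth|exact: L2_cst|exact: aeW].
    rewrite mipC mip_null0 //; [exact/grad_L2/test_smooth|exact/L2v_mL2|exact: aeW].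
  split => //; first by exists (fun=> 0).
  move=> phi ps.
  have w0 : null Omega (wdiv Omega (0 : vfield R)).
    by apply: wdiv_null; [exact/L2v_mL2|exact: aeW].
  rewrite sipC sip_null0 //; [|exact: smooth_L2|by apply: wdiv_L2; split=> //; eexists; exact: P0].
  rewrite mipC mip_null0 ?addr0 //; [exact: grad_L2|exact/L2v_mL2|exact: aeW].
move=> a F F' HF HF'; have [F2 _ FP] := HF; have [F2' _ FP'] := HF'.
move/L2v_mL2 in F2; move/L2v_mL2 in F2'.
have [hF hF'] := (H0div_Hdiv HF, H0div_Hdiv HF').
have lP := is_wdivDl a hF hF'.
have L2l : mL2 (a *: F + F') by case: (mL2_subspace 1 3) => _; exact.
have hl : Hdiv (a *: F + F') by split; [exact/L2v_mL2|eexists; exact: lP].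
split; [exact/L2v_mL2|by case: hl|move=> phi ps].
have [p2 g2] := (smooth_L2 ps, grad_L2 ps).
have [W2 W2'] := (wdiv_L2 hF, wdiv_L2 hF').
rewrite (sip_ael (wdiv_L2 hl) (L2Dl oOmega a W2 W2') p2 (wdivDl a hF hF')).
rewrite mipDl // (sipDl a W2 W2' p2).
have := (FP _ ps, FP' _ ps) => -[/eqP + /eqP].
rewrite !addr_eq0 => /eqP-> /eqP->; ring.
Qed.

End MatrixFields.

(** * Piecewise polynomial spaces are finite dimensional *)

Section LocalSpaces.
Variable R : realType.

Definition spanned (E : lmodType R) (P : set E) := exists (I : finType) (s : I -> E),
  forall p, P p -> exists c : I -> R, p = \sum_i c i *: s i.

Definition monomial (i j l : nat) : sfield R := fun x => x.1.1 ^+ i * x.1.2 ^+ j * x.2 ^+ l.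

Lemma fct_sumE (T : Type) (V : nmodType) (I : Type) (r : seq I) (f : I -> T -> V) x :
  (\sum_(i <- r) f i) x = \sum_(i <- r) f i x.
Proof. by elim: r => [|i r IHr]; rewrite ?big_nil // !big_cons -IHr. Qed.

Lemma poly_fun_spanned k : @spanned (pt R -> R^o) (poly_fun k).
Proof.
exists ('I_k.+1 * 'I_k.+1 * 'I_k.+1)%type, 
  (fun i : 'I_k.+1 * 'I_k.+1 * 'I_k.+1 => monomial i.1.1 i.1.2 i.2).
move=> p [c pE].
exists (fun i : 'I_k.+1 * 'I_k.+1 * 'I_k.+1 => if (i.1.1 + i.1.2 + i.2 <= k)%N then c i.1.1 i.1.2 i.2 else 0).
apply/funext => x; rewrite pE fct_sumE.
rewrite pair_bigA /= pair_big_dep /= [RHS](bigID (fun i : 'I_k.+1 * 'I_k.+1 * 'I_k.+1 => (i.1.1 + i.1.2 + i.2 <= k)%N)) /=.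
rewrite [X in _ = _ + X]big1 ?addr0 => [|i /negPf ik]; last by rewrite ik scale0r.
apply: eq_bigr => i ->; rewrite -!mulrA.
by rewrite -[RHS]/(c i.1.1 i.1.2 i.2 * (_ * _ * _)) -!mulrA.
Qed.

Lemma poly_fun_subspace k : @subspace R (pt R -> R^o) (poly_fun k).
Proof.
split.
  exists (fun _ _ _ => 0) => x; apply/esym; rewrite big1 // => i _; rewrite big1 // => j _.
  by rewrite big1 // => l _; rewrite !mul0r.
move=> a u v [c uE] [d vE]; exists (fun i j l => a * c i j l + d i j l) => x.
transitivity (a * u x + v x) => //; rewrite uE vE.
rewrite mulr_sumr -big_split; apply: eq_bigr => i _ /=.
rewrite mulr_sumr -big_split; apply: eq_bigr => j _ /=.
rewrite mulr_sumr -big_split; apply: eq_bigr => l _ /=.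
ring.
Qed.

Lemma poly_fun_continuous k (f : sfield R) : poly_fun k f -> continuous f.
Proof.
move=> [c fE].
have -> : f = fun x => \sum_(i < k.+1) \sum_(j < k.+1) \sum_(l < k.+1 | (i + j + l <= k)%N)
    c i j l * x.1.1 ^+ i * x.1.2 ^+ j * x.2 ^+ l by apply/funext.
have vc j : continuous (fun x : pt R => vec x 0 j) := @vec_continuous R j.
have mulc (g h : sfield R) : continuous g -> continuous h -> continuous (fun x => g x * h x).
  by move=> gc hc x; exact: (cvgM (gc x) (hc x)).
have expc (g : sfield R) m : continuous g -> continuous (fun x => g x ^+ m).
  move=> gc; elim: m => [|m IHm].
    by under eq_fun do rewrite expr0; exact: cst_continuous.
  by under eq_fun do rewrite exprS; exact: mulc.
have c0 : continuous (fun x : pt R => x.1.1) by have := vc 0; under eq_fun do rewrite vecE.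
have c1 : continuous (fun x : pt R => x.1.2) by have := vc 1; under eq_fun do rewrite vecE.
have c2 : continuous (fun x : pt R => x.2) by have := vc 2%:R; under eq_fun do rewrite vecE.
do 3!(apply: continuous_big; [exact: add_continuous|move=> ? _]).
apply: (mulc); last exact: expc.
apply: (mulc); last exact: expc.
by apply: (mulc); [exact: cst_continuous|exact: expc].
Qed.

Lemma poly_field_spanned k : spanned (@poly_field R k).
Proof.
have [I [s sP]] := poly_fun_spanned k.
exists (I * 'I_3)%type, (fun (i : I * 'I_3) x => s i.1 x *: delta_mx 0 i.2) => p pk.
have /fin_all_exists[c cP] : forall j, exists c : I -> R,
    (fun x => p x 0 j) = \sum_i c i *: s i by move=> j; exact: sP.
exists (fun i => c i.2 i.1); apply/funext => x; apply/rowP => j.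
rewrite fct_sumE summxE.
rewrite -(pair_bigA _ (fun i m => (c m i *: (fun x => s i x *: delta_mx 0 m)) x 0 j)) /=.
rewrite [LHS](congr1 (fun f => f x) (cP j)) fct_sumE.
apply: eq_bigr => i _; rewrite (bigD1 j) //= big1 => [|l lj].
  by rewrite addr0 !mxE !eqxx mulr1.
by rewrite !mxE eq_sym (negPf lj) andbF !mulr0.
Qed.

Lemma poly_field_subspace k : subspace (@poly_field R k).
Proof.
have [p0 pl] := poly_fun_subspace k; split=> [i|a u v uk vk i].
  by under eq_fun do rewrite mxE; exact: p0.
by under eq_fun do rewrite !mxE; apply: pl; [exact: uk|exact: vk].
Qed.

Lemma spanned_image (E E' : lmodType R) (P : set E) (f : {linear E -> E'}) :
  spanned P -> spanned [set f p | p in P].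
Proof.
move=> [I [s sP]]; exists I, (fun i => f (s i)) => _ [p /sP[c ->] <-].
by exists c; rewrite linear_sum; apply: eq_bigr => i _; rewrite linearZ.
Qed.

Lemma spanned_add (E : lmodType R) (P Q S : set E) : spanned P -> spanned Q ->
  (forall p, S p -> exists q r, [/\ P q, Q r & p = q + r]) -> spanned S.
Proof.
move=> [I [s sP]] [J [t tP]] SPQ; exists (I + J)%type.
exists (fun i => match i with inl i => s i | inr j => t j end) => p /SPQ[q [r [/sP[c ->] /tP[d ->] ->]]].
exists (fun i => match i with inl i => c i | inr j => d j end).
by rewrite big_sumType.
Qed.

Definition cross_pos (q : vfield R) : vfield R := fun x => cross (vec x) (q x).
Definition scale_pos (q : pt R -> R^o) : vfield R := fun x => (q x : R) *: vec x.

Lemma cross_pos_linear : linear cross_pos.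
Proof.
move=> a p q; apply/funext => x; apply/rowP => k; rewrite !mxE; ring.
Qed.

Lemma scale_pos_linear : linear scale_pos.
Proof.
move=> a p q; apply/funext => x; apply/rowP => k.
by rewrite /scale_pos !mxE /=; rewrite mulrDl -mulrA.
Qed.

HB.instance Definition _ := GRing.isLinear.Build R _ _ _ cross_pos cross_pos_linear.
HB.instance Definition _ := GRing.isLinear.Build R _ _ _ scale_pos scale_pos_linear.

Lemma edge_local_spanned e k : spanned (@edge_local R e k).
Proof.
case: e => /=; last exact: poly_field_spanned.
apply: (spanned_add (poly_field_spanned k.-1) (spanned_image cross_pos (poly_field_spanned k.-1))).
move=> F [p [q [pk qk FE]]]; exists p, (cross_pos q); split=> //; first by exists q.
by apply/funext.
Qed.

Lemma face_local_spanned d k : spanned (@face_local R d k).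
Proof.
case: d => /=; last exact: poly_field_spanned.
apply: (spanned_add (poly_field_spanned k.-1) (spanned_image scale_pos (poly_fun_spanned k.-1))).
move=> F [p [q [pk qk FE]]]; exists p, (scale_pos q); split=> //; first by exists q.
by apply/funext.
Qed.

Lemma edge_local_subspace e k : subspace (@edge_local R e k).
Proof.
case: e => /=; last exact: poly_field_subspace.
have [p0 pl] := poly_field_subspace k.-1; split=> [|a u v [p [q [pk qk uE]]] [p' [q' [pk' qk' vE]]]].
  exists 0, 0; split=> // x; rewrite -[cross _ _]/(cross_pos 0 x) linear0.
  by rewrite addr0.
exists (a *: p + p'), (a *: q + q'); split; [exact: pl|exact: pl|move=> x].
rewrite -[cross _ _]/(cross_pos (a *: q + q') x) linearP.
transitivity (a *: u x + v x) => //; rewrite uE vE scalerDr addrACA.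
by [].
Qed.

Lemma face_local_subspace d k : subspace (@face_local R d k).
Proof.
case: d => /=; last exact: poly_field_subspace.
have [p0 pl] := poly_field_subspace k.-1; have [q0 ql] := poly_fun_subspace k.-1.
split=> [|a u v [p [q [pk qk uE]]] [p' [q' [pk' qk' vE]]]].
  exists 0, (fun=> 0); split=> // x; rewrite scale0r addr0.
  by [].
exists (a *: p + p'), (a *: (q : pt R -> R^o) + q'); split; [exact: pl|exact: ql|move=> x].
rewrite -[_ *: vec x]/(scale_pos (a *: (q : pt R -> R^o) + q') x) linearP.
transitivity (a *: u x + v x) => //; rewrite uE vE scalerDr addrACA.
by [].
Qed.

End LocalSpaces.

Section Piecewise.
Variables (R : realType) (Omega : set (pt R)) (Th : mesh R).
Hypotheses (oOmega : open Omega) (bOmega : bounded_set Omega).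
Hypothesis Th_cover : Omega `<=` mesh_cover Th.
Local Notation mu := (leb3 R).

Lemma null_subspace (V : lmodType R) : subspace (@null R Omega V : set (pt R -> V)).
Proof.
split=> [|a u v]; first exact: aeW.
by apply: ae_imply2 => x u0 v0 Ox; rewrite -[LHS]/(a *: u x + v x) u0 // v0 // scaler0 addr0.
Qed.

Lemma piecewise_subspace (V : lmodType R) (P : set (pt R -> V)) :
  subspace P -> subspace (piecewise Th P).
Proof.
move=> [P0 Pl]; split=> [K _|a u v uP vP K KTh]; first by exists 0 => //; exact: aeW.
have [[p Pp up] [q Pq vq]] := (uP K KTh, vP K KTh).
exists (a *: p + q); first exact: Pl.
by move: up vq; apply: ae_imply2 => x ux vx Kx; rewrite -[LHS]/(a *: u x + v x) ux // vx.
Qed.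

(** Each point is attributed to the first cell that contains it, so that
    overlaps of cells need not be examined. *)
Lemma piecewise_finite_mod (V : lmodType R) (P : set (pt R -> V)) :
  spanned P -> finite_mod (@null R Omega V) (piecewise Th P).
Proof.
move=> [I [s sP]].
(* Outside the mesh the value is size Th, the index of no cell. *)
pose cell (x : pt R) := find (fun K => `[< tetra K x >]) Th.
pose J := ('I_(size Th) * I)%type.
pose t (j : J) : pt R -> V := fun x => if cell x == j.1 :> nat then s j.2 x else 0.
apply: (@finite_mod_finType _ _ _ _ J t) => F FP.
have /fin_all_exists[c cP] : forall k : 'I_(size Th), exists c : I -> R,
    ae_eq mu (tetra (tnth (in_tuple Th) k)) F (\sum_i c i *: s i).
  move=> k; have [p /sP[c ->] Fp] := FP _ (mem_tnth k (in_tuple Th)).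
  by exists c.
exists (fun j => c j.1 j.2); apply: ae_imply (ae_forall cP) => x Fx Ox.
have [K KTh Kx] := Th_cover Ox.
have cell_lt : (cell x < size Th)%N.
  by rewrite -has_find; apply/hasP; exists K => //; apply/asboolP.
pose k := Ordinal cell_lt.
have kx : tetra (tnth (in_tuple Th) k) x.
  by apply/asboolP; rewrite (tnth_nth K) /=; apply: (nth_find K (a := fun K => `[< tetra K x >])); rewrite has_find.
rewrite -[LHS]/(F x - (\sum_j c j.1 j.2 *: t j) x) (Fx k kx) !fct_sumE.
rewrite -(pair_bigA _ (fun k i => (c k i *: t (k, i)) x)) /= (bigD1 k) //=.
rewrite [X in _ - (_ + X)]big1 ?addr0 => [|l lk]; last first.
  rewrite big1 // => i _; rewrite -[LHS]/(c l i *: t (l, i) x) /t /=.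
  case: eqP => [kl|_]; last by rewrite scaler0.
  by case/eqP: lk; apply/val_inj.
apply/eqP; rewrite subr_eq0; apply/eqP; apply: eq_bigr => i _.
by rewrite -[RHS]/(c k i *: t (k, i) x) /t /= eqxx.
Qed.

Lemma piecewise_bounded (f : sfield R) :
  (forall K, K \in Th -> exists2 p, continuous p & ae_eq mu (tetra K) f p) ->
  exists M : R, {ae mu, forall x, Omega x -> `|f x| <= M}.
Proof.
move=> fP.
have /fin_all_exists[M MP] : forall k : 'I_(size Th), exists M : R,
    {ae mu, forall x, tetra (tnth (in_tuple Th) k) x -> Omega x -> `|f x| <= M}.
  move=> k; have [p pc fp] := fP _ (mem_tnth k (in_tuple Th)).
  have [M MP] := continuous_bounded bOmega pc; exists M.
  by apply: ae_imply fp => x fp Kx Ox; rewrite fp //; exact: MP.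
exists (\sum_k `|M k|); apply: ae_imply (ae_forall MP) => x Mx Ox.
have [K KTh Kx] := Th_cover Ox.
have /tnthP[k kE] : K \in in_tuple Th by [].
have := Mx k; rewrite -kE => /(_ Kx Ox) /le_trans; apply.
apply: le_trans (ler_norm _) _; rewrite (bigD1 k) //= lerDl.
by rewrite sumr_ge0.
Qed.

End Piecewise.

(** * Functions of H^1_0 with a vanishing derivative *)

Section Poincare.
Variables (R : realType) (Omega : set (pt R)).
Hypotheses (oOmega : open Omega) (bOmega : bounded_set Omega).
Local Notation mu := (leb3 R).

Lemma test_fun_vecM (j : 'I_3) (phi : sfield R) :
  test_fun Omega phi -> test_fun Omega (fun x => vec x 0 j * phi x).
Proof.
move=> [ps pc pO].
have sub : closure [set x | vec x 0 j * phi x != 0] `<=` closure [set x | phi x != 0].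
  by apply: closureS => x /=; apply: contra => /eqP->; rewrite mulr0.
split; first exact: smooth_vecM.
  by apply: subclosed_compact sub => //; exact: closed_closure.
exact: subset_trans pO.
Qed.

(** A qualitative Poincare inequality.  Testing the weak derivative with the
    product of the first coordinate x_0 and a test function phi close to u
    gives int u phi = - int x_0 u d_0 phi; the left side tends to int u^2, and
    the right side to 0 since d_0 phi approaches d_0 u = 0. *)
Theorem H10_null (u : sfield R) : H10 Omega u ->
  null Omega (wpd Omega 0 u) -> null Omega u.
Proof.
move=> [u1 uP] du0; have [u2 _] := u1.
have xb : Linf Omega (fun x : pt R => vec x 0 0).
  by apply: continuous_Linf => //; exact: vec_continuous.
have xu2 : L2 Omega (fun x => vec x 0 0 * u x) by exact: L2_Linf.
have sL2 := L2_subspace oOmega bOmega; have sI := sip_semi_inner oOmega.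
set U := sip Omega u u; set K := sip Omega (fun x => vec x 0 0 * u x) (fun x => vec x 0 0 * u x).
have [_ _ s0] := sI.
have U0 : 0 <= U by exact: s0.
have K0 : 0 <= K by exact: s0.
have key e : 0 < e -> U ^+ 2 <= 2 * (U + K) * e.
  move=> e_gt0; have [phi tphi] := uP e e_gt0.
  set d := (fun x => u x - phi x : R) => /=.
  set D := (fun x => wgrad Omega u x - grad phi x) => dD.
  have ps := test_smooth tphi.
  have p2 := smooth_L2 oOmega bOmega ps; have dp2 := pd_L2 oOmega bOmega 0 ps.
  have wu2 := wpd_L2 0 u1.
  have d2 : L2 Omega d by exact: L2B.
  have D2 : mL2 Omega D.
    apply/L2v_mL2 => i; rewrite /D; under eq_fun do rewrite !mxE.
    exact: (L2B oOmega bOmega (wpd_L2 i u1) (pd_L2 oOmega bOmega i ps)).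
  have D02 : L2 Omega (fun x => D x 0 0) := D2 0 0.
  have D0_le : sip Omega (fun x => D x 0 0) (fun x => D x 0 0) <= mip Omega D D.
    rewrite mipE // big_ord1 (bigD1 0) //= lerDl sumr_ge0 // => i _; exact: s0.
  have dd0 := s0 _ d2; have DD0 := s0 _ D02.
  (* By the Leibniz rule this is the derivative of the test function x_0 phi. *)
  have test0 : sip Omega u (fun x => vec x 0 0 * pd 0 phi x + phi x) = 0.
    have -> : (fun x => vec x 0 0 * pd 0 phi x + phi x) = pd 0 (fun x => vec x 0 0 * phi x).
      rewrite pdM; [|by move=> x; exact: derivable_vec|by move=> x; exact: smooth_derivable].
      by apply/funext => x; rewrite pd_vec eqxx mulr1.
    have [_ wP] := wpdP (u1.2 0).
    have tx := test_fun_vecM 0 tphi; have x2 := smooth_L2 oOmega bOmega (test_smooth tx).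
    by rewrite (wP _ tx) sipC (sip_null0 oOmega bOmega x2 wu2 du0) oppr0.
  have UE : U = sip Omega u d + sip Omega (fun x => vec x 0 0 * u x) (fun x => D x 0 0).
    have x2 : L2 Omega (fun x => vec x 0 0 * pd 0 phi x) by exact: L2_Linf.
    have -> : sip Omega (fun x => vec x 0 0 * u x) (fun x => D x 0 0) =
        sip Omega u (fun x => vec x 0 0 * D x 0 0).
      by apply: eq_Rintegral => x _; rewrite [RHS]mulrCA mulrA.
    have -> : sip Omega u (fun x => vec x 0 0 * D x 0 0) =
        - sip Omega u (fun x => vec x 0 0 * pd 0 phi x).
      rewrite ![sip Omega u _]sipC -[RHS]addr0 -[X in _ + X](sip_null0 oOmega bOmega u2 (L2_cst oOmega bOmega 0)) ?[sip Omega u _]sipC; last exact: aeW.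
      rewrite -mulN1r -(sipDl oOmega _ x2 (L2_cst oOmega bOmega 0) u2).
      apply: sip_ael => //; [exact: L2_Linf|exact: L2Dl (L2_cst oOmega bOmega 0)|].
      apply: ae_imply du0 => x du0 Ox; rewrite /D !mxE du0 //; ring.
    rewrite [sip Omega u d](linear_onB sL2 (semi_inner_linr sL2 sI u2)) //.
    have : sip Omega (fun x => 1 * (vec x 0 0 * pd 0 phi x) + phi x) u = 0.
      by rewrite sipC -[RHS]test0; apply: eq_Rintegral => x _; rewrite mul1r.
    rewrite (sipDl oOmega 1 x2 p2 u2) mul1r ![sip Omega _ u]sipC -/U => /eqP.
    by rewrite addr_eq0 => /eqP ->; rewrite opprK subrK.
  have CS1 := cauchy_schwarz sL2 sI u2 d2.
  have CS2 := cauchy_schwarz sL2 sI xu2 D02.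
  rewrite -/U -/K in CS1 CS2.
  set s1 := sip Omega u d in UE CS1; set s2 := sip Omega _ (fun x => D x 0 0) in UE CS2.
  have : s1 ^+ 2 <= U * e by apply: le_trans CS1 _; rewrite ler_wpM2l //; move: dD dd0 DD0 D0_le; rewrite -/d; lra.
  have : s2 ^+ 2 <= K * e by apply: le_trans CS2 _; rewrite ler_wpM2l //; move: dD dd0 DD0 D0_le; rewrite -/d; lra.
  have := sqr_ge0 (s1 - s2); rewrite UE; nra.
apply/(sip_null oOmega) => //; apply/eqP; rewrite -/U.
apply: contraT => U_neq0; have U_gt0 : 0 < U by rewrite lt_def U_neq0.
have C_gt0 : 0 < 4 * (U + K) by rewrite mulr_gt0 // ltr_pwDl.
have := key (U ^+ 2 / (4 * (U + K))).
rewrite divr_gt0 ?exprn_gt0 // => /(_ isT).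
have -> : 2 * (U + K) * (U ^+ 2 / (4 * (U + K))) = U ^+ 2 / 2 by field; rewrite gt_eqF // ltr_pwDl.
have : 0 < U ^+ 2 by rewrite exprn_gt0.
lra.
Qed.
End Poincare.

(** * The discrete magnetohydrodynamic system *)

Section LinearOn.
Variables (R : realType) (E E' : lmodType R).
Implicit Types (A : set E) (g h : E -> R).

Lemma linear_on_sub A A' g : A' `<=` A -> linear_on A g -> linear_on A' g.
Proof. by move=> AA gl a u v /AA Au /AA Av; exact: gl. Qed.

Lemma linear_on_add A g h : linear_on A g -> linear_on A h -> linear_on A (fun x => g x + h x).
Proof. by move=> gl hl a u v Au Av; rewrite gl // hl // mulrDr addrACA. Qed.

Lemma linear_on_scale A (c : R) g : linear_on A g -> linear_on A (fun x => c * g x).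
Proof. by move=> gl a u v Au Av; rewrite gl // mulrDr mulrCA. Qed.

Lemma linear_on_opp A g : linear_on A g -> linear_on A (fun x => - g x).
Proof. by move=> gl a u v Au Av; rewrite gl // mulrN -opprD. Qed.

Lemma linear_on_minus A g h : linear_on A g -> linear_on A h -> linear_on A (fun x => g x - h x).
Proof. by move=> gl hl; apply: linear_on_add => //; exact: linear_on_opp. Qed.

Lemma linear_on_fst A (A' : set E') g : linear_on A g ->
  @linear_on R (E * E')%type (A `*` A') (fun x => g x.1).
Proof. by move=> gl a u v [Au _] [Av _]; exact: gl. Qed.

Lemma linear_on_snd (A' : set E') A g : linear_on A g ->
  @linear_on R (E' * E)%type (A' `*` A) (fun x => g x.2).
Proof. by move=> gl a u v [_ Au] [_ Av]; exact: gl. Qed.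

Lemma subspace_prod A (A' : set E') : subspace A -> subspace A' ->
  @subspace R (E * E')%type (A `*` A').
Proof.
move=> [A0 Al] [A0' Al']; split=> [|a u v [? ?] [? ?]]; first by split.
by split; [exact: Al|exact: Al'].
Qed.

Lemma finite_mod_prod N A (N' A' : set E') : finite_mod N A -> finite_mod N' A' ->
  @finite_mod R (E * E')%type (N `*` N') (A `*` A').
Proof.
move=> [m [s sP]] [m' [s' sP']].
pose t (k : 'I_m + 'I_m') : E * E' := match k with inl i => (s i, 0) | inr j => (0, s' j) end.
apply: (@finite_mod_finType _ _ _ _ _ t) => -[x x'] [/sP[c cP] /sP'[c' cP']].
exists (fun k => match k with inl i => c i | inr j => c' j end).
rewrite big_sumType /=; split => /=.
  rewrite !(big_morph fst (id1 := 0) (op1 := +%R)) //=.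
  rewrite [X in _ - (_ + X)]big1 ?addr0 // => i _; exact: scaler0.
rewrite !(big_morph snd (id1 := 0) (op1 := +%R)) //=.
rewrite [X in _ - (X + _)]big1 ?add0r // => i _; exact: scaler0.
Qed.

Lemma finite_mod_subset N A A' : A' `<=` A -> finite_mod N A -> finite_mod N A'.
Proof. by move=> AA [m [s sP]]; exists m, s => x /AA /sP. Qed.

Lemma semi_inner_sub A A' ip : A' `<=` A -> semi_inner A ip -> semi_inner A' ip.
Proof.
move=> AA [l c p]; split=> [w /AA Aw|u v /AA Au /AA Av|u /AA Au].
- exact: linear_on_sub (l _ Aw).
- exact: c.
- exact: p.
Qed.

End LinearOn.

Section AeLinear.
Variables (R : realType) (Omega : set (pt R)).
Hypotheses (oOmega : open Omega) (bOmega : bounded_set Omega).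
Local Notation mu := (leb3 R).

(** The weak operators choose representatives, so they are linear only up to
    null sets. *)
Definition ae_lin (E : lmodType R) (A : set E) m n (T : E -> pt R -> 'M[R]_(m, n)) :=
  (forall u, A u -> mL2 Omega (T u)) /\
  forall a u v, A u -> A v -> ae_eq mu Omega (T (a *: u + v)) (a *: T u + T v).

Lemma ae_lin_mipl (E : lmodType R) (A : set E) m n (T : E -> pt R -> 'M[R]_(m, n)) W :
  subspace A -> ae_lin A T -> mL2 Omega W -> linear_on A (fun u => mip Omega (T u) W).
Proof.
move=> [_ Al] [T2 Tl] W2 a u v Au Av; have [Tu2 Tv2] := (T2 _ Au, T2 _ Av).
have l2 : mL2 Omega (a *: T u + T v).
  by case: (mL2_subspace oOmega bOmega m n) => _; exact.
have t2 : mL2 Omega (T (a *: u + v)) by apply: T2; exact: Al.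
by rewrite (mip_ael oOmega bOmega t2 l2 W2 (Tl a u v Au Av)) mipDl.
Qed.

Lemma ae_lin_mipr (E : lmodType R) (A : set E) m n (T : E -> pt R -> 'M[R]_(m, n)) W :
  subspace A -> ae_lin A T -> mL2 Omega W -> linear_on A (fun u => mip Omega W (T u)).
Proof.
move=> As Tl W2 a u v Au Av; rewrite ![mip Omega W _]mipC.
exact: (ae_lin_mipl As Tl W2).
Qed.

Definition Linfv (u : vfield R) := forall i, Linf Omega (fun x => u x 0 i).

Lemma convect_L2 w u : Linfv w -> H1v Omega u -> mL2 Omega (convect Omega w u).
Proof.
move=> wb u1; apply/L2v_mL2 => j; have g2 := wgradv_L2 u1.
have -> : (fun x => convect Omega w u x 0 j) =
    fun x => w x 0 0 * wgradv Omega u x 0 j +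
      (w x 0 1 * wgradv Omega u x 1 j + w x 0 2%:R * wgradv Omega u x 2%:R j).
  apply/funext => x; rewrite mxE !big_ord_recl big_ord0 addr0.
  by congr (_ * _ + (_ * _ + _ * _)); congr (fun_of_matrix _ _ _); apply/val_inj.
have p2 i := L2_Linf oOmega (wb i) (g2 i j).
exact: (L2D oOmega (p2 0) (L2D oOmega (p2 1) (p2 2%:R))).
Qed.

Lemma crossf_L2 u G : Linfv u -> mL2 Omega G -> mL2 Omega (crossf u G).
Proof.
move=> ub G2; apply/L2v_mL2 => k; under eq_fun do rewrite mxE.
have p2 i j := L2_Linf oOmega (ub i) (G2 0 j).
exact: (L2B oOmega bOmega (p2 _ _) (p2 _ _)).
Qed.

Lemma crossf_null u G : Linfv u -> mL2 Omega G ->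
  null Omega u \/ null Omega G -> null Omega (crossf u G).
Proof.
move=> ub G2; case; apply: ae_imply => x h Ox; apply/rowP => k.
  by rewrite !mxE h // !mxE !mul0r subrr.
by rewrite !mxE h // !mxE !mulr0 subrr.
Qed.

Lemma H1v_Hdiv (u : vfield R) : H1v Omega u -> Hdiv Omega u.
Proof.
move=> u1; have u2 := H1v_L2 u1; split; first exact/L2v_mL2.
have d2 i := wpd_L2 i (u1 i).
exists (fun x => wpd Omega 0 (fun y => u y 0 0) x +
  (wpd Omega 1 (fun y => u y 0 1) x + wpd Omega 2%:R (fun y => u y 0 2%:R) x)).
have d12 := L2D oOmega (d2 1) (d2 2%:R).
split=> [|phi tphi]; first exact: (L2D oOmega (d2 0) d12).
have ps := test_smooth tphi; have p2 := smooth_L2 oOmega bOmega ps.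
rewrite (sipD oOmega (d2 0) d12 p2) (sipD oOmega (d2 1) (d2 2%:R) p2).
rewrite mipE //; last exact: grad_L2.
rewrite big_ord1 !big_ord_recl big_ord0 addr0 !opprD.
have E i : sip Omega (fun x => u x 0 i) (fun x => grad phi x 0 i) =
    - sip Omega (wpd Omega i (fun y => u y 0 i)) phi.
  have [_ <- //] := wpdP ((u1 i).2 i).
  by apply: eq_Rintegral => x _; rewrite mxE.
congr (_ + (_ + _)); rewrite -E.
- by congr (sip Omega _ _); apply/funext => x; congr (_ _ _ _); apply/val_inj.
- by congr (sip Omega _ _); apply/funext => x; congr (_ _ _ _); apply/val_inj.
- by congr (sip Omega _ _); apply/funext => x; congr (_ _ _ _); apply/val_inj.
Qed.

Lemma wdiv_linear_on (A : set (vfield R)) q : A `<=` Hdiv Omega -> subspace A ->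
  L2 Omega q -> linear_on A (fun v => sip Omega (wdiv Omega v) q).
Proof.
move=> AH [_ Al] q2 a u v Au Av; have [Hu Hv] := (AH _ Au, AH _ Av).
have [du dv] := (wdiv_L2 Hu, wdiv_L2 Hv).
have t2 := wdiv_L2 (AH _ (Al a u v Au Av)); have l2 := L2Dl oOmega a du dv.
rewrite -(sipDl oOmega a du dv q2).
exact: (sip_ael oOmega bOmega t2 l2 q2 (wdivDl oOmega bOmega a Hu Hv)).
Qed.

End AeLinear.

Section DiscreteProblem.
Variables (R : realType) (Omega : set (pt R)).
Hypotheses (oOmega : open Omega) (bOmega : bounded_set Omega).
Variables (Re Rm S : R).
Hypotheses (Re_gt0 : 0 < Re) (Rm_gt0 : 0 < Rm) (S_gt0 : 0 < S).
Variables (Vh Vc Vd : set (vfield R)) (Qh Vl : set (sfield R)) (f : vfield R -> R).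
Local Notation mu := (leb3 R).
Local Notation nullv := (@null R Omega 'rV[R]_3).
Local Notation nulls := (@null R Omega R : set (pt R -> R^o)).
Hypotheses (Vh_sub : subspace Vh) (Vc_sub : subspace Vc) (Vd_sub : subspace Vd).
Hypotheses (Qh_sub : @subspace R (pt R -> R^o) Qh) (Vl_sub : @subspace R (pt R -> R^o) Vl).
Hypotheses (Vh_fin : finite_mod nullv Vh) (Vc_fin : finite_mod nullv Vc)
  (Vd_fin : finite_mod nullv Vd).
Hypotheses (Qh_fin : @finite_mod R (pt R -> R^o) nulls Qh)
  (Vl_fin : @finite_mod R (pt R -> R^o) nulls Vl).
Hypotheses (Vh_H10 : Vh `<=` H10v Omega) (Vh_Linf : forall v, Vh v -> Linfv Omega v).
Hypotheses (Vc_Hcurl : Vc `<=` Hcurl Omega) (Vd_Hdiv : Vd `<=` Hdiv Omega).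
Hypotheses (Qh_L2 : Qh `<=` L2 Omega) (Vl_L2 : Vl `<=` L2 Omega).
Hypothesis div_Vd : forall B, Vd B -> Vl (wdiv Omega B).
Hypothesis potential : forall B, Vd B -> null Omega (wdiv Omega B) ->
  exists2 F, Vc F & ae_eq mu Omega B (wcurl Omega F).
Hypotheses (f_lin : linear_on Vh f) (f_null : forall v, Vh v -> null Omega v -> f v = 0).

Lemma Vh_H1 : Vh `<=` H1v Omega.
Proof. by move=> v /Vh_H10 vh j; case: (vh j). Qed.

Lemma Vh_L2 : Vh `<=` mL2 Omega (n:=3).
Proof. by move=> v /Vh_H1/H1v_L2. Qed.

Lemma Vc_L2 : Vc `<=` mL2 Omega (n:=3).
Proof. by move=> F /Vc_Hcurl[/L2v_mL2]. Qed.

Lemma Vd_L2 : Vd `<=` mL2 Omega (n:=3).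
Proof. by move=> B /Vd_Hdiv[/L2v_mL2]. Qed.

Let mipS m n := mip_semi_inner oOmega bOmega m n.

(** The edge space has finite dimension, so functionals on it are represented
    by the L^2 product; this yields the discrete curl and the projection of
    u x B. *)
Lemma Vc_riesz (g : vfield R -> R) : linear_on Vc g ->
  (forall F, Vc F -> null Omega F -> g F = 0) ->
  exists2 G, Vc G & forall F, Vc F -> mip Omega G F = g F.
Proof.
move=> gl g0; have ipP := semi_inner_sub Vc_L2 (mipS 1 3).
have [|n [e [eo efull]]] := orthonormal_basis Vc_sub ipP (null_subspace _ _) _ Vc_fin.
  by move=> F VF F0; apply/mip_null => //; exact: Vc_L2.
apply: (riesz Vc_sub ipP eo efull gl) => F VF F0; apply: g0 => //.
by apply/(mip_null oOmega) => //; exact: Vc_L2.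
Qed.

Local Notation rot := (dcurl Omega Vc).

Lemma rotP C : Vd C -> Vc (rot C) /\
  forall F, Vc F -> mip Omega (rot C) F = mip Omega C (wcurl Omega F).
Proof.
move=> VC; have C2 := Vd_L2 VC.
have [||G VG GP] := @Vc_riesz (fun F => mip Omega C (wcurl Omega F)).
- move=> a F F' VF VF'; have [HF HF'] := (Vc_Hcurl VF, Vc_Hcurl VF').
  have Hl := Vc_Hcurl (Vc_sub.2 a _ _ VF VF').
  have [w2 w2'] := (wcurl_L2 HF, wcurl_L2 HF').
  have l2 : mL2 Omega (a *: wcurl Omega F + wcurl Omega F').
    by case: (mL2_subspace oOmega bOmega 1 3) => _; exact.
  rewrite ![mip Omega C _]mipC -(mipDl oOmega bOmega a w2 w2' C2).
  exact: (mip_ael oOmega bOmega (wcurl_L2 Hl) l2 C2 (wcurlDl oOmega bOmega a HF HF')).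
- move=> F VF F0; apply: mip_null0 => //; first exact/wcurl_L2/Vc_Hcurl.
  by apply: wcurl_null => //; exact: Vc_L2.
have : exists G, [set G | Vc G /\
    forall F, Vc F -> mip Omega G F = mip Omega C (wcurl Omega F)] G by exists G.
by move=> /getPex.
Qed.

Lemma rot_L2 C : Vd C -> mL2 Omega (rot C).
Proof. by move=> /rotP[/Vc_L2]. Qed.

Lemma Vc_null F : Vc F -> (forall G, Vc G -> mip Omega F G = 0) -> null Omega F.
Proof. by move=> VF F0; apply/(mip_null oOmega); [exact: Vc_L2|exact: F0]. Qed.

Lemma rot_null C : Vd C -> null Omega C -> null Omega (rot C).
Proof.
move=> VC C0; have [Vr rP] := rotP VC; apply: Vc_null => // F VF.
rewrite rP // mipC mip_null0 //; [exact/wcurl_L2/Vc_Hcurl|exact: Vd_L2].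
Qed.

Lemma rot_ae_lin : ae_lin Omega Vd (fun C => rot C).
Proof.
split=> [C|a C C' VC VC']; first exact: rot_L2.
have VD := Vd_sub.2 a _ _ VC VC'.
have [Vr rP] := rotP VC.
have [Vr' rP'] := rotP VC'.
have [Vs sP] := rotP VD.
have Vl' := Vc_sub.2 a _ _ Vr Vr'.
apply: (ae_eq_null Omega (rot (a *: C + C')) (a *: rot C + rot C')).2.
apply: Vc_null => [|F VF]; first exact: subspaceB.
have [ml _ _] := mipS 1 3; have F2 := Vc_L2 VF.
rewrite (linear_onB (mL2_subspace oOmega bOmega 1 3) (ml _ F2)); try exact: Vc_L2.
rewrite (mipDl oOmega bOmega a (Vc_L2 Vr) (Vc_L2 Vr') F2) sP // rP // rP' //.
rewrite (mipDl oOmega bOmega a (Vd_L2 VC) (Vd_L2 VC')) ?subrr //.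
exact/wcurl_L2/Vc_Hcurl.
Qed.

Lemma wgradv_ae_lin : ae_lin Omega Vh (fun u => wgradv Omega u).
Proof.
split=> [u /Vh_H1|a u v /Vh_H1 u1 /Vh_H1 v1]; first exact: wgradv_L2.
exact: wgradvDl.
Qed.

Lemma id_ae_lin : ae_lin Omega Vh (fun u => u).
Proof. by split=> [u|a u v _ _]; [exact: Vh_L2|exact: aeW]. Qed.

Lemma convect_ae_linr w : Vh w -> ae_lin Omega Vh (fun u => convect Omega w u).
Proof.
move=> Vw; split=> [u Vu|a u v Vu Vv].
  by apply: convect_L2; [|exact: Vh_Linf|exact: Vh_H1].
have := wgradvDl oOmega bOmega a (Vh_H1 Vu) (Vh_H1 Vv).
apply: ae_imply => x E Ox.
by rewrite /convect E // -[RHS]/(a *: (_ *m _) + _ *m _) mulmxDr scalemxAr.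
Qed.

Lemma convect_ae_linl u : Vh u -> ae_lin Omega Vh (fun w => convect Omega w u).
Proof.
move=> Vu; split=> [w Vw|a w w' Vw Vw'].
  by apply: convect_L2; [|exact: Vh_Linf|exact: Vh_H1].
apply: aeW => x _.
by rewrite /convect -[LHS]/((a *: w x + w' x) *m _) mulmxDl -scalemxAl.
Qed.

Lemma crossf_ae_linl G : Vd G -> ae_lin Omega Vh (fun u => crossf u G).
Proof.
move=> VG; split=> [u Vu|a u v Vu Vv].
  exact: (crossf_L2 oOmega bOmega (Vh_Linf Vu) (Vd_L2 VG)).
by apply: aeW => x _; apply/rowP => k; rewrite !mxE; ring.
Qed.

Lemma crossf_ae_linr u : Vh u -> ae_lin Omega Vd (fun G => crossf u G).
Proof.
move=> Vu; split=> [G VG|a G G' VG VG'].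
  exact: (crossf_L2 oOmega bOmega (Vh_Linf Vu) (Vd_L2 VG)).
by apply: aeW => x _; apply/rowP => k; rewrite !mxE; ring.
Qed.

Local Notation X := (vfield R * vfield R)%type.
Local Notation Xt := (Vh `*` Vd).
Local Notation Y := (Qh `*` Vl).

Definition energy (xi eta : X) : R :=
  Re^-1 * mip Omega (wgradv Omega xi.1) (wgradv Omega eta.1)
  + S * Rm ^- 2 * mip Omega (rot xi.2) (rot eta.2).

Definition coupling (psi xi eta : X) : R :=
  Lform Omega psi.1 xi.1 eta.1
  + S * Rm^-1 * mip Omega (rot xi.2) (crossf eta.1 psi.2)
  - S * Rm^-1 * mip Omega (crossf xi.1 psi.2) (rot eta.2).

Lemma aformE psi xi eta :
  aform Omega Vc Re Rm S psi xi eta = energy xi eta + coupling psi xi eta.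
Proof. by case: psi xi eta => [w G] [u B] [v C]; rewrite /aform /energy /coupling /=; ring. Qed.

Lemma Xt_sub : @subspace R X Xt.
Proof. exact: subspace_prod. Qed.

Lemma Xt_fin : @finite_mod R X (nullv `*` nullv) Xt.
Proof. exact: finite_mod_prod. Qed.

Lemma energy_semi_inner : @semi_inner R X Xt energy.
Proof.
split=> [eta [Vv VC]|xi eta _ _|xi [Vu VB]].
- have v2 := wgradv_L2 (Vh_H1 Vv); have C2 := rot_L2 VC.
  apply: linear_on_add; apply: linear_on_scale.
    exact: (linear_on_fst (ae_lin_mipl oOmega bOmega Vh_sub wgradv_ae_lin v2)).
  exact: (linear_on_snd (ae_lin_mipl oOmega bOmega Vd_sub rot_ae_lin C2)).
- rewrite /energy (mipC Omega (wgradv Omega xi.1)).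
  by rewrite (mipC Omega (rot xi.2)).
have [_ _ p3] := mipS 3 3; have [_ _ p1] := mipS 1 3.
rewrite /energy; apply: addr_ge0; apply: mulr_ge0.
- by rewrite invr_ge0 ltW.
- exact: (p3 _ (wgradv_L2 (Vh_H1 Vu))).
- by rewrite mulr_ge0 ?invr_ge0 ?exprn_ge0 // ltW.
- exact: (p1 _ (rot_L2 VB)).
Qed.

Lemma energy_null xi : Xt xi -> null Omega xi.1 -> null Omega xi.2 -> energy xi xi = 0.
Proof.
move=> [Vu VB] u0 B0; rewrite /energy.
rewrite mip_null0 ?mulr0 ?add0r //; try exact/wgradv_L2/Vh_H1; last first.
  by apply: wgradv_null => //; exact: Vh_H1.
rewrite mip_null0 ?mulr0 //; try exact: rot_L2.
exact: rot_null.
Qed.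

Lemma coupling_linear3 psi xi : Xt psi -> Xt xi -> @linear_on R X Xt (coupling psi xi).
Proof.
move=> [Vw VG] [Vu VB]; rewrite /coupling /Lform.
have u2 := Vh_L2 Vu; have r2 := rot_L2 VB.
have c2 := (convect_ae_linr Vw).1 _ Vu; have x2 := (crossf_ae_linl VG).1 _ Vu.
apply: linear_on_minus; [apply: linear_on_add|].
- apply: linear_on_scale; apply: linear_on_minus.
    exact: (linear_on_fst (ae_lin_mipr oOmega bOmega Vh_sub id_ae_lin c2)).
  exact: (linear_on_fst (ae_lin_mipl oOmega bOmega Vh_sub (convect_ae_linr Vw) u2)).
- apply: linear_on_scale.
  exact: (linear_on_fst (ae_lin_mipr oOmega bOmega Vh_sub (crossf_ae_linl VG) r2)).
- apply: linear_on_scale.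
  exact: (linear_on_snd (ae_lin_mipr oOmega bOmega Vd_sub rot_ae_lin x2)).
Qed.

Lemma coupling_linear2 psi eta : Xt psi -> Xt eta ->
  @linear_on R X Xt (fun xi => coupling psi xi eta).
Proof.
move=> [Vw VG] [Vv VC]; rewrite /coupling /Lform.
have v2 := Vh_L2 Vv; have r2 := rot_L2 VC.
have c2 := (convect_ae_linr Vw).1 _ Vv; have x2 := (crossf_ae_linl VG).1 _ Vv.
apply: linear_on_minus; [apply: linear_on_add|].
- apply: linear_on_scale; apply: linear_on_minus.
    exact: (linear_on_fst (ae_lin_mipl oOmega bOmega Vh_sub (convect_ae_linr Vw) v2)).
  exact: (linear_on_fst (ae_lin_mipr oOmega bOmega Vh_sub id_ae_lin c2)).
- apply: linear_on_scale.
  exact: (linear_on_snd (ae_lin_mipl oOmega bOmega Vd_sub rot_ae_lin x2)).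
- apply: linear_on_scale.
  exact: (linear_on_fst (ae_lin_mipl oOmega bOmega Vh_sub (crossf_ae_linl VG) r2)).
Qed.

Lemma coupling_linear1 xi eta : Xt xi -> Xt eta ->
  @linear_on R X Xt (fun psi => coupling psi xi eta).
Proof.
move=> [Vu VB] [Vv VC]; rewrite /coupling /Lform.
have [u2 v2] := (Vh_L2 Vu, Vh_L2 Vv); have [rB rC] := (rot_L2 VB, rot_L2 VC).
apply: linear_on_minus; [apply: linear_on_add|].
- apply: linear_on_scale; apply: linear_on_minus.
    exact: (linear_on_fst (ae_lin_mipl oOmega bOmega Vh_sub (convect_ae_linl Vu) v2)).
  exact: (linear_on_fst (ae_lin_mipl oOmega bOmega Vh_sub (convect_ae_linl Vv) u2)).
- apply: linear_on_scale.
  exact: (linear_on_snd (ae_lin_mipr oOmega bOmega Vd_sub (crossf_ae_linr Vv) rB)).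
- apply: linear_on_scale.
  exact: (linear_on_snd (ae_lin_mipl oOmega bOmega Vd_sub (crossf_ae_linr Vu) rC)).
Qed.

(** The convective part is skew by construction; the two Lorentz terms cancel,
    which is why the discrete curl appears in both. *)
Lemma coupling_skew psi xi : coupling psi xi xi = 0.
Proof.
rewrite /coupling /Lform subrr mulr0 add0r.
by rewrite [mip Omega (crossf _ _) _]mipC subrr.
Qed.

Lemma coupling_null psi xi eta : Xt psi -> Xt xi -> Xt eta ->
  null Omega eta.1 -> null Omega eta.2 -> coupling psi xi eta = 0.
Proof.
move=> [Vw VG] [Vu VB] [Vv VC] v0 C0; rewrite /coupling /Lform.
have c2 := (convect_ae_linr Vw).1 _ Vu; have c2' := (convect_ae_linr Vw).1 _ Vv.
have x2 := (crossf_ae_linl VG).1 _ Vu; have x2' := (crossf_ae_linl VG).1 _ Vv.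
have c0 : null Omega (convect Omega psi.1 eta.1).
  have := wgradv_null oOmega bOmega (Vh_H1 Vv) v0.
  by apply: ae_imply => x g0 Ox; rewrite /convect g0 // mulmx0.
have x0 : null Omega (crossf eta.1 psi.2).
  by apply: crossf_null; [exact: Vh_Linf|exact: Vd_L2|left].
rewrite (mip_null0 oOmega bOmega c2 (Vh_L2 Vv) v0).
rewrite mipC (mip_null0 oOmega bOmega (Vh_L2 Vu) c2' c0).
rewrite (mip_null0 oOmega bOmega (rot_L2 VB) x2' x0).
rewrite (mip_null0 oOmega bOmega x2 (rot_L2 VC) (rot_null VC C0)).
by rewrite !(subr0, mulr0, addr0).
Qed.

Local Notation W := ((pt R -> R^o) * (pt R -> R^o))%type.
Local Notation b := (bform Omega).

Lemma Vh_Hdiv : Vh `<=` Hdiv Omega.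
Proof. by move=> v /Vh_H1; exact: H1v_Hdiv. Qed.

Lemma bform_linear1 y : Y y -> @linear_on R X Xt (fun xi => b xi y).
Proof.
move=> [Qy Vy]; rewrite /bform.
apply: linear_on_add; first apply: linear_on_opp.
  exact: (linear_on_fst (wdiv_linear_on oOmega bOmega Vh_Hdiv Vh_sub (Qh_L2 Qy))).
exact: (linear_on_snd (wdiv_linear_on oOmega bOmega Vd_Hdiv Vd_sub (Vl_L2 Vy))).
Qed.

Lemma bform_linear2 xi : Xt xi -> @linear_on R W Y (b xi).
Proof.
move=> [Vv VC]; rewrite /bform.
have sL2 := L2_subspace oOmega bOmega; have sI := sip_semi_inner oOmega.
apply: linear_on_add; first apply: linear_on_opp.
  have l := semi_inner_linr sL2 sI (wdiv_L2 (Vh_Hdiv Vv)).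
  exact: (linear_on_fst (linear_on_sub Qh_L2 l)).
have l := semi_inner_linr sL2 sI (wdiv_L2 (Vd_Hdiv VC)).
exact: (linear_on_snd (linear_on_sub Vl_L2 l)).
Qed.

Definition sip2 (y z : W) : R := sip Omega y.1 z.1 + sip Omega y.2 z.2.

Lemma Y_sub : @subspace R W Y.
Proof. exact: subspace_prod. Qed.

Lemma sip2_semi_inner : @semi_inner R W Y sip2.
Proof.
have [sl sC s0] := sip_semi_inner oOmega.
split=> [z [Qz Vz]|y z _ _|y [Qy Vy]].
- apply: linear_on_add.
    exact: (linear_on_fst (linear_on_sub Qh_L2 (sl _ (Qh_L2 Qz)))).
  exact: (linear_on_snd (linear_on_sub Vl_L2 (sl _ (Vl_L2 Vz)))).
- rewrite /sip2 (sipC Omega y.1).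
  by rewrite (sipC Omega y.2).
- by apply: addr_ge0; apply: s0; [exact: Qh_L2|exact: Vl_L2].
Qed.

Lemma sip2_null y : Y y -> sip2 y y = 0 -> null Omega y.1 /\ null Omega y.2.
Proof.
move=> [/Qh_L2 y1 /Vl_L2 y2]; have [_ _ s0] := sip_semi_inner oOmega.
move=> /eqP; rewrite /sip2 paddr_eq0 ?s0 // => /andP[/eqP e1 /eqP e2].
by split; [apply/(sip_null oOmega)|apply/(sip_null oOmega)].
Qed.

Definition kerb : set X := [set xi | Xt xi /\ forall y, Y y -> b xi y = 0].

Lemma kerb_Xt : kerb `<=` Xt.
Proof. by move=> xi []. Qed.

Lemma kerb_sub : @subspace R X kerb.
Proof.
have [X0 Xl] := Xt_sub; split.
  by split=> // y Yy; exact: (linear_on0 Xt_sub (bform_linear1 Yy)).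
move=> a u v [Xu u0] [Xv v0]; split=> [|y Yy]; first exact: Xl.
by rewrite (bform_linear1 Yy) // u0 // v0 // mulr0 addr0.
Qed.

(** The divergence constraint is tested with wdiv B itself, which lies in the
    multiplier space, so that B is exactly divergence free and exactness
    applies. *)
Lemma energy_definite xi : kerb xi -> energy xi xi = 0 -> null Omega xi.1 /\ null Omega xi.2.
Proof.
move=> [[Vu VB] b0]; have [_ _ p3] := mipS 3 3; have [_ _ p1] := mipS 1 3.
have g2 := wgradv_L2 (Vh_H1 Vu); have r2 := rot_L2 VB; have B2 := Vd_L2 VB.
have Re0 : 0 < Re^-1 by rewrite invr_gt0.
have SR0 : 0 < S * Rm ^- 2 by rewrite mulr_gt0 // invr_gt0 exprn_gt0.
rewrite /energy => /eqP; rewrite paddr_eq0; last 2 first.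
- by rewrite mulr_ge0 ?(ltW Re0) //; exact: p3.
- by rewrite mulr_ge0 ?(ltW SR0) //; exact: p1.
move=> /andP[]; rewrite mulf_eq0 (gt_eqF Re0) /= => /eqP du0.
rewrite mulf_eq0 (gt_eqF SR0) /= => /eqP rB0.
have {}du0 := (mip_null oOmega g2).1 du0; have {}rB0 := (mip_null oOmega r2).1 rB0.
split.
  apply/null_entries => i j; rewrite (ord1 i).
  apply: (H10_null oOmega bOmega (Vh_H10 Vu j)).
  move/null_entries: du0 => /(_ 0 j); apply: ae_imply => x h Ox.
  by have := h Ox; rewrite mxE.
have d0 : null Omega (wdiv Omega xi.2).
  apply/(sip_null oOmega); first exact/wdiv_L2/Vd_Hdiv.
  have := b0 (0, wdiv Omega xi.2); rewrite /bform /=.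
  rewrite (sip_null0 oOmega bOmega (wdiv_L2 (Vh_Hdiv Vu)) (L2_cst oOmega bOmega 0)); last exact: aeW.
  rewrite oppr0 add0r; apply; split; [exact: Qh_sub.1|exact: div_Vd].
have [F VF BF] := potential VB d0.
have w2 := wcurl_L2 (Vc_Hcurl VF).
apply/(mip_null oOmega B2).
rewrite (mip_ael oOmega bOmega B2 w2 B2 BF) mipC -(rotP VB).2 // mipC.
exact: (mip_null0 oOmega bOmega (Vc_L2 VF) r2 rB0).
Qed.

(** The problem is first solved on the constrained pairs; the residual then
    vanishes on the common kernel of the multipliers, hence is a combination
    of them. *)
Theorem reduced_problem : exists xi x, [/\ Xt xi, Y x,
  forall eta, Xt eta -> aform Omega Vc Re Rm S xi xi eta + b eta x = f eta.1 &
  forall y, Y y -> b xi y = 0].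
Proof.
have eI := semi_inner_sub kerb_Xt energy_semi_inner.
have [|||n [e [eo efull]]] := @orthonormal_basis R X kerb energy kerb_sub eI (nullv `*` nullv).
- exact: (subspace_prod (null_subspace _ _) (null_subspace _ _)).
- by move=> xi /kerb_Xt Xxi [u0 B0]; exact: energy_null.
- exact: finite_mod_subset kerb_Xt Xt_fin.
have fl : @linear_on R X Xt (fun eta => f eta.1) by exact: (linear_on_fst f_lin).
have [||||||xi Zxi xiP] := @skew_variational R X kerb energy kerb_sub eI n e eo efull
    coupling (fun eta => f eta.1).
- by move=> u v /kerb_Xt Xu /kerb_Xt Xv; exact: (linear_on_sub kerb_Xt (coupling_linear3 Xu Xv)).
- by move=> u v /kerb_Xt Xu /kerb_Xt Xv; exact: (linear_on_sub kerb_Xt (coupling_linear2 Xu Xv)).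
- by move=> u v /kerb_Xt Xu /kerb_Xt Xv; exact: (linear_on_sub kerb_Xt (coupling_linear1 Xu Xv)).
- by move=> u v _ _; exact: coupling_skew.
- exact: (linear_on_sub kerb_Xt fl).
- move=> r Zr r0; have [u0 B0] := energy_definite Zr r0; have Xr := kerb_Xt Zr.
  split=> [|u v /kerb_Xt Xu /kerb_Xt Xv]; first by apply: f_null => //; case: Xr.
  exact: coupling_null.
have Xxi := kerb_Xt Zxi.
have al : @linear_on R X Xt (fun eta => energy xi eta + coupling xi xi eta).
  apply: linear_on_add; last exact: coupling_linear3.
  exact: (semi_inner_linr Xt_sub energy_semi_inner Xxi).
have [|||m [y [yo yfull]]] := @orthonormal_basis R W Y sip2 Y_sub sip2_semi_inner (nulls `*` nulls).
- exact: (subspace_prod (null_subspace _ _) (null_subspace _ _)).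
- move=> z [Qz Vz] [z1 z2]; rewrite /sip2.
  rewrite (sip_null0 oOmega bOmega (Qh_L2 Qz) (Qh_L2 Qz) z1).
  by rewrite (sip_null0 oOmega bOmega (Vl_L2 Vz) (Vl_L2 Vz) z2) addr0.
- exact: finite_mod_prod.
have b_null eta r : Xt eta -> Y r -> sip2 r r = 0 -> b eta r = 0.
  move=> [Vv VC] Yr r0; have [r1 r2] := sip2_null Yr r0; rewrite /bform.
  rewrite (sip_null0 oOmega bOmega (wdiv_L2 (Vh_Hdiv Vv)) (Qh_L2 Yr.1) r1).
  by rewrite (sip_null0 oOmega bOmega (wdiv_L2 (Vd_Hdiv VC)) (Vl_L2 Yr.2) r2) oppr0 addr0.
have [|||c cP] := @functional_in_span R X m (fun i eta => b eta (y i)) Xt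
    (fun eta => f eta.1 - (energy xi eta + coupling xi xi eta)) Xt_sub.
- by move=> i; apply: bform_linear1; exact: yo.1.
- exact: linear_on_minus.
- move=> eta Xeta b0; apply/eqP; rewrite subr_eq0 eq_sym; apply/eqP/xiP.
  split=> // z Yz; rewrite (linear_on_basis Y_sub yo yfull (bform_linear2 Xeta)) //.
    by rewrite big1 // => i _; rewrite b0 mulr0.
  by move=> r; exact: b_null.
exists xi, (\sum_i c i *: y i); split => //.
- by apply: subspace_sum; [exact: Y_sub|exact: yo.1].
- move=> eta Xeta; rewrite aformE.
  rewrite (linear_on_sum _ _ Y_sub (bform_linear2 Xeta)); last exact: yo.1.
  by rewrite -cP // addrC subrK.
- by case: Zxi.
Qed.

(** The eliminated unknowns are recovered as j = Rm^-1 rot B and sigma the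
    projection of u x B; the equations for (v, C) are those of the reduced
    problem with C = 0 and v = 0. *)
Theorem mixed_problem :
  exists (u j sigma B : vfield R) (p r : sfield R),
     [/\ Vh u, Vc j, Vc sigma & Vd B] /\ Qh p /\ Vl r /\
     forall (v k tau C : vfield R) (q s : sfield R),
       Vh v -> Vc k -> Vc tau -> Vd C -> Qh q -> Vl s ->
       (Re^-1 * mip Omega (wgradv Omega u) (wgradv Omega v)
          + Lform Omega u u v + S * mip Omega j (crossf v B)
          - sip Omega p (wdiv Omega v) = f v) /\
       (S * Rm^-1 * mip Omega (wcurl Omega j) C
          - S * Rm^-1 * mip Omega (wcurl Omega sigma) C
          + sip Omega r (wdiv Omega C) = 0) /\
       (S * Rm^-1 * mip Omega sigma tau
          - S * Rm^-1 * mip Omega (crossf u B) tau = 0) /\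
       (S * mip Omega j k - S * Rm^-1 * mip Omega B (wcurl Omega k) = 0) /\
       (- sip Omega (wdiv Omega u) q = 0) /\
       (sip Omega (wdiv Omega B) s = 0).
Proof.
have [xi [x [[Vu VB] [Qp Vr] eq_a eq_b]]] := reduced_problem.
set u := xi.1 in Vu; set B := xi.2 in VB; set p := x.1 in Qp; set r := x.2 in Vr.
have [VrB rBP] := rotP VB.
have uB2 : mL2 Omega (crossf u B) := (crossf_ae_linl VB).1 _ Vu.
have [||sigma Vsig sigP] := @Vc_riesz (fun F => mip Omega (crossf u B) F).
- have l := semi_inner_linr (mL2_subspace oOmega bOmega 1 3) (mipS 1 3) uB2.
  exact: (linear_on_sub Vc_L2 l).
- by move=> F VF F0; rewrite (mip_null0 oOmega bOmega uB2 (Vc_L2 VF) F0).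
pose j := Rm^-1 *: rot B.
have Vj : Vc j by exact: subspaceZ.
have jE G : mL2 Omega G -> mip Omega j G = Rm^-1 * mip Omega (rot B) G.
  move=> G2; have [ml _ _] := mipS 1 3.
  exact: (linear_onZ _ (mL2_subspace oOmega bOmega 1 3) (ml _ G2) (Vc_L2 VrB)).
have Xxi : Xt xi by split.
have V0 := Vh_sub.1; have D0 := Vd_sub.1.
exists u, j, sigma, B, p, r; split=> //; split=> //; split=> //.
move=> v k tau C q s Vv Vk Vtau VC Qq Vs.
have Rm_neq0 : Rm != 0 by rewrite gt_eqF.
have [v2 C2] := (Vh_L2 Vv, Vd_L2 VC).
split; [|split; [|split; [|split; [|split]]]].
- have := eq_a (v, 0) (conj Vv D0); rewrite aformE /energy /coupling /bform /= -/u -/B -/p -/r.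
  rewrite (jE _ ((crossf_ae_linl VB).1 _ Vv)).
  have -> : mip Omega (rot B) (rot 0) = 0.
    exact: (linear_on0 Vd_sub (ae_lin_mipr oOmega bOmega Vd_sub rot_ae_lin (Vc_L2 VrB))).
  have -> : mip Omega (crossf u B) (rot 0) = 0.
    exact: (linear_on0 Vd_sub (ae_lin_mipr oOmega bOmega Vd_sub rot_ae_lin uB2)).
  have -> : sip Omega (wdiv Omega 0) r = 0.
    exact: (linear_on0 Vd_sub (wdiv_linear_on oOmega bOmega Vd_Hdiv Vd_sub (Vl_L2 Vr))).
  rewrite (sipC Omega p) => <-; ring.
- have := eq_a (0, C) (conj V0 VC); rewrite aformE /energy /bform /= -/u -/B -/p -/r.
  rewrite (linear_on0 Vh_sub f_lin) /coupling /= -/u -/B.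
  have -> : mip Omega (wgradv Omega u) (wgradv Omega 0) = 0.
    exact: (linear_on0 Vh_sub (ae_lin_mipr oOmega bOmega Vh_sub wgradv_ae_lin (wgradv_L2 (Vh_H1 Vu)))).
  have -> : Lform Omega u u 0 = 0.
    rewrite /Lform.
    have -> : mip Omega (convect Omega u u) 0 = 0.
      exact: (linear_on0 Vh_sub (ae_lin_mipr oOmega bOmega Vh_sub id_ae_lin ((convect_ae_linr Vu).1 _ Vu))).
    have -> : mip Omega (convect Omega u 0) u = 0.
      exact: (linear_on0 Vh_sub (ae_lin_mipl oOmega bOmega Vh_sub (convect_ae_linr Vu) (Vh_L2 Vu))).
    by rewrite subrr mulr0.
  have -> : mip Omega (rot B) (crossf 0 B) = 0.
    exact: (linear_on0 Vh_sub (ae_lin_mipr oOmega bOmega Vh_sub (crossf_ae_linl VB) (Vc_L2 VrB))).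
  have -> : sip Omega (wdiv Omega 0) p = 0.
    exact: (linear_on0 Vh_sub (wdiv_linear_on oOmega bOmega Vh_Hdiv Vh_sub (Qh_L2 Qp))).
  have [VrC rCP] := rotP VC.
  rewrite (mipC Omega (wcurl Omega j)) -(rCP _ Vj) (mipC Omega (rot C)) (jE _ (Vc_L2 VrC)).
  rewrite (mipC Omega (wcurl Omega sigma)) -(rCP _ Vsig) (mipC Omega (rot C)) (sigP _ VrC).
  rewrite (sipC Omega r) -exprVn => <-; ring.
- by rewrite (sigP _ Vtau) subrr.
- by rewrite (jE _ (Vc_L2 Vk)) (rBP _ Vk) mulrA subrr.
- have := eq_b (q, 0) (conj Qq Vl_sub.1); rewrite /bform /= -/u -/B => {}eq_b.
  rewrite -[RHS]eq_b; apply/esym.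
  have dB := wdiv_L2 (Vd_Hdiv VB).
  have dB0 := sip_null0 oOmega bOmega dB (L2_cst oOmega bOmega 0) (aeW _ (fun=> fun=> erefl)).
  by rewrite [X in _ + X]dB0 addr0.
- have := eq_b (0, s) (conj Qh_sub.1 Vs); rewrite /bform /= -/u -/B => {}eq_b.
  rewrite -[RHS]eq_b; apply/esym.
  have du := wdiv_L2 (Vh_Hdiv Vu).
  have du0 := sip_null0 oOmega bOmega du (L2_cst oOmega bOmega 0) (aeW _ (fun=> fun=> erefl)).
  by rewrite [X in - X + _]du0 oppr0 add0r.
Qed.

End DiscreteProblem.

Unset Implicit Arguments.
Set Strict Implicit.
Set Printing Implicit Defensive.

Theorem theorem3 (R : realType) (Omega : set (pt R)) (Re Rm S : R)
  (c h : R) (Th : mesh R) (D : deRham_kind)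
  (Vh : set (vfield R)) (Qh : set (sfield R)) (f : vfield R -> R)
  (Omega_polyhedron : bounded_lipschitz_polyhedron Omega)
  (Omega_contractible : contractible Omega)
  (Re_gt0 : 0 < Re) (Rm_gt0 : 0 < Rm) (S_gt0 : 0 < S)
  (Th_triangulation : triangulation Omega Th)
  (c_gt0 : 0 < c) (Th_regular : regular_quasi_uniform c h Th)
  (Th_exact : exact_sequence Omega (H0hgrad Omega Th D) (H0hcurl Omega Th D)
     (H0hdiv Omega Th D) (L20h Omega Th D))
  (VQ_stable : stokes_pair Omega Th Vh Qh)
  (f_dual : dual_functional Omega Vh f) :
  let Vc := H0hcurl Omega Th D in
  let Vd := H0hdiv Omega Th D in
  let Vl := L20h Omega Th D in
  let Xt := Vh `*` Vd in
  let Y := Qh `*` Vl in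
  let a := aform Omega Vc Re Rm S in
  let b := bform Omega in
  (exists xi x, [/\ Xt xi, Y x,
     forall eta, Xt eta -> a xi xi eta + b eta x = f eta.1 &
     forall y, Y y -> b xi y = 0])
  /\
  (exists (u j sigma B : vfield R) (p r : sfield R),
     [/\ Vh u, Vc j, Vc sigma & Vd B] /\ Qh p /\ Vl r /\
     forall (v k tau C : vfield R) (q s : sfield R),
       Vh v -> Vc k -> Vc tau -> Vd C -> Qh q -> Vl s ->
       (Re^-1 * mip Omega (wgradv Omega u) (wgradv Omega v)
          + Lform Omega u u v + S * mip Omega j (crossf v B)
          - sip Omega p (wdiv Omega v) = f v) /\
       (S * Rm^-1 * mip Omega (wcurl Omega j) C
          - S * Rm^-1 * mip Omega (wcurl Omega sigma) C
          + sip Omega r (wdiv Omega C) = 0) /\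
       (S * Rm^-1 * mip Omega sigma tau
          - S * Rm^-1 * mip Omega (crossf u B) tau = 0) /\
       (S * mip Omega j k - S * Rm^-1 * mip Omega B (wcurl Omega k) = 0) /\
       (- sip Omega (wdiv Omega u) q = 0) /\
       (sip Omega (wdiv Omega B) s = 0)).
Proof.
move=> Vc Vd Vl Xt Y a b.
have [oO bO _ _] := Omega_polyhedron.
have cover : Omega `<=` mesh_cover Th.
  have [_ <- _] := Th_triangulation; exact: subset_closure.
have [[Vh_sub Qh_sub] Vh_H10 Qh_L20 [Th' [k [Th'_tri _ Vh_pw Qh_pw]]] _] := VQ_stable.
have cover' : Omega `<=` mesh_cover Th'.
  have [_ <- _] := Th'_tri; exact: subset_closure.
have [[_ _ div_Vd] _ _ Vd_exact _] := Th_exact.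
have [f_lin [Cf f_bound]] := f_dual.
have Vh_H1 v : Vh v -> H1v Omega v by move=> Vv i; case: (Vh_H10 _ Vv i).
have Vh_fin := finite_mod_subset Vh_pw (piecewise_finite_mod cover' (poly_field_spanned R k)).
have Qh_fin := @finite_mod_subset R (pt R -> R^o) _ _ _ Qh_pw
  (@piecewise_finite_mod R Omega Th' cover' R^o _ (poly_fun_spanned R k)).
have Vc_sub : subspace Vc.
  have [c0 cl] := H0curl_subspace oO bO.
  have [p0 pl] := piecewise_subspace Th (edge_local_subspace R (edge_elt D) (edge_order D)).
  by split=> [|t u v [cu pu] [cv pv]]; [split|split; [exact: cl|exact: pl]].
have Vd_sub : subspace Vd.
  have [c0 cl] := H0div_subspace oO bO.
  have [p0 pl] := piecewise_subspace Th (face_local_subspace R (face_elt D) (face_order D)).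
  by split=> [|t u v [cu pu] [cv pv]]; [split|split; [exact: cl|exact: pl]].
have Vl_sub : @subspace R (pt R -> R^o) Vl.
  have [p0 pl] := @piecewise_subspace R Th R^o _ (poly_fun_subspace R (dg_degree D)).
  have [c0 cl] := L20_subspace oO bO.
  by split=> [|t u v [cu pu] [cv pv]]; [split|split; [exact: cl|exact: pl]].
have Vc_fin : finite_mod (@null R Omega 'rV[R]_3) Vc.
  apply: finite_mod_subset (piecewise_finite_mod cover (edge_local_spanned R (edge_elt D) (edge_order D))).
  by move=> F [].
have Vd_fin : finite_mod (@null R Omega 'rV[R]_3) Vd.
  apply: finite_mod_subset (piecewise_finite_mod cover (face_local_spanned R (face_elt D) (face_order D))).
  by move=> F [].
have Vl_fin : @finite_mod R (pt R -> R^o) (@null R Omega R) Vl.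
  apply: (@finite_mod_subset R (pt R -> R^o) _ (piecewise Th (poly_fun (dg_degree D)))).
    by move=> F [].
  exact: (@piecewise_finite_mod R Omega Th cover R^o _ (poly_fun_spanned R (dg_degree D))).
have Vh_Linf v : Vh v -> Linfv Omega v.
  move=> Vv i; split; first by have [[]] := Vh_H1 v Vv i.
  apply: (piecewise_bounded bO cover') => K KTh.
  have [q qk vq] := Vh_pw _ Vv K KTh.
  exists (fun x => q x 0 i); first exact: poly_fun_continuous (qk i).
  by apply: ae_imply vq => x vx Kx; rewrite vx.
have Vc_Hcurl : Vc `<=` Hcurl Omega by move=> F [/H0curl_Hcurl].
have Vd_Hdiv : Vd `<=` Hdiv Omega by move=> F [/H0div_Hdiv].
have Qh_L2 : Qh `<=` L2 Omega by move=> q /Qh_L20[].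
have Vl_L2 : Vl `<=` L2 Omega by move=> q [[]].
have potential B : Vd B -> null Omega (wdiv Omega B) ->
    exists2 F, Vc F & ae_eq (leb3 R) Omega B (wcurl Omega F).
  by move=> VB; exact: (Vd_exact B VB).1.
have f_null v : Vh v -> null Omega v -> f v = 0.
  move=> Vv v0; have := f_bound v Vv; rewrite /h1norm.
  have v1 := Vh_H1 v Vv; have v2 := H1v_L2 v1; have g2 := wgradv_L2 v1.
  rewrite (mip_null0 oO bO v2 v2 v0).
  rewrite (mip_null0 oO bO g2 g2 (wgradv_null oO bO v1 v0)).
  by rewrite addr0 sqrtr0 mulr0 normr_le0 => /eqP.
split.
  exact: (reduced_problem oO bO Re_gt0 Rm_gt0 S_gt0 Vh_sub Vc_sub Vd_sub Qh_sub Vl_sub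
    Vh_fin Vc_fin Vd_fin Qh_fin Vl_fin Vh_H10 Vh_Linf Vc_Hcurl Vd_Hdiv Qh_L2 Vl_L2
    div_Vd potential f_lin f_null).
exact: (mixed_problem oO bO Re_gt0 Rm_gt0 S_gt0 Vh_sub Vc_sub Vd_sub Qh_sub Vl_sub
    Vh_fin Vc_fin Vd_fin Qh_fin Vl_fin Vh_H10 Vh_Linf Vc_Hcurl Vd_Hdiv Qh_L2 Vl_L2
    div_Vd potential f_lin f_null).
Qed.
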